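(* Let $0<\alpha\le1$, let $\{\mathcal{S}^\alpha(t)\}_{t\ge0}$ be the generalized fractional Skellam process with rates $\lambda_j,\mu_j>0$, $j=1,\dots,k$, let $\{H_f(t)\}_{t\ge0}$ be an independent inverse subordinator, and let $\bar{\mathcal{Z}}_f^\alpha(t)=\mathcal{S}^\alpha(H_f(t))$. Put $m_1=\sum_{j=1}^kj(\lambda_j-\mu_j)$, $m_2=\sum_{j=1}^kj^2(\lambda_j+\mu_j)$, $l_1=m_1/\Gamma(1+\alpha)$, $l_2=m_2/\Gamma(1+\alpha)$, $d=\alpha l_1^2B(\alpha,1+\alpha)$. Then for $0<s\le t<\infty$: (i) $\mathbb{E}(\bar{\mathcal{Z}}_f^\alpha(t))=l_1\mathbb{E}(H_f^\alpha(t))$; (ii) $\operatorname{Var}(\bar{\mathcal{Z}}_f^\alpha(t))=\mathbb{E}(H_f^\alpha(t))\big(l_2-l_1^2\mathbb{E}(H_f^\alpha(t))\big)+2d\,\mathbb{E}(H_f^{2\alpha}(t))$; (iii) $\operatorname{Cov}(\bar{\mathcal{Z}}_f^\alpha(s),\bar{\mathcal{Z}}_f^\alpha(t))=l_2\mathbb{E}(H_f^\alpha(s))+d\,\mathbb{E}(H_f^{2\alpha}(s))-l_1^2\mathbb{E}(H_f^\alpha(s))\mathbb{E}(H_f^\alpha(t))+l_1^2\alpha\,\mathbb{E}\big(H_f^{2\alpha}(t)B(\alpha,\alpha+1;H_f(s)/H_f(t))\big)$.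
   Context: Fix an integer $k\ge1$ and positive rates $\lambda_1,\dots,\lambda_k,\mu_1,\dots,\mu_k$. The generalized counting process (GCP) with rates $\lambda_1,\dots,\lambda_k$ is a Lévy process started at $0$ performing jumps of size $j\in\{1,\dots,k\}$ at rate $\lambda_j$. The generalized Skellam process (GSP) is $\mathcal{S}(t)=M_1(t)-M_2(t)$, with $M_1,M_2$ independent GCPs with rates $\lambda_j$ and $\mu_j$, respectively. For $0<\alpha<1$, the inverse stable subordinator is $Y_\alpha(t)=\inf\{x\ge0: D_\alpha(x)>t\}$, where $D_\alpha$ is the stable subordinator, $\mathbb{E}(e^{-sD_\alpha(t)})=e^{-ts^\alpha}$. The generalized fractional Skellam process (GFSP) is $\mathcal{S}^\alpha(t)=\mathcal{S}(Y_\alpha(t))$ for $0<\alpha<1$ with $\mathcal{S}$ and $Y_\alpha$ independent, and $\mathcal{S}^1(t)=\mathcal{S}(t)$. A Lévy subordinator $\{D_f(t)\}_{t\ge0}$ is a one-dimensional Lévy process with non-decreasing sample paths, $D_f(0)=0$ a.s., and $\mathbb{E}(e^{-sD_f(t)})=e^{-tf(s)}$, $s>0$, where $f$ is its Bernštein function. The inverse subordinator is $H_f(t)=\inf\{x\ge0:D_f(x)>t\}$; it is known that $\mathbb{E}(H_f^r(t))<\infty$ for all $r>0$. The process $\bar{\mathcal{Z}}_f^\alpha$ is called the time-changed generalized fractional Skellam process-II (TCGFSP-II). $B(a,b)$ is the beta function and $B(a,b;x)=\int_0^xu^{a-1}(1-u)^{b-1}\mathrm{d}u$ is the incomplete beta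 function. *)

(* Defs.v *)
From HB Require Import structures.
From mathcomp Require Import all_boot all_order all_algebra.
From mathcomp Require Import all_classical all_reals all_analysis.

Set Implicit Arguments.
Unset Strict Implicit.
Unset Printing Implicit Defensive.

Import Order.TTheory GRing.Theory Num.Theory.
Import numFieldNormedType.Exports.

Local Open Scope classical_set_scope.
Local Open Scope ring_scope.

(* The library's beta_fun only takes natural number arguments. *)
Definition Gamma (R : realType) (a : R) : R :=
  \int[lebesgue_measure]_(x in `[0%R, +oo[) (x `^ (a - 1) * expR (- x)).

Definition incBeta (R : realType) (a b x : R) : R :=
  \int[lebesgue_measure]_(u in `[0%R, x]) (u `^ (a - 1) * (1 - u) `^ (b - 1)).

Definition Beta (R : realType) (a b : R) : R := incBeta a b 1.

(* A process is a family X : R -> T -> R; only the times t >= 0 matter. *)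

Definition process_sigma (R : realType) (d : measure_display)
    (T : measurableType d) (X : R -> T -> R) : set (set T) :=
  <<s [set A | exists (t : R) (B : set R),
         [/\ 0 <= t, measurable B & A = X t @^-1` B]] >>.

Definition indep_processes (R : realType) (d : measure_display)
    (T : measurableType d) (P : probability T R) (X Y : R -> T -> R) : Prop :=
  forall A B : set T, process_sigma X A -> process_sigma Y B ->
    P (A `&` B) = (P A * P B)%E.

Definition cadlag (R : realType) (x : R -> R) : Prop :=
  (forall t : R, 0 <= t -> x u @[u --> t^'+] --> x t) /\
  (forall t : R, 0 < t -> cvg (x u @[u --> t^'-])).

Record is_levy (R : realType) (d : measure_display) (T : measurableType d)
    (P : probability T R) (X : R -> T -> R) : Prop := IsLevy {
  levy_measurable : forall t : R, 0 <= t -> measurable_fun setT (X t);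
  levy_start : {ae P, forall w, X 0 w = 0};
  levy_indep_increments : forall (n : nat) (t : nat -> R) (B : nat -> set R),
    0 <= t 0%N -> (forall i, t i <= t i.+1) -> (forall i, measurable (B i)) ->
    P (\bigcap_(i < n) [set w | B i (X (t i.+1) w - X (t i) w)]) =
    (\prod_(i < n) P [set w | B i (X (t i.+1) w - X (t i) w)%R])%E;
  levy_stationary_increments : forall (s t : R) (B : set R),
    0 <= s -> s <= t -> measurable B ->
    P [set w | B (X t w - X s w)] = P [set w | B (X (t - s) w)];
  levy_cadlag : forall w, cadlag (fun t => X t w)
}.

(* Index i : 'I_k stands for the jump size j = i + 1.  The jump rates are those
   of the infinitesimal transition probabilities
     P(M(t+h) = n + j | M(t) = n) = lam_j h + o(h),        1 <= j <= k,
     P(M(t+h) = n     | M(t) = n) = 1 - (sum_j lam_j) h + o(h),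
   which by stationarity and independence of the increments are P(M(h) = j)
   and P(M(h) = 0); all other transitions thus have probability o(h). *)
Record is_gcp (R : realType) (d : measure_display) (T : measurableType d)
    (P : probability T R) (k : nat) (lam : 'I_k -> R) (M : R -> T -> R)
    : Prop := IsGCP {
  gcp_levy : is_levy P M;
  gcp_jump_rate : forall i : 'I_k,
    fine (P [set w | M h w = i.+1%:R]) / h @[h --> 0^'+] --> lam i;
  gcp_total_rate :
    (1 - fine (P [set w | M h w = 0])) / h @[h --> 0^'+] --> \sum_(i < k) lam i
}.

Definition is_gsp (R : realType) (d : measure_display) (T : measurableType d)
    (P : probability T R) (k : nat) (lam mu : 'I_k -> R) (S : R -> T -> R)
    : Prop :=
  exists M1 M2 : R -> T -> R,
    [/\ is_gcp P lam M1, is_gcp P mu M2, indep_processes P M1 M2 &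
        forall (t : R) w, 0 <= t -> S t w = M1 t w - M2 t w].

(* The Laplace exponent f is determined on ]0, +oo[ by D, and is automatically
   a Bernstein function; its values on ]-oo, 0] are irrelevant. *)
Record is_subordinator (R : realType) (d : measure_display)
    (T : measurableType d) (P : probability T R) (f : R -> R) (D : R -> T -> R)
    : Prop := IsSubordinator {
  subordinator_levy : is_levy P D;
  subordinator_nondecreasing : forall w (s t : R), 0 <= s -> s <= t ->
    D s w <= D t w;
  subordinator_laplace : forall s t : R, 0 < s -> 0 <= t ->
    ('E_P[(fun w => expR (- (s * D t w)))] = (expR (- (t * f s)))%:E)%E
}.

(* In R the infimum of the empty set is 0.  For every nonzero Laplace exponent,
   D is almost surely unbounded and the set below almost surely nonempty. *)
Definition inverse_subordinator (R : realType) (T : Type) (D : R -> T -> R)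
    (t : R) (w : T) : R :=
  inf [set x | 0 <= x /\ t < D x w].

Definition is_gfsp (R : realType) (d : measure_display) (T : measurableType d)
    (P : probability T R) (alpha : R) (k : nat) (lam mu : 'I_k -> R)
    (Sa : R -> T -> R) : Prop :=
  exists S : R -> T -> R, is_gsp P lam mu S /\
    ((alpha = 1 /\ forall (t : R) w, 0 <= t -> Sa t w = S t w) \/
     (0 < alpha < 1 /\
      exists D : R -> T -> R,
        let Y := inverse_subordinator D in
        [/\ is_subordinator P (fun s => s `^ alpha) D,
            indep_processes P S Y &
            forall (t : R) w, 0 <= t -> Sa t w = S (Y t w) w])).

(* Main.v *)
Require Import Defs.
From HB Require Import structures.
From mathcomp Require Import all_boot all_order all_algebra.
From mathcomp Require Import all_classical all_reals all_analysis.
From mathcomp Require Import measurable_realfun ring lra.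

Set Implicit Arguments.
Unset Strict Implicit.
Unset Printing Implicit Defensive.

Import Order.TTheory GRing.Theory Num.Theory.
Import numFieldNormedType.Exports.

Local Open Scope classical_set_scope.
Local Open Scope ring_scope.

(** The first two moments of a generalized counting process M are read off its
    Laplace transform: the infinitesimal jump rates give
    E exp(-theta M(h)) = 1 + h c(theta) + o(h) as h decreases to 0, hence
    E exp(-theta M(t)) = exp(t c(theta)) by independence of the increments, and
    one lets theta decrease to 0.

    For a stable subordinator D with inverse Y, the potential measure
    t |-> \int P(D(x) <= t) dx has the Laplace transform s^-alpha of
    t^alpha / Gamma(1 + alpha), and therefore equals it (Hausdorff moment
    problem for exp(-D)).  This is E Y(t).  The mixed moment E Y(s) Y(t), with
    s <= t, comes from the pathwise identity
      \int \int 1{D(x) <= s, D(x + h) <= t} dh dx = Y(s) Y(t) - Y(s)^2 / 2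
    by conditioning on D(x); the outer integral against the potential measure
    is the incomplete beta integral.

    Finally, if E X(s) X(t) = c(s, t) for s <= t and Y is a nonnegative process
    independent of X, then E X(Y(s)) X(Y(t)) = E c(Y(s), Y(t)) as soon as
    Y(s) <= Y(t) almost surely.  This is applied twice, to the inverse stable
    subordinator and to H_f. *)

(** * Independent pairs and processes *)

(** Three obstacles shape the argument. The product of Lebesgue measure and [P] is infinite, so
    [exp(-D)] has no finite zeroth moment: only polynomials vanishing at 0 can be compared, and the
    comparison of distribution functions needs two thresholds [a < b], whose gap closes because
    [t^alpha] is continuous. The definition of a counting process prescribes only rates at time 0,
    so nonnegativity of [M] has to be derived: the rates leave mass [o(h)] for other values, and the
    probability of a negative value is subadditive in time. Finally the infimum of the empty set is
    0, which destroys pathwise monotonicity of an inverse subordinator; minima and maxima of the two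
    random times are carried along until an almost sure order removes them. For a general [f]
    everything rests on [f 1]. If it is positive, [P(D(x) <= t) <= exp(t - x f(1))] bounds the
    second moment of [H_f], which suffices because [alpha] and [2 alpha] are at most 2. If it is
    zero, [D] almost surely vanishes and [H_f(t) = 0] by the convention on the infimum. *)

Section independent_pair.
Local Open Scope ereal_scope.
Context {R : realType} {d d1 d2 : measure_display} {T : measurableType d}
  {T1 : measurableType d1} {T2 : measurableType d2}.
Variables (P : probability T R) (f : T -> T1) (g : T -> T2).
Hypotheses (mf : measurable_fun setT f) (mg : measurable_fun setT g).
Hypothesis indep : forall A B, measurable A -> measurable B ->
  P (f @^-1` A `&` g @^-1` B) = P (f @^-1` A) * P (g @^-1` B).

Let f' : {mfun T >-> T1} := mfun_Sub (mem_set mf).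
Let g' : {mfun T >-> T2} := mfun_Sub (mem_set mg).
Let h : T -> T1 * T2 := fun w => (f w, g w).
Let mh : measurable_fun setT h.
Proof. exact: measurable_fun_pair. Qed.
Let h' : {mfun T >-> (T1 * T2)%type} := mfun_Sub (mem_set mh).

(** The hypothesis speaks of rectangles only; uniqueness of the product measure extends it to all
    measurable sets of pairs. *)
Let joint A : measurable A ->
  (distribution P f' \x distribution P g') A = distribution P h' A.
Proof.
apply: product_measure_unique => B C mB mC.
by rewrite -[RHS]indep.
Qed.

(** Tonelli for the product law. The target spaces are arbitrary measurable types because the time
    change below takes for [f] the identity into [T] with a smaller sigma-algebra. *)
Lemma ge0_integral_indep (F : T1 * T2 -> \bar R) :
  measurable_fun [set: T1 * T2] F -> (forall z, 0 <= F z) ->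
  \int[P]_w F (f w, g w) = \int[P]_w' \int[P]_w F (f w, g w').
Proof.
move=> mF F0.
rewrite -(ge0_integral_distribution h' mF F0).
rewrite -(eq_measure_integral _ (fun A mA _ => joint mA)).
rewrite fubini_tonelli2// ge0_integral_distribution//; last 2 first.
  exact: measurable_fun_fubini_tonelli_G.
  by move=> y; exact: integral_ge0.
apply: eq_integral => w' _ /=.
rewrite /fubini_G ge0_integral_distribution//.
exact: measurable_fun_pair1.
Qed.

Lemma measurable_integral_indep (F : T1 * T2 -> \bar R) :
  measurable_fun [set: T1 * T2] F -> (forall z, 0 <= F z) ->
  measurable_fun setT (fun y => \int[P]_w F (f w, y)).
Proof.
move=> mF F0.
have := measurable_fun_fubini_tonelli_G (m1 := distribution P f') F mF F0.
apply: eq_measurable_fun => y _; rewrite /fubini_G ge0_integral_distribution//.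
exact: measurable_fun_pair1.
Qed.

Lemma integrable_indep (F : T1 * T2 -> \bar R) :
  measurable_fun [set: T1 * T2] F ->
  \int[P]_w' \int[P]_w `|F (f w, g w')| < +oo ->
  P.-integrable setT (fun w => F (f w, g w)).
Proof.
move=> mF Foo; apply/integrableP; split.
  exact: (measurableT_comp mF mh).
by have := ge0_integral_indep (measurableT_comp (@abse_measurable _ _) mF)
  (fun=> abse_ge0 _) => /= ->.
Qed.

Lemma integral_indep (F : T1 * T2 -> \bar R) :
  measurable_fun [set: T1 * T2] F ->
  \int[P]_w' \int[P]_w `|F (f w, g w')| < +oo ->
  \int[P]_w F (f w, g w) = \int[P]_w' \int[P]_w F (f w, g w').
Proof.
move=> mF Foo; have iF := integrable_indep mF Foo.
have Ep := ge0_integral_indep (measurable_funepos mF) (funepos_ge0 F).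
have En := ge0_integral_indep (measurable_funeneg mF) (funeneg_ge0 F).
transitivity (\int[P]_w F^\+ (f w, g w) - \int[P]_w F^\- (f w, g w)).
  by rewrite [LHS](integralE P setT (F \o h)) funepos_comp funeneg_comp.
rewrite {}Ep {}En.
have mFp := measurable_integral_indep (measurable_funepos mF) (funepos_ge0 F).
have mFn := measurable_integral_indep (measurable_funeneg mF) (funeneg_ge0 F).
rewrite -integralB//.
- apply: eq_integral => w' _.
  pose q w := (f w, g w').
  by rewrite [RHS](integralE P setT (F \o q)) (funepos_comp F q) (funeneg_comp F q).
- apply/integrableP; split; first exact: (measurableT_comp mFp).
  apply: le_lt_trans Foo; apply: ge0_le_integral => //.
  + by apply: measurableT_comp => //; exact: (measurableT_comp mFp).
  + exact: (measurableT_comp (measurable_integral_indep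
      (measurableT_comp (@abse_measurable _ _) mF) (fun=> abse_ge0 _))).
  + move=> w' _; rewrite gee0_abs ?integral_ge0//; apply: ge0_le_integral => //.
    * apply: (measurableT_comp (measurable_funepos mF)).
      exact: measurable_fun_pair.
    * do 2 apply: measurableT_comp => //; exact: measurable_fun_pair.
    * by move=> w _; rewrite -[leRHS]/((abse \o F) (f w, g w')) fune_abse leeDl// funeneg_ge0.
- apply/integrableP; split; first exact: (measurableT_comp mFn).
  apply: le_lt_trans Foo; apply: ge0_le_integral => //.
  + by apply: measurableT_comp => //; exact: (measurableT_comp mFn).
  + exact: (measurableT_comp (measurable_integral_indep
      (measurableT_comp (@abse_measurable _ _) mF) (fun=> abse_ge0 _))).
  + move=> w' _; rewrite gee0_abs ?integral_ge0//; apply: ge0_le_integral => //.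
    * apply: (measurableT_comp (measurable_funeneg mF)).
      exact: measurable_fun_pair.
    * do 2 apply: measurableT_comp => //; exact: measurable_fun_pair.
    * by move=> w _; rewrite -[leRHS]/((abse \o F) (f w, g w')) fune_abse leeDr// funepos_ge0.
Qed.

End independent_pair.

(** Right-continuity makes the process a pointwise limit of processes that are constant in time on
    the cells of a grid, hence jointly measurable. The clamp [Num.max 0] appears because nothing is
    known at negative times. *)
Lemma measurable_process (R : realType) (d : measure_display)
    (T : measurableType d) (X : R -> T -> R) :
  (forall t, 0 <= t -> measurable_fun setT (X t)) ->
  (forall w t, 0 <= t -> X u w @[u --> t^'+] --> X t w) ->
  measurable_fun [set: R * T] (fun z => X (Num.max 0 z.1) z.2).
Proof.
move=> mX cX.
(* The first multiple of [1/(n+1)] strictly above [max 0 u]; strictness is what a limit from the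
   right asks for. *)
pose g (n : nat) (u : R) : R := (Num.trunc (Num.max 0 u * n.+1%:R)).+1%:R / n.+1%:R.
have gt n u : Num.max 0 u < g n u.
  rewrite /g ltr_pdivlMr// ?ltr0n//; have : 0 <= Num.max 0 u * n.+1%:R.
    by rewrite mulr_ge0// le_max lexx.
  by move=> /truncn_itv/andP[].
have gle n u : g n u <= Num.max 0 u + n.+1%:R^-1.
  rewrite /g -natr1 mulrDl mul1r lerD2r ler_pdivrMr ?ltr0n//.
  have : 0 <= Num.max 0 u * n.+1%:R by rewrite mulr_ge0// le_max lexx.
  by move=> /truncn_itv/andP[].
apply: (@measurable_fun_cvg _ _ _ _ (fun n z => X (g n z.1) z.2)).
  move=> n.
  pose E k : set (R * T) :=
    (fun z => Num.trunc (Num.max 0 z.1 * n.+1%:R)) @^-1` [set k].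
  have mE k : measurable (E k).
    have mm : measurable_fun [set: R * T] (fun z => Num.max 0 z.1 * n.+1%:R).
      apply: measurable_funM => //; exact: measurable_maxr.
    rewrite (_ : E k = (fun z => Num.max 0 z.1 * n.+1%:R) @^-1`
        [set` `[k%:R, k.+1%:R[]); last first.
      apply/seteqP; split => z; rewrite /E /= in_itv/=.
        move=> <-; apply: truncn_itv.
        by rewrite mulr_ge0// le_max lexx.
      by move=> /truncn_def.
    by rewrite -[X in measurable X]setTI; exact: mm.
  rewrite (_ : setT = \bigcup_k E k); last first.
    by apply/seteqP; split => // z _; exists (Num.trunc (Num.max 0 z.1 * n.+1%:R)).
  apply/measurable_fun_bigcup => // k.
  apply: (@eq_measurable_fun _ _ _ _ _ (fun z => X (k.+1%:R / n.+1%:R) z.2)).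
    by move=> z; rewrite inE /E/= => zk; rewrite /g zk.
  apply: measurable_funTS; apply: measurableT_comp => //; exact: mX.
move=> [u w] _ /=.
have : g n u @[n --> \oo] --> Num.max 0 u.
  apply: (@squeeze_cvgr _ _ _ _ (fun=> Num.max 0 u) (fun n => Num.max 0 u + n.+1%:R^-1)).
  - by apply: nearW => n; rewrite gle (ltW (gt _ _)).
  - exact: cvg_cst.
  - rewrite -[X in _ --> X]addr0; apply: cvgD; first exact: cvg_cst.
    exact: cvg_harmonic.
move=> gu.
have := cX w (Num.max 0 u); rewrite le_max lexx => /(_ isT) /cvg_at_rightP.
by apply; split.
Qed.

(** * A Hausdorff moment comparison *)

(** The bound [(1 - y)^N <= 1 / (1 + N y)], kept free of division; it controls how far
    [x * step_poly] stays below 1. *)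
Lemma bernoulli_inv (R : realFieldType) (y : R) N : 0 <= y <= 1 ->
  (1 - y) ^+ N * (1 + N%:R * y) <= 1.
Proof.
move=> /andP[y0 y1]; elim: N => [|N IH]; first by rewrite expr0 mul0r addr0 mulr1.
apply: le_trans IH; rewrite exprSr -mulrA ler_wpM2l ?exprn_ge0 ?subr_ge0//.
rewrite -natr1; have : 0 <= N%:R :> R by []; nra.
Qed.

(** The factor [X] in front of [q] restricts the comparison to polynomials without constant term,
    since constants may have infinite integral. *)
Lemma integral_mulX_horner_eq (R : realType) d1 d2 (T1 : measurableType d1)
    (T2 : measurableType d2) (m1 : {measure set T1 -> \bar R})
    (m2 : {measure set T2 -> \bar R}) (D1 : set T1) (D2 : set T2)
    (X1 : T1 -> R) (X2 : T2 -> R) (q : {poly R}) :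
  measurable D1 -> measurable D2 ->
  (forall n, m1.-integrable D1 (fun x => (X1 x ^+ n.+1)%:E)) ->
  (forall n, m2.-integrable D2 (fun x => (X2 x ^+ n.+1)%:E)) ->
  (forall n, \int[m1]_(x in D1) (X1 x ^+ n.+1)%:E =
             \int[m2]_(x in D2) (X2 x ^+ n.+1)%:E)%E ->
  (\int[m1]_(x in D1) (X1 x * q.[X1 x])%:E =
   \int[m2]_(x in D2) (X2 x * q.[X2 x])%:E)%E.
Proof.
move=> mD1 mD2 i1 i2 E.
have aux d (T : measurableType d) (m : {measure set T -> \bar R}) (D : set T) (X : T -> R) :
    measurable D -> (forall n, m.-integrable D (fun x => (X x ^+ n.+1)%:E)) ->
    (\int[m]_(x in D) (X x * q.[X x])%:E =
     \sum_(i < size q) (q`_i)%:E * \int[m]_(x in D) (X x ^+ i.+1)%:E)%E.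
  move=> mD iX.
  under eq_integral => x _.
    rewrite horner_coef mulr_sumr -sumEFin.
    under eq_bigr => i _ do rewrite mulrCA -exprS EFinM.
    over.
  rewrite integral_sum//; last by move=> i; exact: integrableZl.
  by apply: eq_bigr => i _; rewrite integralZl.
by rewrite !aux//; apply: eq_bigr => i _; rewrite E.
Qed.

(* [1 - (1 - x ^ m) ^ N] with [N] about [b ^ - m] is a polynomial approximation of the indicator function of [x > b]. *)
Definition step_poly (R : realType) (b : R) (m : nat) : {poly R} :=
  'X^m * \sum_(i < Num.trunc (b ^- m.+1)) (1 - 'X^(m.+1)) ^+ i.

(** With [y = x^(m+1)], the geometric sum telescopes: [y] times the sum of [(1 - y)^i] over [i < N]
    is [1 - (1 - y)^N]. *)
Lemma step_polyE (R : realType) (b x : R) (m : nat) :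
  x * (step_poly b m).[x] = 1 - (1 - x ^+ m.+1) ^+ (Num.trunc (b ^- m.+1)).
Proof.
rewrite /step_poly hornerM hornerXn mulrA -exprS horner_sum.
under eq_bigr => i _ do rewrite horner_exp !hornerE.
set N := Num.trunc _.
have /= := subrXX 1 (1 - x ^+ m.+1) N.
rewrite expr1n subKr => ->; congr (_ * _).
by apply: eq_bigr => i _; rewrite expr1n mul1r.
Qed.

(** Every term of the geometric sum is at most 1 and there are at most [b^-(m+1)] of them. The bound
    tends to 0 with growing [m] when [x < b]. *)
Lemma step_poly_le (R : realType) (b x : R) (m : nat) : 0 < b -> 0 <= x <= 1 ->
  0 <= x * (step_poly b m).[x] <= (x / b) ^+ m.+1.
Proof.
move=> b0 /andP[x0 x1]; rewrite /step_poly hornerM hornerXn mulrA -exprS horner_sum.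
under eq_bigr => i _ do rewrite horner_exp !hornerE.
have y0 : 0 <= x ^+ m.+1 by exact: exprn_ge0.
have y1 : x ^+ m.+1 <= 1 by exact: exprn_ile1.
apply/andP; split.
  by apply: mulr_ge0 => //; apply: sumr_ge0 => i _; rewrite exprn_ge0// subr_ge0.
rewrite expr_div_n ler_wpM2l//.
apply: (@le_trans _ _ (\sum_(i < Num.trunc (b ^- m.+1)) 1)).
  by apply: ler_sum => i _; rewrite exprn_ile1 ?subr_ge0// lerBlDr lerDl.
rewrite sumr_const card_ord.
have : 0 <= b ^- m.+1 by rewrite invr_ge0 exprn_ge0// ltW.
by move=> /truncn_itv/andP[].
Qed.

Lemma step_poly_ge (R : realType) (b x : R) (m : nat) : 0 < b -> 0 < x <= 1 ->
  1 - (b / x) ^+ m.+1 <= x * (step_poly b m).[x].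
Proof.
move=> b0 /andP[x0 x1]; rewrite step_polyE lerD2l lerN2.
have y0 : 0 < x ^+ m.+1 by exact: exprn_gt0.
have y1 : x ^+ m.+1 <= 1 by rewrite exprn_ile1// ltW.
set N := Num.trunc _.
have := @bernoulli_inv _ (x ^+ m.+1) N; rewrite (ltW y0) y1 => /(_ isT) H.
have : 0 <= b ^- m.+1 by rewrite invr_ge0 exprn_ge0// ltW.
move=> /truncn_itv/andP[_]; rewrite -/N -natr1 => HN.
have bm : 0 < b ^+ m.+1 by rewrite exprn_gt0.
rewrite expr_div_n ler_pdivlMr//.
apply: (@le_trans _ _ (b ^+ m.+1 * ((1 - x ^+ m.+1) ^+ N * (1 + N%:R * x ^+ m.+1)))); last first.
  by rewrite ler_piMr// ltW.
rewrite mulrCA ler_wpM2l ?exprn_ge0 ?subr_ge0//.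
move: HN; rewrite -[X in X < _]mulr1 mulrC ltr_pdivrMr// => HN.
(* Since [x^(m+1) <= 1], one has [1 + N x^(m+1) >= (N + 1) x^(m+1)], and [(N + 1) b^(m+1) > 1] by
   the choice of [N]. *)
nra.
Qed.

(** Integrating a polynomial approximation of a step at a level between [a] and [b] gives the same
    value on both sides. The two distinct thresholds absorb the region around the step, where the
    approximation is poor. *)
Lemma hausdorff_le (R : realType) d1 d2 (T1 : measurableType d1)
    (T2 : measurableType d2) (m1 : {measure set T1 -> \bar R})
    (m2 : {measure set T2 -> \bar R}) (D1 : set T1) (D2 : set T2)
    (X1 : T1 -> R) (X2 : T2 -> R) (a b : R) :
  measurable D1 -> measurable D2 ->
  measurable_fun D1 X1 -> measurable_fun D2 X2 ->
  (forall x, D1 x -> 0 <= X1 x <= 1) -> (forall x, D2 x -> 0 <= X2 x <= 1) ->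
  (\int[m1]_(x in D1) (X1 x)%:E < +oo)%E ->
  (forall n, \int[m1]_(x in D1) (X1 x ^+ n.+1)%:E =
             \int[m2]_(x in D2) (X2 x ^+ n.+1)%:E)%E ->
  0 < a -> a < b ->
  (m1 (D1 `&` [set x | (b <= X1 x)%R]) <= m2 (D2 `&` [set x | (a <= X2 x)%R]))%E.
Proof.
move=> mD1 mD2 mX1 mX2 X1b X2b fin E a0 ab.
have b0 := lt_trans a0 ab.
have int d (T : measurableType d) (m : {measure set T -> \bar R}) (D : set T) (X : T -> R) :
    measurable D -> measurable_fun D X -> (forall x, D x -> 0 <= X x <= 1) ->
    (\int[m]_(x in D) (X x)%:E < +oo)%E ->
    forall n, m.-integrable D (fun x => (X x ^+ n.+1)%:E).
  move=> mD mX Xb f n; apply: (@le_integrable _ _ _ m D mD _ (EFin \o X)).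
  - by apply/measurable_EFinP; exact: measurable_funX.
  - move=> x Dx; have /andP[x0 x1] := Xb x Dx.
    rewrite lee_fin !ger0_norm ?exprn_ge0// exprS ler_piMr// exprn_ile1//.
  - apply/integrableP; split; first exact/measurable_EFinP.
    rewrite (eq_integral (EFin \o X))// => x /set_mem Dx /=.
    by rewrite ger0_norm//; have /andP[] := Xb x Dx.
have fin2 : (\int[m2]_(x in D2) (X2 x)%:E < +oo)%E.
  by have := E 0%N; rewrite /= => <-.
have i1 := int _ _ m1 D1 X1 mD1 mX1 X1b fin.
have i2 := int _ _ m2 D2 X2 mD2 mX2 X2b fin2.
have mE d (T : measurableType d) (D : set T) (X : T -> R) c :
    measurable D -> measurable_fun D X -> measurable (D `&` [set x | c <= X x]).
  move=> mD mX; rewrite (_ : [set x | c <= X x] = X @^-1` `[c, +oo[).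
    exact: mX.
  by apply/seteqP; split=> x /=; rewrite in_itv/= andbT.
set E1 := D1 `&` _; set E2 := D2 `&` _.
have mE1 : measurable E1 by exact: mE.
have mE2 : measurable E2 by exact: mE.
(* The step is placed strictly inside, so that both error ratios [c / b] and [a / c] are below 1. *)
have [c ac cb] : exists2 c, a < c & c < b by exists ((a + b) / 2); lra.
have c0 := lt_trans a0 ac.
have mq d (T : measurableType d) (D : set T) (X : T -> R) (q : {poly R}) :
    measurable_fun D X -> measurable_fun D (fun x => X x * q.[X x]).
  move=> mX; apply: measurable_funM => //.
  rewrite (_ : (fun x => q.[X x]) = (fun x => \sum_(i < size q) q`_i * X x ^+ i)).
    by apply: measurable_sum => i; apply: measurable_funM => //; exact: measurable_funX.
  by apply/funext => x; rewrite horner_coef.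
(* On [E1] the polynomial is at least [1 - (c/b)^(k+1)]. Off [E2] it is at most [(X2/c)^(k+1)]; one
   factor [X2/c] is kept unestimated, because the first moment is finite while the measure may not
   be. *)
have key k : ((1 - (c / b) ^+ k.+1)%:E * m1 E1 <=
    m2 E2 + ((a / c) ^+ k / c)%:E * \int[m2]_(x in D2) (X2 x)%:E)%E.
  apply: (@le_trans _ _ (\int[m1]_(x in D1) (X1 x * (step_poly c k).[X1 x])%:E)%E).
    apply: (@le_trans _ _ (\int[m1]_(x in E1) (X1 x * (step_poly c k).[X1 x])%:E)%E).
      rewrite -integral_cst//; apply: ge0_le_integral => //.
      - move=> x _; rewrite lee_fin subr_ge0 exprn_ile1// ?divr_ge0 ?ltW//.
        by rewrite ltr_pdivrMr// mul1r.
      - apply/measurable_EFinP; apply: measurable_funS (mq _ _ D1 X1 _ mX1) => //.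
        exact: subIsetl.
      - move=> x [Dx /= bx]; rewrite lee_fin.
        have /andP[_ x1] := X1b x Dx.
        have x0 : 0 < X1 x by exact: lt_le_trans bx.
        apply: le_trans (step_poly_ge _ c0 _); last by rewrite x0.
        have : c / X1 x <= c / b by rewrite ler_pM2l// lef_pV2.
        by rewrite lerD2l lerN2; apply: lerXn2r; rewrite nnegrE divr_ge0// ltW.
    apply: ge0_subset_integral => //.
    - by apply/measurable_EFinP; exact: mq.
    - by move=> x Dx; rewrite lee_fin; have /andP[] := step_poly_le k c0 (X1b x Dx).
    - exact: subIsetl.
  rewrite (integral_mulX_horner_eq _ mD1 mD2 i1 i2 E).
  rewrite -ge0_integralZl//=; last 3 first.
  - exact/measurable_EFinP.
  - by move=> x /X2b/andP[]; rewrite lee_fin.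
  - by rewrite lee_fin divr_ge0 ?exprn_ge0 ?divr_ge0 ?ltW.
  have mi : measurable_fun D2 (fun x => (\1_E2 x)%:E : \bar R).
    by apply/measurable_EFinP; apply: measurable_funTS; exact: measurable_indic.
  have -> : (m2 E2 = \int[m2]_(x in D2) (\1_E2 x)%:E)%E.
    by rewrite integral_indic// setIidl//; exact: subIsetl.
  rewrite -ge0_integralD//; last 2 first.
  - move=> x /X2b/andP[x0 _]; rewrite -EFinM lee_fin mulr_ge0// divr_ge0 ?exprn_ge0 ?divr_ge0 ?ltW//.
  - apply/measurable_EFinP; exact: measurable_funM.
  apply: ge0_le_integral => //.
  - by move=> x Dx; rewrite lee_fin; have /andP[] := step_poly_le k c0 (X2b x Dx).
  - by apply/measurable_EFinP; exact: mq.
  - by apply: emeasurable_funD => //; apply/measurable_EFinP; exact: measurable_funM.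
  - move=> x Dx; have /andP[x0 x1] := X2b x Dx.
    rewrite -EFinM -EFinD lee_fin indicE; have [xa|xa] := leP a (X2 x).
      rewrite mem_set//.
      apply: (@le_trans _ _ 1); last first.
        by rewrite lerDl mulr_ge0// divr_ge0 ?exprn_ge0 ?divr_ge0 ?ltW.
      rewrite step_polyE lerBlDr lerDl exprn_ge0// subr_ge0 exprn_ile1//.
    rewrite memNset ?add0r; last by move=> [_ /=]; rewrite leNgt xa.
    have /andP[_ H] := step_poly_le k c0 (X2b x Dx).
    apply: (le_trans H); rewrite exprSr -mulrA (mulrC c^-1) ler_wpM2r ?divr_ge0//; first exact: ltW.
    have : X2 x / c <= a / c by rewrite ler_pM2r ?invr_gt0// ltW.
    by apply: lerXn2r; rewrite nnegrE divr_ge0// ltW.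
have := leey (m2 E2); rewrite le_eqVlt => /predU1P[->|Bfin]; first by rewrite leey.
have A0 := measure_ge0 m1 E1; have B0 := measure_ge0 m2 E2.
have C0 : (0 <= \int[m2]_(x in D2) (X2 x)%:E)%E.
  by apply: integral_ge0 => x /X2b/andP[]; rewrite lee_fin.
have Bf : m2 E2 \is a fin_num by rewrite ge0_fin_numE.
have Cf : (\int[m2]_(x in D2) (X2 x)%:E)%E \is a fin_num by rewrite ge0_fin_numE.
(* Already [key] at [k = 0] forces this, the factor [1 - c/b] being positive. *)
have Af : m1 E1 \is a fin_num.
  rewrite ge0_fin_numE// ltey; apply/eqP => Aoo.
  have := key 0%N; rewrite Aoo -(fineK Bf) -(fineK Cf) -EFinM -EFinD expr1.
  by rewrite gt0_muley ?lte_fin ?subr_gt0 ?ltr_pdivrMr ?mul1r// leye_eq.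
move: key; rewrite -(fineK Af) -(fineK Bf) -(fineK Cf).
move: (fine _) (fine _) (fine _) => C B A key.
rewrite lee_fin.
have {}key k : (1 - c / b * (c / b) ^+ k) * A <= B + C / c * (a / c) ^+ k.
  have := key k; rewrite -!EFinM -EFinD lee_fin exprS.
  by rewrite (mulrAC C) (mulrC C) (mulrAC _ C).
have lim1 : (1 - c / b * (c / b) ^+ k) * A @[k --> \oo] --> (1 - c / b * 0) * A.
  apply: cvgMl; apply: cvgB; first exact: cvg_cst.
  apply: cvgMr; apply: cvg_expr.
  by rewrite ger0_norm ?divr_ge0 ?ltW// ltr_pdivrMr ?mul1r.
have lim2 : B + C / c * (a / c) ^+ k @[k --> \oo] --> B + C / c * 0.
  apply: cvgD; first exact: cvg_cst.
  apply: cvgMr; apply: cvg_expr.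
  by rewrite ger0_norm ?divr_ge0 ?ltW// ltr_pdivrMr ?mul1r.
suff: (1 - c / b * 0) * A <= B + C / c * 0.
  by rewrite !mulr0 subr0 mul1r addr0.
by apply: (ler_cvg_to lim1 lim2); exact: nearW.
Qed.

(** * Layer cake formula *)

Lemma measurable_set_le (R : realType) d (T : measurableType d) (f g : T -> R) :
  measurable_fun setT f -> measurable_fun setT g -> measurable [set x | f x <= g x].
Proof.
move=> mf mg; rewrite (_ : [set x | _] = (fun x => f x <= g x) @^-1` [set true])//.
by rewrite -[X in measurable X]setTI; exact: measurable_fun_ler.
Qed.

Lemma measurable_set_lt (R : realType) d (T : measurableType d) (f g : T -> R) :
  measurable_fun setT f -> measurable_fun setT g -> measurable [set x | f x < g x].
Proof.
move=> mf mg; rewrite (_ : [set x | _] = (fun x => f x < g x) @^-1` [set true])//.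
by rewrite -[X in measurable X]setTI; exact: measurable_fun_ltr.
Qed.

Section layer_cake.
Context {R : realType} {d : measure_display} {T : measurableType d}.
Variable m : {sigma_finite_measure set T -> \bar R}.
Local Notation mu := (@lebesgue_measure R).

Let layer_cakeT (h : T -> R) : measurable_fun setT h -> (forall x, 0 <= h x) ->
  (\int[m]_x (h x)%:E = \int[mu]_(y in `]0%R, +oo[) m [set x | (y <= h x)%R])%E.
Proof.
move=> mh h0.
pose E : set (T * measurableTypeR R) := [set z | 0 < z.2 /\ z.2 <= h z.1].
have mE : measurable E.
  apply: measurableI; first exact: measurable_set_lt.
  by apply: measurable_set_le => //; exact: measurableT_comp.
transitivity (\int[m]_x \int[mu]_y (\1_E (x, y))%:E)%E.
  apply: eq_integral => x _.
  rewrite (_ : (fun y => (\1_E (x, y))%:E) = (fun y => (\1_(`]0%R, h x]%classic : set R) y)%:E)).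
    rewrite integral_indic//= setIT lebesgue_measure_itv/= lte_fin.
    have := h0 x; rewrite le_eqVlt => /predU1P[<-|->]; first by rewrite ltxx.
    by rewrite sube0.
  apply/funext => y; rewrite !indicE; congr ((_ : bool)%:R%:E).
  by apply/idP/idP; rewrite !inE /E/= in_itv/= => /andP.
rewrite (fubini_tonelli (fun z : T * measurableTypeR R => (\1_E z)%:E))//=; last first.
  by apply/measurable_EFinP; exact: measurable_indic.
rewrite [RHS]integral_mkcond; apply: eq_integral => y _.
rewrite patchE; case: ifPn => [|]; rewrite ?inE ?notin_setE/= in_itv/= andbT => y0.
  rewrite (_ : (fun x => _) = (fun x => (\1_[set x | y <= h x] x)%:E)).
    rewrite integral_indic ?setIT//=.
    exact: measurable_set_le.
  apply/funext => x; rewrite !indicE; congr ((_ : bool)%:R%:E).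
  by apply/idP/idP; rewrite !inE /E/=; [case|].
rewrite -[RHS]/0%E; apply: integral0_eq => x _; rewrite indicE memNset// /E/= => -[].
by move=> /y0.
Qed.

(** Tonelli on the region [0 < y <= h x]. It reduces the equality of two integrals to that of the
    measures of superlevel sets, the only information available about the potential measure. *)
Lemma layer_cake (D : set T) (h : T -> R) : measurable D ->
  measurable_fun D h -> (forall x, D x -> 0 <= h x) ->
  (\int[m]_(x in D) (h x)%:E =
   \int[mu]_(y in `]0%R, +oo[) m (D `&` [set x | (y <= h x)%R]))%E.
Proof.
move=> mD mh h0.
transitivity (\int[m]_x ((h \_ D) x)%:E)%E.
  rewrite integral_mkcond; apply: eq_integral => x _.
  by rewrite !patchE; case: ifP.
rewrite layer_cakeT.
- apply: eq_integral => y; rewrite inE/= in_itv/= andbT => y0; congr (m _).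
  apply/seteqP; split => x /=; rewrite patchE.
    by case: ifPn => [/set_mem//|_]; rewrite leNgt y0.
  by move=> [Dx ?]; rewrite mem_set.
- exact/(measurable_restrictT _ mD).
- by move=> x; rewrite patchE; case: ifPn => // /set_mem; exact: h0.
Qed.

End layer_cake.

(** * Gamma and incomplete beta integrals *)

Section gamma.
Context {R : realType}.
Local Notation mu := (@lebesgue_measure R).

Lemma integral_expRN_tail (a : R) :
  (\int[mu]_(x in `[a, +oo[) (expR (- x))%:E = (expR (- a))%:E)%E.
Proof.
rewrite (@ge0_continuous_FTC2y _ _ (fun x => - expR (- x)) a 0).
- by rewrite sub0e -EFinN opprK.
- by move=> x _; exact: expR_ge0.
- apply: continuous_subspaceT => x; apply: continuous_comp.
    exact: continuousN.
  exact: continuous_expR.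
- rewrite -oppr0; apply: cvgN; exact: cvgr_expR.
- by move=> x _.
- apply: cvg_at_right_filter; apply: cvgN; apply: continuous_comp.
    exact: continuousN.
  exact: continuous_expR.
- move=> x _; rewrite derive1E.
  have D1 : is_derive x (1 : R) (expR \o -%R) (expR (- x) * - 1).
    exact: is_derive1_comp.
  have D : is_derive x (1 : R) (- (expR \o -%R)) (- (expR (- x) * - 1)).
    exact: is_deriveN.
  rewrite (_ : (fun _ => _) = - (expR \o -%R))//.
  by rewrite derive_val mulrN1 opprK.
Qed.

Lemma powR_invK (a v x : R) : 0 < a -> 0 <= v -> 0 <= x ->
  (v <= x `^ a) = (v `^ a^-1 <= x).
Proof.
move=> a0 v0 x0; apply/idP/idP => h.
  have := ge0_ler_powR (ltW (etrans (invr_gt0 a) a0)) v0 (powR_ge0 x a) h.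
  by rewrite -powRrM mulfV ?gt_eqF// powRr1.
have := ge0_ler_powR (ltW a0) (powR_ge0 v _) x0 h.
by rewrite -powRrM mulVf ?gt_eqF// powRr1.
Qed.

(** From [x^a <= 1 + x <= 2 exp(x/2)]: half of the exponential decay absorbs the power, which leaves
    an integrable majorant for the Gamma integral. *)
Lemma powR_expRN_le (a x : R) : 0 <= a <= 1 -> 0 <= x ->
  x `^ a * expR (- x) <= 2 * expR (- (x / 2)).
Proof.
move=> /andP[a0 a1] x0.
have h : x `^ a <= 1 + x.
  have [x1|x1] := leP 1 x; last first.
    by have := @ge0_ler_powR _ a a0 x 1; rewrite !nnegrE powR1 => /(_ x0 ler01 (ltW x1)); lra.
  by rewrite (le_trans (ler1_powR x1 a1))// lerDr.
have h2 : 1 + x <= 2 * expR (x / 2).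
  have := expR_ge1Dx (x / 2); lra.
have -> : expR (- (x / 2)) = expR (x / 2) * expR (- x).
  by rewrite -expRD; congr expR; lra.
by rewrite mulrA ler_wpM2r ?expR_ge0// (le_trans h).
Qed.

Lemma integral_Gamma (a : R) : 0 < a <= 1 ->
  (\int[mu]_(x in `[0%R, +oo[) (x `^ a * expR (- x))%:E = (Gamma (1 + a))%:E)%E.
Proof.
move=> /andP[a0 a1]; rewrite /Gamma /Rintegral addrAC subrr add0r fineK//.
rewrite ge0_fin_numE; last first.
  by apply: integral_ge0 => x _; rewrite lee_fin mulr_ge0// ?powR_ge0 ?expR_ge0.
have half : 0 < 2^-1 :> R by rewrite invr_gt0.
(* The constant 4 arises because [2 exp(-x/2)] is 4 times the exponential density of rate 1/2. *)
apply: (@le_lt_trans _ _ (\int[mu]_x (4 * exponential_pdf 2^-1 x)%:E)%E); last first.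
  under eq_integral do rewrite EFinM.
  rewrite ge0_integralZl//=.
  - by rewrite integral_exponential_pdf// mule1 ltry.
  - by apply/measurable_EFinP; exact: measurable_exponential_pdf.
  - by move=> x _; rewrite lee_fin exponential_pdf_ge0// ltW.
rewrite [leLHS]integral_mkcond; apply: ge0_le_integral => //=.
- by move=> x _; rewrite patchE; case: ifP => // _; rewrite lee_fin mulr_ge0// ?powR_ge0 ?expR_ge0.
- apply/(measurable_restrictT _ (measurable_itv `[0%R, +oo[)); apply/measurable_EFinP.
  apply: measurable_funTS; apply: measurable_funM; first exact: measurable_powR.
  apply: measurableT_comp => //.
- apply/measurable_EFinP; apply: measurable_funM => //; exact: measurable_exponential_pdf.
- move=> x _; rewrite patchE; case: ifPn => [|_]; last first.
    by rewrite lee_fin mulr_ge0// exponential_pdf_ge0// ltW.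
  rewrite inE/= in_itv/= andbT => x0; rewrite lee_fin.
  rewrite exponential_pdfE//.
  have := @powR_expRN_le a x; rewrite (ltW a0) a1 => /(_ isT x0) h.
  by apply: (le_trans h); rewrite mulNr (mulrC _ x) mulrA; lra.
Qed.

(** Tonelli in place of a substitution: [exp(-v^(1/a))] is the integral of [exp(-x)] over
    [x >= v^(1/a)], that is, over [v <= x^a]; integrating [v] first gives [x^a exp(-x)]. *)
Lemma integral_expRN_powR (a : R) : 0 < a <= 1 ->
  (\int[mu]_(v in `[0%R, +oo[) (expR (- (v `^ a^-1)))%:E = (Gamma (1 + a))%:E)%E.
Proof.
move=> ha; have /andP[a0 a1] := ha; rewrite -integral_Gamma//.
pose E : set (measurableTypeR R * measurableTypeR R) :=
  [set z | z.1 <= z.2 `^ a].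
have mE : measurable E.
  apply: measurable_set_le => //.
  exact: (measurableT_comp (measurable_powR a) (@measurable_snd _ _ _ _)).
pose D : set R := `[0%R, +oo[%classic.
have inD y : (y \in D) = (0 <= y).
  by apply/idP/idP; rewrite inE /D/= in_itv/= andbT.
pose F (z : measurableTypeR R * measurableTypeR R) : \bar R :=
  (\1_D z.1 * \1_D z.2 * \1_E z * expR (- z.2))%:E.
have mF : measurable_fun setT F.
  apply/measurable_EFinP; apply: measurable_funM; last first.
    by apply: measurableT_comp => //; exact: measurableT_comp.
  apply: measurable_funM; last exact: measurable_indic.
  have mi : measurable_fun [set: R] (\1_D : R -> R).
    by apply: measurable_indic; exact: measurable_itv.
  apply: measurable_funM.
    exact: (measurableT_comp mi (@measurable_fst _ _ _ _)).
  exact: (measurableT_comp mi (@measurable_snd _ _ _ _)).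
have F0 z : (0 <= F z)%E.
  by rewrite lee_fin !mulr_ge0 ?expR_ge0.
transitivity (\int[mu]_v \int[mu]_x F (v, x))%E.
  rewrite integral_mkcond; apply: eq_integral => v _.
  rewrite patchE /F/=; case: ifPn => vD; last first.
    rewrite [RHS]integral0_eq// => x _; rewrite indicE (negbTE vD).
    by rewrite !mul0r.
  move: vD; rewrite inE/= in_itv/= andbT => v0.
  rewrite -integral_expRN_tail integral_mkcond; apply: eq_integral => x _.
  have -> : \1_D v = 1 :> R by rewrite indicE inD v0.
  rewrite mul1r patchE (indicE _ D) (indicE _ E).
  have -> : (x \in `[v `^ a^-1, +oo[%classic) = (x \in D) && ((v, x) \in E).
    apply/idP/andP; rewrite inD !inE/= !in_itv/= !andbT /E/=.
      move=> vx; have x0 : 0 <= x by rewrite (le_trans _ vx)// powR_ge0.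
      by rewrite powR_invK.
    by move=> [x0]; rewrite powR_invK.
  by case: (x \in D); case: ((v, x) \in E); rewrite ?(mulr1, mulr0, mul0r, mul1r).
rewrite fubini_tonelli//.
rewrite [RHS]integral_mkcond; apply: eq_integral => x _.
rewrite patchE /F/=; case: ifPn => xD; last first.
  rewrite integral0_eq// => v _; rewrite [_ x]indicE (negbTE xD).
  by rewrite !mulr0 !mul0r.
move: xD; rewrite inE/= in_itv/= andbT => x0.
transitivity (\int[mu]_v ((expR (- x))%:E * (\1_(`[0%R, x `^ a]%classic : set R) v)%:E))%E.
  apply: eq_integral => v _; rewrite -EFinM; congr EFin.
  have -> : \1_D x = 1 :> R by rewrite indicE inD x0.
  rewrite mulr1 mulrC (indicE _ D) (indicE _ E) indicE -natrM mulnb; congr (_ * (_ : bool)%:R).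
  apply/andP/idP; rewrite inD !inE/= !in_itv/= /E/=; first by case=> -> ->.
  by move=> /andP[-> ->].
rewrite ge0_integralZl//=; last first.
  by apply/measurable_EFinP; exact: measurable_indic.
rewrite integral_indic//= setIT lebesgue_measure_itv/= lte_fin.
have := powR_ge0 x a; rewrite le_eqVlt => /predU1P[<-|->].
  by rewrite ltxx mule0 mul0r.
by rewrite sube0 -EFinM mulrC.
Qed.

Lemma Gamma_gt0 (a : R) : 0 < a <= 1 -> 0 < Gamma (1 + a).
Proof.
move=> ha; have /andP[a0 a1] := ha; rewrite -lte_fin -integral_expRN_powR//.
apply: (@lt_le_trans _ _ (\int[mu]_(v in `[0%R, 1%R]) (expR (- 1))%:E)%E).
  rewrite integral_cst//= lebesgue_measure_itv/= lte01 sube0 mule1.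
  by rewrite lte_fin expR_gt0.
apply: (@le_trans _ _ (\int[mu]_(v in `[0%R, 1%R]) (expR (- (v `^ a^-1)))%:E)%E).
  apply: ge0_le_integral => //.
  - apply/measurable_EFinP; apply: measurable_funTS; apply: measurableT_comp => //.
    by apply: measurableT_comp => //; exact: measurable_powR.
  - move=> x /=; rewrite in_itv/= => /andP[x0 x1]; rewrite lee_fin ler_expR lerN2.
    by rewrite -powR_invK// powR1.
apply: ge0_subset_integral => //.
- apply/measurable_EFinP; apply: measurable_funTS; apply: measurableT_comp => //.
  by apply: measurableT_comp => //; exact: measurable_powR.
- exact: subset_itvl.
Qed.

(** Under Lebesgue measure on the half-line, [(c x)^(1/a)] has distribution function [b^a / c]. With
    [c = Gamma(1 + a)] it is the deterministic model of the potential measure. *)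
Lemma lebesgue_measure_powR_le (a c b : R) : 0 < a -> 0 < c -> 0 <= b ->
  mu (`[0%R, +oo[ `&` [set x | (c * x) `^ a^-1 <= b]) = (b `^ a / c)%:E.
Proof.
move=> a0 c0 b0.
rewrite (_ : _ `&` _ = `[0, b `^ a / c]%classic).
  rewrite lebesgue_measure_itv/= lte_fin.
  have : 0 <= b `^ a / c by rewrite divr_ge0 ?powR_ge0// ltW.
  by rewrite le_eqVlt => /predU1P[<-|->]; rewrite ?ltxx ?sube0.
apply/seteqP; split=> x /=; rewrite !in_itv/= ?andbT.
  move=> [x0 h]; rewrite x0/= ler_pdivlMr// mulrC.
  by rewrite powR_invK// mulr_ge0// ltW.
move=> /andP[x0]; rewrite ler_pdivlMr// mulrC => h; split => //.
by rewrite -powR_invK// mulr_ge0// ltW.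
Qed.

(** The layer cake formula turns both integrals into integrals of explicit level-set measures, in
    which [c] and [r] enter only as the factor [r^(-a) / c]. *)
Lemma integral_expRN_powR_scale (a c r : R) : 0 < a <= 1 -> 0 < c -> 0 < r ->
  (\int[mu]_(x in `[0%R, +oo[) (expR (- (r * (c * x) `^ a^-1)))%:E =
   (r `^ (- a) / c * Gamma (1 + a))%:E)%E.
Proof.
move=> ha; have /andP[a0 a1] := ha.
have level c' r' y : 0 < c' -> 0 < r' -> 0 < y ->
    mu (`[0%R, +oo[ `&` [set x | y <= expR (- (r' * (c' * x) `^ a^-1))]) =
    (if y <= 1 then ((- ln y) / r') `^ a / c' else 0)%:E.
  move=> c0 r0 y0; case: ifPn => [y1|]; last first.
    rewrite -ltNge => y1; rewrite (_ : _ `&` _ = set0) ?measure0//.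
    apply/seteqP; split => x //= [x0]; rewrite leNgt (le_lt_trans _ y1)//.
    by rewrite -[leRHS]expR0 ler_expR oppr_le0 mulr_ge0 ?powR_ge0// ltW.
  rewrite -lebesgue_measure_powR_le//; last first.
    by rewrite divr_ge0 ?(ltW r0)// oppr_ge0 ln_le0.
  congr (mu (_ `&` _)); apply/funext => x; apply/propext => /=.
  rewrite -[X in X <= expR _](lnK y0) ler_expR lerNr mulrC ler_pdivlMr// mulrC.
have cake c' r' : 0 < c' -> 0 < r' ->
    (\int[mu]_(x in `[0%R, +oo[) (expR (- (r' * (c' * x) `^ a^-1)))%:E =
     \int[mu]_(y in `]0%R, +oo[) (if (y <= 1)%R then ((- ln y) / r') `^ a / c' else 0)%:E)%E.
  move=> c0 r0; rewrite layer_cake//=.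
  - apply: eq_integral => y; rewrite inE/= in_itv/= andbT => y0.
    by rewrite -level.
  - apply: measurable_funTS; apply: measurableT_comp => //; apply: measurableT_comp => //.
    apply: measurable_funM => //; apply: (measurableT_comp (measurable_powR _)).
    exact: measurable_funM.
move=> c0 r0; rewrite EFinM -integral_expRN_powR//.
transitivity ((r `^ (- a) / c)%:E *
    \int[mu]_(v in `[0%R, +oo[) (expR (- (1 * (1 * v) `^ a^-1)))%:E)%E; last first.
  by congr (_ * _)%E; apply: eq_integral => v _; rewrite !mul1r.
rewrite !cake// -ge0_integralZl//=; last 3 first.
- apply: measurable_funTS; apply/measurable_EFinP; apply: measurable_fun_ifT => //.
    exact: measurable_fun_ler.
  apply: measurable_funM => //; apply: (measurableT_comp (measurable_powR _)).
  by apply: measurable_funM => //; apply: measurableT_comp => //; exact: measurable_ln.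
- move=> y; case: ifP => _; rewrite lee_fin// divr_ge0 ?powR_ge0//.
- by rewrite lee_fin divr_ge0 ?powR_ge0// ltW.
apply: eq_integral => y; rewrite inE/= in_itv/= andbT => y0.
rewrite -EFinM; congr EFin; case: ifPn => y1; last by rewrite mulr0.
rewrite !divr1 powRM ?invr_ge0 ?(ltW r0)//; last by rewrite oppr_ge0 ln_le0.
have -> : r^-1 `^ a = r `^ (- a) by rewrite -powR_inv1 ?(ltW r0)// -powRrM mulN1r.
by rewrite (mulrC ((- ln y) `^ a)) mulrAC.
Qed.

End gamma.

(** * Substitution for the incomplete beta integral *)

Section beta.
Context {R : realType}.
Local Notation mu := (@lebesgue_measure R).

Lemma continuous_max0_powR (a : R) : 0 < a ->
  continuous (fun x : R => (Num.max 0 x) `^ a).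
Proof.
move=> a0 x; have [x0|x0|->] := ltgtP x 0.
- rewrite /continuous_at max_l ?(ltW x0)// powR0 ?gt_eqF//.
  apply: cvg_near_cst; near=> y; have y0 : y < 0 by near: y; exact: lt_nbhsl.
  by rewrite max_l ?(ltW y0)// powR0 ?gt_eqF.
- rewrite /continuous_at max_r ?(ltW x0)//.
  apply: (@cvg_trans _ (y `^ a @[y --> x])).
    apply: near_eq_cvg; near=> y; have y0 : 0 < y by near: y; exact: lt_nbhsr.
    by rewrite max_r ?(ltW y0).
  have : {for x, continuous (fun y : R => y `^ a)}.
    apply: differentiable_continuous; apply/derivable1_diffP.
    by apply: derivable_powR; rewrite in_itv/= x0.
  by [].
- rewrite /continuous_at maxxx powR0 ?gt_eqF//.
  apply/cvgrPdist_lt => e e0; near=> y.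
  rewrite sub0r normrN ger0_norm ?powR_ge0//.
  have -> : e = (e `^ a^-1) `^ a by rewrite -powRrM mulVf ?gt_eqF// powRr1 ?ltW.
  rewrite gt0_ltr_powR ?nnegrE ?powR_ge0 ?le_max ?lexx// gt_max powR_gt0//=.
  near: y; apply: lt_nbhsl; exact: powR_gt0.
Unshelve. all: by end_near. Qed.

Lemma integral_beta_subst_ge (a c t e b : R) : 0 < a -> 0 < c -> 0 < t ->
  0 < e -> e <= b -> b <= 1 ->
  (\int[mu]_(x in `[((t * e) `^ a / c)%R, ((t * b) `^ a / c)%R])
      ((t - (c * x) `^ a^-1) `^ a)%:E =
   \int[mu]_(u in `[e, b])
      ((t `^ (2 * a) / c * a) * (u `^ (a - 1) * (1 - u) `^ (a + 1 - 1)))%:E)%E.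
Proof.
move=> a0 c0 t0 e0 eb b1.
pose F u := (t * u) `^ a / c.
have tu (u : R) : 0 < u -> 0 < t * u by move=> u0; exact: mulr_gt0.
pose h (u : R) := c^-1 * (a * (t * u) `^ (a - 1) * t).
have dF (u : R) : 0 < u -> is_derive u (1 : R) F (h u).
  move=> u0.
  have d1 : is_derive u (1 : R) (t \*: (@id R)) (t *: (1 : R)).
    exact: is_deriveZ.
  have d2 : is_derive (t * u) (1 : R) (fun y : R => y `^ a) (a * (t * u) `^ (a - 1)).
    by apply: is_derive1_powR; exact: tu.
  have d3 : is_derive u (1 : R) ((fun y : R => y `^ a) \o (t \*: (@id R)))
      (a * (t * u) `^ (a - 1) * (t *: (1 : R))).
    exact: is_derive1_comp.
  have d4 := @is_deriveZ _ _ _ _ c^-1 _ _ _ d3.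
  rewrite (_ : F = c^-1 \*: ((fun y : R => y `^ a) \o (t \*: (@id R)))); last first.
    by apply/funext => y; rewrite /F /= mulrC.
  have -> : h u = c^-1 *: (a * (t * u) `^ (a - 1) * (t *: (1 : R))) by rewrite /h /GRing.scale/= mulr1.
  exact: d4.
have F'E (u : R) : 0 < u -> F^`()%classic u = h u.
  by move=> /dF hu; rewrite derive1E derive_val.
have cpow p (u : R) : 0 < u -> {for u, continuous (fun y : R => y `^ p)}.
  move=> u0; apply: differentiable_continuous; apply/derivable1_diffP.
  by apply: derivable_powR; rewrite in_itv/= u0.
have ch (u : R) : 0 < u -> {for u, continuous h}.
  move=> u0; apply: cvgMr; apply: cvgMl; apply: cvgMr.
  apply: (@continuous_comp _ _ _ ( *%R t) (fun y : R => y `^ (a - 1))).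
    exact: mulrl_continuous.
  by apply: cpow; exact: tu.
have cF' (u : R) : 0 < u -> {for u, continuous F^`()%classic}.
  move=> u0; rewrite /prop_for /continuous_at F'E//.
  apply: (@cvg_trans _ (h y @[y --> u])); last exact: ch.
  apply: near_eq_cvg; near=> y; rewrite F'E//; near: y; exact: lt_nbhsr.
have cF (u : R) : 0 < u -> {for u, continuous F}.
  move=> u0; apply: differentiable_continuous; apply/derivable1_diffP.
  by apply: ex_derive; exact: dF.
(* The clamps make the integrand continuous on the whole line; on the interval of integration they
   change nothing. *)
pose G x := (Num.max 0 (t - (Num.max 0 (c * x)) `^ a^-1)) `^ a.
have cG : continuous G.
  move=> x; apply: (@continuous_comp _ _ _ (fun x => t - (Num.max 0 (c * x)) `^ a^-1)
    (fun y : R => (Num.max 0 y) `^ a)); last exact: continuous_max0_powR.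
  apply: cvgB; first exact: cvg_cst.
  apply: (@continuous_comp _ _ _ ( *%R c) (fun y : R => (Num.max 0 y) `^ a^-1)).
    exact: mulrl_continuous.
  by apply: continuous_max0_powR; rewrite invr_gt0.
have GE u : 0 < u -> u <= 1 -> G (F u) = t `^ a * (1 - u) `^ a.
  move=> u0 u1; rewrite /G /F mulrC divfK ?gt_eqF//.
  rewrite (max_r (powR_ge0 _ _)) -powRrM mulfV ?gt_eqF// powRr1 ?(ltW (tu _ u0))//.
  have -> : t - t * u = t * (1 - u) by ring.
  by rewrite max_r ?powRM// ?mulr_ge0 ?subr_ge0 ?(ltW t0).
have FeE x : F e <= x -> x <= F b -> 0 <= c * x /\ (c * x) `^ a^-1 <= t.
  move=> ex xb; have x0 : 0 <= x by rewrite (le_trans _ ex)// divr_ge0 ?powR_ge0 ?ltW.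
  have cx0 : 0 <= c * x by rewrite mulr_ge0// ltW.
  split => //; rewrite -powR_invK ?(ltW t0)//.
  move: xb; rewrite ler_pdivlMr// mulrC => /le_trans; apply.
  rewrite ge0_ler_powR ?nnegrE ?(ltW a0) ?(ltW t0)//.
    by rewrite ltW// tu// (lt_le_trans e0).
  by rewrite ler_piMr// ltW.
transitivity (\int[mu]_(x in `[F e, F b]) (G x)%:E)%E.
  apply: eq_integral => x; rewrite inE/= in_itv/= => /andP[ex xb].
  have [cx0 cxt] := FeE x ex xb.
  by rewrite /G !max_r// subr_ge0.
rewrite (@integration_by_substitution_increasing _ F G e b)//.
- apply: eq_integral => u; rewrite inE/= in_itv/= => /andP[eu ub].
  have u0 := lt_le_trans e0 eu.
  congr EFin; rewrite -[LHS]/(G (F u) * F^`()%classic u) F'E// GE//; last exact: le_trans b1.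
  rewrite /h addrK mulr_natl mulr2n (@powRD _ t a a) ?(gt_eqF t0) ?implybT//.
  rewrite (@powRM _ t u (a - 1)) ?(ltW t0) ?(ltW u0)// -(mulr_powRB1 (ltW t0) a0).
  ring.
- move=> x y; rewrite !in_itv/= => /andP[ex _] /andP[ey _] xy.
  rewrite ltr_pM2r ?invr_gt0// gt0_ltr_powR ?nnegrE//.
  + by rewrite ltW// tu// (lt_le_trans e0).
  + by rewrite ltW// tu// (lt_le_trans e0).
  + by rewrite ltr_pM2l.
- by move=> x; rewrite in_itv/= => /andP[ex _]; apply: cF'; exact: lt_trans ex.
- apply/cvg_ex; exists (F^`()%classic e); apply: cvg_at_right_filter; exact: cF'.
- apply/cvg_ex; exists (F^`()%classic b); apply: cvg_at_left_filter; apply: cF'; exact: lt_le_trans eb.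
- split.
  + move=> x; rewrite in_itv/= => /andP[ex _]; apply: ex_derive; apply: dF.
    exact: lt_trans ex.
  + apply: cvg_at_right_filter; exact: cF.
  + apply: cvg_at_left_filter; apply: cF; exact: lt_le_trans eb.
- apply: continuous_subspaceT => x; exact: cG.
Unshelve. all: by end_near. Qed.

(** The truncated identity on [[e n, b]] with [e n = b / (n+1)], and monotone convergence on both
    sides. *)
Lemma integral_beta_subst (a c t s : R) : 0 < a -> 0 < c -> 0 < t ->
  0 <= s <= t ->
  (\int[mu]_(x in `[0%R, (s `^ a / c)%R]) ((t - (c * x) `^ a^-1) `^ a)%:E =
   \int[mu]_(u in `[0%R, (s / t)%R])
      ((t `^ (2 * a) / c * a) * (u `^ (a - 1) * (1 - u) `^ (a + 1 - 1)))%:E)%E.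
Proof.
move=> a0 c0 t0 /andP[s0 st].
have [->|sn0] := eqVneq s 0.
  by rewrite powR0 ?gt_eqF// !mul0r !set_itv1 !integral_set1.
have {sn0} : 0 < s by rewrite lt0r sn0.
move=> {}s0.
pose b := s / t.
have b0 : 0 < b by exact: divr_gt0.
have b1 : b <= 1 by rewrite ler_pdivrMr// mul1r.
have sE : s = t * b by rewrite /b mulrC divfK// gt_eqF.
rewrite {1}sE -/b.
pose e (n : nat) := b / n.+1%:R.
have key n := @integral_beta_subst_ge a c t (e n) b a0 c0 t0.
have e0 n : 0 < e n by rewrite divr_gt0.
have eb n : e n <= b by rewrite ler_pdivrMr// ler_peMr ?ler1n// ltW.
have e_ni n m : (n <= m)%N -> e m <= e n.
  by move=> nm; rewrite ler_pM2l// lef_pV2 ?posrE// ler_nat.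
have e_small x : 0 < x -> exists n, e n <= x.
  move=> x0; exists (Num.trunc (b / x)).
  have /truncn_itv/andP[_ h] : 0 <= b / x by rewrite divr_ge0// ltW.
  rewrite /e ler_pdivrMr// mulrC -ler_pdivrMr//; exact: ltW.
have mono x y : 0 < x -> x <= y -> (t * x) `^ a / c <= (t * y) `^ a / c.
  move=> x0 xy; rewrite ler_pM2r ?invr_gt0// ge0_ler_powR ?nnegrE ?(ltW a0)//.
  - by rewrite mulr_ge0// ltW.
  - by rewrite mulr_ge0 ?(ltW t0)// (le_trans _ xy)// ltW.
  - by rewrite ler_pM2l.
have mG : measurable_fun [set: R] (fun x => (t - (c * x) `^ a^-1) `^ a).
  apply: (measurableT_comp (measurable_powR _)); apply: measurable_funB => //.
  by apply: (measurableT_comp (measurable_powR _)); exact: measurable_funM.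
have mH : measurable_fun [set: R] (fun u : R =>
    t `^ (2 * a) / c * a * (u `^ (a - 1) * (1 - u) `^ (a + 1 - 1))).
  apply: measurable_funM => //; apply: measurable_funM; first exact: measurable_powR.
  by apply: (measurableT_comp (measurable_powR _)); exact: measurable_funB.
rewrite -(@integral_itv_obnd_cbnd _ 0%R (BRight ((t * b) `^ a / c))); last first.
  by apply: measurable_funTS; exact/measurable_EFinP.
rewrite -(@integral_itv_obnd_cbnd _ 0%R (BRight b)); last first.
  by apply: measurable_funTS; exact/measurable_EFinP.
have UA : `]0%R, ((t * b) `^ a / c)%R]%classic =
    \bigcup_n `[((t * e n) `^ a / c)%R, ((t * b) `^ a / c)%R]%classic.
  apply/seteqP; split => x /=; rewrite in_itv/=.
    move=> /andP[x0 xb].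
    have [n hn] := e_small ((c * x) `^ a^-1 / t) (divr_gt0 (powR_gt0 _ (mulr_gt0 c0 x0)) t0).
    exists n => //=; rewrite in_itv/= xb andbT ler_pdivrMr// mulrC.
    move: hn; rewrite ler_pdivlMr// (mulrC _ t) => hn.
    rewrite leNgt; apply/negP => hlt.
    move: hlt; rewrite (mulrC x) ltNge => /negP; apply.
    have := @ge0_ler_powR _ a (ltW a0) (t * e n) ((c * x) `^ a^-1).
    rewrite !nnegrE -powRrM mulVf ?gt_eqF// powRr1 ?(ltW (mulr_gt0 c0 x0))//.
    by apply => //; [rewrite ltW// mulr_gt0|rewrite powR_ge0].
  move=> [n _ /=]; rewrite in_itv/= => /andP[ex ->]; rewrite andbT.
  by apply: lt_le_trans ex; rewrite divr_gt0// powR_gt0// mulr_gt0.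
have UB : `]0%R, b]%classic = \bigcup_n `[e n, b]%classic.
  apply/seteqP; split => x /=; rewrite in_itv/=.
    move=> /andP[x0 xb]; have [n hn] := e_small x x0.
    by exists n => //=; rewrite in_itv/= hn xb.
  move=> [n _ /=]; rewrite in_itv/= => /andP[ex ->]; rewrite andbT.
  exact: lt_le_trans ex.
rewrite UA UB.
have cA := @ge0_nondecreasing_set_cvg_integral _ _ _
  (fun n => `[((t * e n) `^ a / c)%R, ((t * b) `^ a / c)%R]%classic : set (measurableTypeR R))
  (fun x : measurableTypeR R => ((t - (c * x) `^ a^-1) `^ a)%:E) mu.
have cB := @ge0_nondecreasing_set_cvg_integral _ _ _ (fun n => `[e n, b]%classic : set (measurableTypeR R))
  (fun u : measurableTypeR R => ((t `^ (2 * a) / c * a) * (u `^ (a - 1) * (1 - u) `^ (a + 1 - 1)))%:E) mu.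
apply: (cvg_unique _ (cA _ _ _ _)) => //=.
- move=> n m nm; rewrite subsetEset; apply: subset_itvr; rewrite bnd_simp.
  by apply: mono => //; exact: e_ni.
- by move=> i; apply: measurable_funTS; exact/measurable_EFinP.
- by move=> i x _; rewrite lee_fin powR_ge0.
rewrite (_ : (fun n => _) = (fun n => \int[mu]_(u in `[e n, b])
   ((t `^ (2 * a) / c * a) * (u `^ (a - 1) * (1 - u) `^ (a + 1 - 1)))%:E)%E); last first.
  by apply/funext => n; rewrite key.
apply: cB => //.
- move=> n m nm; rewrite subsetEset; apply: subset_itvr; rewrite bnd_simp.
  exact: e_ni.
- by move=> i; apply: measurable_funTS; exact/measurable_EFinP.
- by move=> i x _; rewrite lee_fin !mulr_ge0 ?powR_ge0 ?invr_ge0 ?ltW.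
Qed.

End beta.

Section incomplete_beta.
Context {R : realType}.
Local Notation mu := (@lebesgue_measure R).

Lemma measurable_beta_integrand (a b : R) :
  measurable_fun [set: R] (fun u : R => u `^ (a - 1) * (1 - u) `^ (b - 1)).
Proof.
apply: measurable_funM; first exact: measurable_powR.
by apply: (measurableT_comp (measurable_powR _)); exact: measurable_funB.
Qed.

(** [incBeta] is a real number obtained through [fine], so the integral must be shown finite. The
    substitution with [c = t = 1] trades the singularity at 0 for an integrand bounded by 1 on a
    bounded interval. *)
Lemma integral_incBeta (a x : R) : 0 < a -> 0 <= x <= 1 ->
  (\int[mu]_(u in `[0%R, x]) (u `^ (a - 1) * (1 - u) `^ (a + 1 - 1))%:E =
   (incBeta a (a + 1) x)%:E)%E.
Proof.
move=> a0 x01; have /andP[x0 x1] := x01; rewrite /incBeta /Rintegral fineK//.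
rewrite ge0_fin_numE; last first.
  by apply: integral_ge0 => u _; rewrite lee_fin mulr_ge0 ?powR_ge0.
have := integral_beta_subst a0 (ltr01 : 0 < 1 :> R) ltr01 x01.
under [RHS]eq_integral do rewrite powR1 divr1 mul1r EFinM.
rewrite !divr1 ge0_integralZl//=; last 3 first.
- apply: measurable_funTS; apply/measurable_EFinP; exact: measurable_beta_integrand.
- by move=> u _; rewrite lee_fin mulr_ge0 ?powR_ge0.
- by rewrite lee_fin ltW.
move=> E; rewrite ltey; apply/eqP => Ioo; move: E; rewrite Ioo gt0_muley ?lte_fin//.
move/eqP; apply/negP; rewrite -ltey.
apply: (@le_lt_trans _ _ (\int[mu]_(u in `[0%R, (x `^ a)%R]) 1)%E).
  apply: ge0_le_integral => //.
  - by move=> u _; rewrite lee_fin powR_ge0.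
  - apply: measurable_funTS; apply/measurable_EFinP.
    apply: (measurableT_comp (measurable_powR _)); apply: measurable_funB => //.
    apply: (measurableT_comp (measurable_powR _)); exact: measurable_funM.
  - move=> u /=; rewrite in_itv/= => /andP[u0 ux]; rewrite lee_fin mul1r.
    have h1 : 0 <= 1 - u `^ a^-1.
      rewrite subr_ge0 -powR_invK// powR1 (le_trans ux)//.
      by have := @ge0_ler_powR _ a (ltW a0) x 1; rewrite powR1 !nnegrE; exact.
    have := @ge0_ler_powR _ a (ltW a0) _ 1 h1; rewrite powR1 !nnegrE; apply => //.
    by rewrite lerBlDr lerDl powR_ge0.
rewrite integral_cst//= mul1e lebesgue_measure_itv/= lte_fin.
by case: ifP => _; rewrite -?EFinB ltry.
Qed.

End incomplete_beta.

(** * Products of sigma-finite measures *)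

Section product_sigma_finite.
Local Open Scope ereal_scope.
Context d1 d2 (T1 : measurableType d1) (T2 : measurableType d2) (R : realType).
Variable m1 : {sigma_finite_measure set T1 -> \bar R}.
Variable m2 : {sigma_finite_measure set T2 -> \bar R}.

Lemma product_measure_sigma_finite : sigma_finite setT (m1 \x m2).
Proof.
have /sigma_finiteP[F [TF ndF Foo]] := sigma_finiteT m1.
have /sigma_finiteP[H [TH ndH Hoo]] := sigma_finiteT m2.
exists (fun n => F n `*` H n).
  apply/seteqP; split => // -[x y] _.
  have [n _ Fnx] : (\bigcup_n F n) x by rewrite -TF.
  have [k _ Hky] : (\bigcup_k H k) y by rewrite -TH.
  exists (maxn n k) => //; split.
    by move: Fnx; exact/subsetPset/ndF/leq_maxl.
  by move: Hky; exact/subsetPset/ndH/leq_maxr.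
move=> k; have [? ?] := Foo k; have [? ?] := Hoo k.
split; first exact: measurableX.
by rewrite product_measure1E// lte_mul_pinfty// ge0_fin_numE.
Qed.

(* In the library the canonical sigma-finite structure on products only covers subprobabilities. *)
Definition sigma_finite_product : {sigma_finite_measure set (T1 * T2)%type -> \bar R} :=
  HB.pack (m1 \x m2) (Measure_isSigmaFinite.Build _ _ _ (m1 \x m2) product_measure_sigma_finite).
End product_sigma_finite.

(** * Paths of an inverse subordinator *)

Section inverse_path.
Context {R : realType} {T : Type}.
Variables (D : R -> T -> R) (w : T).
Hypothesis D_nd : forall s t : R, 0 <= s -> s <= t -> D s w <= D t w.
Local Notation Y t := (inverse_subordinator D t w).
Let A (t : R) : set R := [set x | 0 <= x /\ t < D x w].

Let A_lb t : has_lbound (A t).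
Proof. by exists 0 => x []. Qed.

Lemma inverse_subordinator_ge0 t : 0 <= Y t.
Proof.
have [A0|A0] := pselect (A t !=set0); first by apply: lb_le_inf => // x [].
by rewrite /inverse_subordinator inf_out// => -[].
Qed.

Lemma inverse_subordinator_out t : ~ (A t !=set0) -> Y t = 0.
Proof. by move=> A0; rewrite /inverse_subordinator inf_out// => -[]. Qed.

Lemma inverse_subordinator_ge t x : 0 <= x -> t < D x w -> Y t <= x.
Proof. by move=> x0 tx; apply: ge_inf (A_lb t) _ _. Qed.

Lemma inverse_subordinator_nd s t : s <= t -> A t !=set0 -> Y s <= Y t.
Proof.
move=> st At; apply: lb_le_inf => // x [x0 tx].
by apply: inverse_subordinator_ge => //; exact: le_lt_trans tx.
Qed.

(** Monotonicity fails exactly when the path never exceeds [t], where the infimum of the empty set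
    is 0. The second alternative is harmless for the ratio [Y s / Y t], which is then 0. *)
Lemma inverse_subordinator_le s t : s <= t -> Y s <= Y t \/ Y t = 0.
Proof.
move=> st; have [At|At] := pselect (A t !=set0).
  by left; exact: inverse_subordinator_nd.
by right; exact: inverse_subordinator_out.
Qed.

Lemma lt_inverse_subordinator t x : 0 <= x -> x < Y t -> D x w <= t.
Proof.
move=> x0 xY; rewrite leNgt; apply/negP => tx.
by move: xY; rewrite ltNge => /negP; apply; exact: inverse_subordinator_ge.
Qed.

Lemma inverse_subordinator_ltP t c : A t !=set0 -> Y t < c ->
  exists2 x, A t x & x < c.
Proof.
by move=> A0 Yc; have [x Ax xc] := inf_lt A0 Yc; exists x.
Qed.

Lemma inverse_subordinator_lt t x : A t !=set0 -> Y t < x -> t < D x w.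
Proof.
move=> A0 /(inverse_subordinator_ltP A0)[y [y0 ty] yx].
by apply: lt_le_trans ty _; apply: D_nd => //; exact: ltW.
Qed.

(** [Y] is right-continuous and locally nondecreasing, so [f] is approached from the right only. On
    flat stretches [Y u = Y t], a point that the right limit of [f] excludes, hence the separate
    case. If [t] is never exceeded, [Y] is 0 from [t] on. *)
Lemma right_continuous_inverse_subordinator (f : R -> R) t :
  (forall u, 0 <= u -> f v @[v --> u^'+] --> f u) ->
  f (Y u) @[u --> t^'+] --> f (Y t).
Proof.
move=> cf; have [At|At] := pselect (A t !=set0); last first.
  apply: cvg_near_cst; near=> u; rewrite !inverse_subordinator_out// => -[x [x0 ux]].
  apply: At; exists x; split => //; apply: lt_trans ux.
  by near: u; exact: nbhs_right_gt.
apply/cvgrPdist_lt => e e0.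
have := cf _ (inverse_subordinator_ge0 t) => /cvgrPdist_lt/(_ _ e0).
rewrite near_withinE => -[/= r r0 hr].
(* For [u] between [t] and [D x w], this [x] bounds [Y u] from above. *)
have [x [x0 tx] xr] : exists2 x, A t x & x < Y t + r.
  by apply: inverse_subordinator_ltP => //; rewrite ltrDl.
near=> u.
have tu : t < u by near: u; exact: nbhs_right_gt.
have ux : u < D x w by near: u; exact: nbhs_right_lt.
have Yle : Y t <= Y u by apply: inverse_subordinator_nd; [exact: ltW|exists x].
have Yux : Y u <= x by exact: inverse_subordinator_ge.
have := Yle; rewrite le_eqVlt => /predU1P[->|Ylt].
  by rewrite subrr normr0.
apply: hr => //=; rewrite distrC ger0_norm ?subr_ge0 ?(ltW Ylt)//.
by rewrite ltrBlDl (le_lt_trans Yux).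
Unshelve. all: by end_near. Qed.

(** The level set lies between [[0, Y t[] and [[0, Y t]]. This identity turns moments of [Y] into
    integrals over level sets of [D]. *)
Lemma lebesgue_measure_inverse_subordinator t : A t !=set0 ->
  lebesgue_measure (`[0%R, +oo[ `&` [set x | D x w <= t]) = (Y t)%:E.
Proof.
move=> At.
have Y0 := inverse_subordinator_ge0 t.
have le_itv b : 0 <= b -> lebesgue_measure (`[0%R, b]%classic : set R) = b%:E.
  move=> b0; rewrite lebesgue_measure_itv/= lte_fin; move: b0.
  by rewrite le_eqVlt => /predU1P[<-|->]; rewrite ?ltxx ?sube0.
have mE : measurable (`[0%R, +oo[ `&` [set x | D x w <= t] : set R).
  apply: is_interval_measurable => x y /= [x0 Dx] [y0 Dy] z /andP[xz zy].
  move: x0 y0; rewrite !in_itv/= !andbT => x0 y0.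
  have z0 := le_trans x0 xz; split => //.
  by rewrite (le_trans _ Dy)// D_nd.
apply/eqP; rewrite eq_le; apply/andP; split.
  rewrite -le_itv//; apply: le_measure; rewrite ?inE//.
  move=> x /= []; rewrite !in_itv/= andbT => -> Dx /=.
  by rewrite leNgt; apply/negP => /(inverse_subordinator_lt At); rewrite ltNge Dx.
rewrite -le_itv//.
have -> : lebesgue_measure (`[0%R, Y t]%classic : set R) = lebesgue_measure (`[0%R, Y t[%classic : set R).
  by rewrite !lebesgue_measure_itv.
apply: le_measure; rewrite ?inE//.
move=> x /=; rewrite !in_itv/= andbT => /andP[x0 xY]; split => //.
exact: lt_inverse_subordinator.
Qed.

End inverse_path.

Lemma measurable_inverse_subordinator (R : realType) d (T : measurableType d)
    (D : R -> T -> R) (t : R) :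
  (forall t, 0 <= t -> measurable_fun setT (D t)) ->
  (forall w s t, 0 <= s -> s <= t -> D s w <= D t w) ->
  measurable_fun setT (inverse_subordinator D t).
Proof.
move=> mD D_nd; apply: (measurability _ (RGenInftyO.measurableE R)) => //.
move=> /= _ [_ [c ->] <-]; rewrite setTI.
have [c0|c0] := leP c 0.
  rewrite (_ : _ @^-1` _ = set0)//; apply/seteqP; split => w //=.
  by rewrite in_itv/= ltNge (le_trans c0)// inverse_subordinator_ge0.
(* For [c > 0], either the path never exceeds [t], which monotonicity lets one test at integers and
   which gives the default value 0, or it exceeds [t] at some rational time before [c]. *)
rewrite (_ : _ @^-1` _ = \bigcap_(n : nat) [set w | D n%:R w <= t] `|`
    \bigcup_(q : rat) (if ((0 <= ratr q :> R) && (ratr q < c)) then [set w | t < D (ratr q) w] else set0)).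
  apply: measurableU.
    by apply: bigcap_measurable => // n _; apply: measurable_set_le => //; exact: mD.
  apply: bigcupT_measurable_rat => q; case: ifPn => // /andP[q0 _].
  by apply: measurable_set_lt => //; exact: mD.
apply/seteqP; split => w /=; rewrite in_itv/=.
  have [At|At] := pselect ([set x | 0 <= x /\ t < D x w] !=set0); last first.
    by move=> _; left => n _ /=; rewrite leNgt; apply/negP => h; apply: At; exists n%:R.
  move=> /(inverse_subordinator_ltP At)[x [x0 tx] xc]; right.
  have [q] := rat_in_itvoo xc; rewrite in_itv/= => /andP[xq qc].
  exists q => //=; rewrite (le_trans x0 (ltW xq)) qc/=.
  by apply: lt_le_trans tx _; apply: D_nd => //; exact: ltW.
move=> [h|[q _]].
  rewrite inverse_subordinator_out// => -[x [x0]]; apply/negP; rewrite -leNgt.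
  have /truncn_itv/andP[_ xn] := x0.
  by rewrite (le_trans _ (h (Num.trunc x).+1 I))// D_nd// ltW.
case: ifPn => // /andP[q0 qc] tq; apply: le_lt_trans qc; exact: inverse_subordinator_ge.
Qed.

(** * Increments of a Levy process *)

Section levy.
Context {R : realType} {d : measure_display} {T : measurableType d}.
Variables (P : probability T R) (X : R -> T -> R).
Hypothesis LX : is_levy P X.

Lemma levy_indep2 (s h : R) (A B : set R) : 0 <= s -> 0 <= h ->
  measurable A -> measurable B ->
  P ((fun w => X s w - X 0 w) @^-1` A `&` (fun w => X (s + h) w - X s w) @^-1` B) =
  (P ((fun w => (X s w - X 0 w)%R) @^-1` A) *
   P ((fun w => (X (s + h) w - X s w)%R) @^-1` B))%E.
Proof.
move=> s0 h0 mA mB.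
have := @levy_indep_increments _ _ _ _ _ LX 2
  (fun i => match i with 0%N => 0 | 1%N => s | _ => s + h end)
  (fun i => if i is 0%N then A else B) (lexx _).
rewrite !big_ord_recl big_ord0 mule1 /= => <-.
- congr (P _); apply/seteqP; split => w /=.
    by move=> [wA wB] [|[|]]//.
  by move=> h1; split; [exact: (h1 0%N)|exact: (h1 1%N)].
- by move=> [|[|i]]//; rewrite lerDl.
- by move=> [|i].
Qed.

Lemma measurable_levy_increment (s t : R) : 0 <= s -> 0 <= t ->
  measurable_fun setT (fun w => X t w - X s w).
Proof.
by move=> s0 t0; apply: measurable_funB; exact: (levy_measurable LX).
Qed.

Lemma levy_increment_law (s h : R) (g : R -> \bar R) : 0 <= s -> 0 <= h ->
  measurable_fun setT g -> (forall x, 0 <= g x)%E ->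
  (\int[P]_w g (X (s + h) w - X s w)%R = \int[P]_w g (X h w))%E.
Proof.
move=> s0 h0 mg g0.
have m1 := measurable_levy_increment s0 (addr_ge0 s0 h0).
have m2 := levy_measurable LX h0.
pose f1 : {mfun T >-> R} := mfun_Sub (mem_set m1).
pose f2 : {mfun T >-> R} := mfun_Sub (mem_set m2).
rewrite -(ge0_integral_distribution (P := P) f1 mg g0).
rewrite -(ge0_integral_distribution (P := P) f2 mg g0).
apply: eq_measure_integral => B mB _.
have sh : s <= s + h by rewrite lerDl.
have := levy_stationary_increments LX s0 sh mB.
by have -> : s + h - s = h by rewrite addrC addKr.
Qed.

Lemma levy_start_subr (t : R) : {ae P, forall w, X t w - X 0 w = X t w}.
Proof. by apply: filterS (levy_start LX) => w ->; rewrite subr0. Qed.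

(** The simple Markov property: the increment after [s] may be replaced by [X h] on an independent
    copy [w']. The detour through [X s - X 0] is due to [X 0 = 0] holding only almost surely. *)
Lemma ge0_integral_levy_pair (s h : R) (F : R * R -> \bar R) : 0 <= s -> 0 <= h ->
  measurable_fun [set: R * R] F -> (forall z, 0 <= F z)%E ->
  (\int[P]_w F (X s w, X (s + h) w - X s w)%R =
   \int[P]_w' \int[P]_w F (X s w, X h w'))%E.
Proof.
move=> s0 h0 mF F0.
have mX t : 0 <= t -> measurable_fun setT (X t) by move=> t0; exact: (levy_measurable LX).
have m1 := measurable_levy_increment (lexx 0) s0.
have m2 := measurable_levy_increment s0 (addr_ge0 s0 h0).
transitivity (\int[P]_w F (X s w - X 0 w, X (s + h) w - X s w)%R)%E.
  apply: ge0_ae_eq_integral => //.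
  - by apply: (measurableT_comp mF); apply: measurable_fun_pair => //; exact: mX.
  - by apply: (measurableT_comp mF); apply: measurable_fun_pair.
  - by apply: filterS (levy_start_subr s) => w + _ => ->.
rewrite (ge0_integral_indep m1 m2 (fun A B => @levy_indep2 s h A B s0 h0) mF F0).
rewrite (levy_increment_law (g := fun y => (\int[P]_w F (X s w - X 0 w, y)%R)%E))//; last 2 first.
- exact: measurable_integral_indep.
- by move=> x; exact: integral_ge0.
apply: eq_integral => w' _.
apply: ge0_ae_eq_integral => //.
- by apply: (measurableT_comp mF); apply: measurable_fun_pair.
- by apply: (measurableT_comp mF); apply: measurable_fun_pair => //; exact: mX.
- by apply: filterS (levy_start_subr s) => w + _ => ->.
Qed.

End levy.

(** * Potential measure of a stable subordinator *)

Section indicators.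
Context {R : realType} {d : measure_display} {T : measurableType d}.

Lemma measurable_ind (b : T -> bool) : measurable_fun setT b ->
  measurable_fun setT (fun x => (b x)%:R%:E : \bar R).
Proof.
move=> mb; apply/measurable_EFinP.
exact: (@measurableT_comp _ _ _ _ _ _ (fun b : bool => b%:R : R)).
Qed.

Lemma integral_ind (m : {measure set T -> \bar R}) (b : T -> bool) :
  measurable_fun setT b -> (\int[m]_x (b x)%:R%:E = m [set x | b x])%E.
Proof.
move=> mb; have mE : measurable [set x | b x].
  rewrite (_ : [set x | b x] = b @^-1` [set true])//.
  by rewrite -[X in measurable X]setTI; exact: mb.
rewrite -(setIT [set x | b x]) -integral_indic//.
by apply: eq_integral => x _; rewrite indicE mem_setE.
Qed.

End indicators.

Section subordinator.
Context {R : realType} {d : measure_display} {T : measurableType d}.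
Variables (P : probability T R) (f : R -> R) (D : R -> T -> R).
Hypothesis SD : is_subordinator P f D.
Local Notation mu := (@lebesgue_measure R).

Let LD := subordinator_levy SD.
Let D_nd := subordinator_nondecreasing SD.
Let mD := levy_measurable LD.

Lemma subordinator_ae_ge0 : {ae P, forall w, forall t, 0 <= t -> 0 <= D t w}.
Proof.
by apply: filterS (levy_start LD) => w D0 t t0; rewrite -D0; exact: D_nd.
Qed.

Lemma measurable_subordinator :
  measurable_fun [set: measurableTypeR R * T] (fun z => D (Num.max 0 z.1) z.2).
Proof.
by apply: (measurable_process mD) => w t t0; have [+ _] := levy_cadlag LD w; apply.
Qed.

(* The clamping at 0 only matters on a null set. *)
Definition clamped_subordinator (z : measurableTypeR R * T) : R :=
  Num.max 0 (D (Num.max 0 z.1) z.2).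

Lemma measurable_clamped_subordinator : measurable_fun setT clamped_subordinator.
Proof. by apply: measurable_maxr => //; exact: measurable_subordinator. Qed.

Lemma laplace_clamped_subordinator s t : 0 < s -> 0 <= t ->
  (\int[P]_w (expR (- (s * clamped_subordinator (t, w))))%:E = (expR (- (t * f s)))%:E)%E.
Proof.
move=> s0 t0; rewrite -(subordinator_laplace SD s0 t0) unlock.
have mx : Num.max 0 t = t by rewrite max_r.
apply: ge0_ae_eq_integral => //.
- apply/measurable_EFinP; apply: measurableT_comp => //; apply: measurableT_comp => //.
  apply: measurable_funM => //; rewrite /clamped_subordinator/= mx.
  by apply: measurable_maxr => //; exact: mD.
- apply/measurable_EFinP; apply: measurableT_comp => //; apply: measurableT_comp => //.
  by apply: measurable_funM => //; exact: mD.
- apply: filterS subordinator_ae_ge0 => w h _.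
  by rewrite /clamped_subordinator/= mx max_r// h.
Qed.

Section stable.
Variable a : R.
Hypotheses (a01 : 0 < a <= 1) (fE : forall s, 0 < s -> f s = s `^ a).

Let D1 : set (measurableTypeR R * T) := [set z | 0 <= z.1].

Let mD1 : measurable D1.
Proof. by apply: measurable_set_le. Qed.

(** The moments of [exp(-D)] are Laplace transforms at integers, and integrating [exp(-x (n+1)^a)]
    over time leaves [(n+1)^(-a)]. *)
Lemma stable_potential_laplace n :
  (\int[mu \x P]_(z in D1) (expR (- clamped_subordinator z) ^+ n.+1)%:E =
   (n.+1%:R `^ (- a))%:E)%E.
Proof.
have nE z : expR (- clamped_subordinator z) ^+ n.+1 = expR (- (n.+1%:R * clamped_subordinator z)).
  by rewrite -expRM_natl mulrN.
have mF : measurable_fun setT (fun z => (expR (- (n.+1%:R * clamped_subordinator z)))%:E : \bar R).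
  apply/measurable_EFinP; apply: measurableT_comp => //; apply: measurableT_comp => //.
  by apply: measurable_funM => //; exact: measurable_clamped_subordinator.
rewrite integral_mkcond fubini_tonelli1//; last 2 first.
- apply/(measurable_restrictT _ mD1); apply: measurable_funTS.
  by under eq_fun do rewrite nE.
- by move=> z; rewrite patchE; case: ifP => // _; rewrite lee_fin exprn_ge0 ?expR_ge0.
have na : 0 < n.+1%:R `^ a :> R by rewrite powR_gt0.
(* The integrand is recognised as a multiple of the exponential density of rate [(n+1)^a], whose
   total mass is 1. *)
transitivity (\int[mu]_(x in `[0%R, +oo[) ((n.+1%:R `^ (- a))%:E * (exponential_pdf (n.+1%:R `^ a) x)%:E))%E.
  rewrite [RHS]integral_mkcond; apply: eq_integral => x _.
  rewrite /fubini_F patchE; case: ifPn => x0.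
    move: x0; rewrite inE/= in_itv/= andbT => x0.
    rewrite -EFinM exponential_pdfE//= mulrA -powRD; last by rewrite pnatr_eq0 implybT.
    rewrite addNr powRr0 mul1r.
    transitivity (\int[P]_w (expR (- (n.+1%:R * clamped_subordinator (x, w))))%:E)%E.
      by apply: eq_integral => w _; rewrite patchE mem_set// nE.
    by rewrite laplace_clamped_subordinator// fE// mulrC mulNr.
  apply: integral0_eq => w _; rewrite patchE memNset//= => h.
  by move: x0; rewrite notin_setE/= in_itv/= h.
rewrite ge0_integralZl//=; last 2 first.
- by apply: measurable_funTS; apply/measurable_EFinP; exact: measurable_exponential_pdf.
- by move=> x _; rewrite lee_fin exponential_pdf_ge0// ltW.
suff -> : (\int[mu]_(x in `[0%R, +oo[) (exponential_pdf (n.+1%:R `^ a) x)%:E = 1)%E by rewrite mule1.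
rewrite -(integral_exponential_pdf na) [LHS]integral_mkcond.
apply: eq_integral => x _; rewrite patchE; case: ifPn => //.
rewrite notin_setE/= in_itv/= andbT => /negP; rewrite -ltNge => x0.
by rewrite lt0_exponential_pdf.
Qed.

Let D2 : set (measurableTypeR R) := `[0%R, +oo[%classic.
Let G := Gamma (1 + a).
(** The comparison variable: under Lebesgue measure its level sets have the measures [t^a / G]
    expected of the potential. *)
Let X2 (x : measurableTypeR R) := expR (- ((G * x) `^ a^-1)).

Let G0 : 0 < G. Proof. exact: Gamma_gt0. Qed.

Let mX2 : measurable_fun setT X2.
Proof.
apply: measurableT_comp => //; apply: measurableT_comp => //.
by apply: (measurableT_comp (measurable_powR _)); exact: measurable_funM.
Qed.

Let X2_laplace n :
  (\int[mu]_(x in D2) (X2 x ^+ n.+1)%:E = (n.+1%:R `^ (- a))%:E)%E.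
Proof.
have /andP[a0 _] := a01.
rewrite (_ : (n.+1%:R `^ (- a)) = n.+1%:R `^ (- a) / G * G); last by rewrite divfK// gt_eqF.
rewrite -integral_expRN_powR_scale//; apply: eq_integral => x _.
by rewrite /X2 -expRM_natl mulrN.
Qed.

Let level2 t : 0 <= t -> mu (D2 `&` [set x | expR (- t) <= X2 x]) = (t `^ a / G)%:E.
Proof.
move=> t0; have /andP[a0 _] := a01; rewrite -lebesgue_measure_powR_le//.
by congr (mu (_ `&` _)); apply/funext => x; rewrite /= /X2 ler_expR lerN2.
Qed.

(** [X1] and [X2] share all moments of positive order, so [hausdorff_le] bounds the mass at [t] by
    [r^a / G] from above for [r > t] and from below for [r < t]; continuity in [r] closes the
    gap. *)
Lemma stable_potential t : 0 <= t ->
  (mu \x P)%E (D1 `&` [set z | clamped_subordinator z <= t]) = (t `^ a / G)%:E.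
Proof.
move=> t0; have /andP[a0 a1] := a01.
pose X1 z := expR (- clamped_subordinator z).
have mX1 : measurable_fun setT X1.
  by apply: measurableT_comp => //; apply: measurableT_comp => //; exact: measurable_clamped_subordinator.
have X1b z : D1 z -> 0 <= X1 z <= 1.
  by move=> _; rewrite expR_ge0 -expR0 ler_expR oppr_le0 le_max lexx.
have X2b z : D2 z -> 0 <= X2 z <= 1.
  by move=> _; rewrite expR_ge0 -expR0 ler_expR oppr_le0 powR_ge0.
have E n : (\int[mu \x P]_(z in D1) (X1 z ^+ n.+1)%:E =
            \int[mu]_(x in D2) (X2 x ^+ n.+1)%:E)%E.
  by rewrite stable_potential_laplace X2_laplace.
have f1 : (\int[mu \x P]_(z in D1) (X1 z)%:E < +oo)%E.
  by have := stable_potential_laplace 0; rewrite /X1 /= => ->; rewrite ltry.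
have f2 : (\int[mu]_(x in D2) (X2 x)%:E < +oo)%E.
  by have := X2_laplace 0; rewrite /= => ->; rewrite ltry.
have mD2 : measurable D2 by exact: measurable_itv.
pose V r := (mu \x P)%E (D1 `&` [set z | clamped_subordinator z <= r]).
rewrite -/(V t).
have lev1 r : (mu \x P)%E (D1 `&` [set z | expR (- r) <= X1 z]) = V r.
  by congr ((mu \x P)%E (_ `&` _)); apply/funext => z; rewrite /= /X1 ler_expR lerN2.
have up r : t < r -> (V t <= (r `^ a / G)%:E)%E.
  move=> tr; rewrite -lev1 -level2 ?(le_trans t0 (ltW tr))//.
  apply: hausdorff_le => //; try exact: measurable_funTS.
  - exact: expR_gt0.
  - by rewrite ltr_expR ltrN2.
have dn r : 0 <= r -> r < t -> ((r `^ a / G)%:E <= V t)%E.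
  move=> r0 rt; rewrite -lev1 -level2//.
  apply: hausdorff_le => //; try exact: measurable_funTS.
  - exact: expR_gt0.
  - by rewrite ltr_expR ltrN2.
have fin : V t \is a fin_num.
  rewrite ge0_fin_numE//; apply: (@le_lt_trans _ _ ((t + 1) `^ a / G)%:E); last by rewrite ltry.
  by apply: up; rewrite ltrDl.
have A0 : (0 <= V t)%E by exact: measure_ge0.
move: up dn A0; rewrite -(fineK fin); move: (fine _) => A up dn A0.
congr EFin; apply/eqP; rewrite eq_le.
pose g (x : R) := (Num.max 0 x) `^ a / G.
have cg : {for t, continuous g}.
  by apply: cvgMl; exact: continuous_max0_powR.
have gE x : 0 <= x -> g x = x `^ a / G by move=> x0; rewrite /g max_r.
apply/andP; split.
  rewrite -gE//.
  have lim1 : (fun=> A : R) @ t^'+ --> A by exact: cvg_cst.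
  apply: (ler_cvg_to lim1 (cvg_at_right_filter cg)).
  near=> r; have tr : t < r by near: r; exact: nbhs_right_gt.
  by rewrite max_r ?(le_trans t0 (ltW tr))// -lee_fin; exact: up.
(* At [t = 0] there is no [r] below, but the lower bound is 0 there. *)
have [t1|t1] := leP t 0.
  have -> : t = 0 by apply/eqP; rewrite eq_le t1 t0.
  rewrite powR0 ?gt_eqF// mul0r -lee_fin; exact: A0.
rewrite -gE//.
have lim1 : (fun=> A : R) @ t^'- --> A by exact: cvg_cst.
apply: (ler_cvg_to (cvg_at_left_filter cg) lim1).
near=> r; have tr : r < t by near: r; exact: nbhs_left_lt.
have r0 : 0 < r by near: r; exact: nbhs_left_gt.
by rewrite max_r ?(ltW r0)// -lee_fin; apply: dn => //; exact: ltW.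
Unshelve. all: by end_near. Qed.

End stable.

End subordinator.

(** * Moments of the inverse stable subordinator *)

Section inverse_path_integrals.
Context {R : realType} {T : Type}.
Variables (D : R -> T -> R) (w : T).
Hypothesis D_nd : forall s t : R, 0 <= s -> s <= t -> D s w <= D t w.
Local Notation Y t := (inverse_subordinator D t w).
Local Notation mu := (@lebesgue_measure R).
Local Notation A t := ([set x | 0 <= x /\ t < D x w]).

(** Whether the endpoint belongs to the level set depends on the value of the path at [Y t]. *)
Lemma inverse_subordinator_level t : A t !=set0 ->
  (forall x, 0 <= x -> (D x w <= t) = (x < Y t)) \/
  (forall x, 0 <= x -> (D x w <= t) = (x <= Y t)).
Proof.
move=> At; have Y0 := inverse_subordinator_ge0 D w t.
have [DY|DY] := leP (D (Y t) w) t; [right|left] => x x0.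
  apply/idP/idP => [Dx|xY].
    by rewrite leNgt; apply/negP => /(inverse_subordinator_lt D_nd At); rewrite ltNge Dx.
  by apply: le_trans DY; exact: D_nd.
apply/idP/idP => [Dx|]; last exact: lt_inverse_subordinator.
rewrite ltNge; apply/negP => Yx.
by have := lt_le_trans DY (D_nd Y0 Yx); rewrite ltNge Dx.
Qed.

Lemma lebesgue_measure_shifted_level t x : A t !=set0 -> 0 <= x ->
  mu [set h | (0 <= h) && (D (Num.max 0 (x + h)) w <= t)] = (Num.max 0 (Y t - x))%:E.
Proof.
move=> At x0.
have mx h : 0 <= h -> Num.max 0 (x + h) = x + h by move=> h0; rewrite max_r ?addr_ge0.
have itvE (b : bool) c : mu [set` Interval (BLeft 0%R) (BSide b c)] = (Num.max 0 c)%:E.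
  rewrite lebesgue_measure_itv/= lte_fin.
  by case: ltP => [c0|c0]; rewrite ?sube0 ?max_r ?max_l// ltW.
have [E|E] := inverse_subordinator_level At.
  rewrite -(itvE true); congr (mu _); apply/seteqP; split => h /=; rewrite in_itv/=.
    by move=> /andP[h0]; rewrite mx// E ?addr_ge0// h0/= ltrBrDl.
  by move=> /andP[h0]; rewrite mx// E ?addr_ge0// h0/= ltrBrDl.
rewrite -(itvE false); congr (mu _); apply/seteqP; split => h /=; rewrite in_itv/=.
  by move=> /andP[h0]; rewrite mx// E ?addr_ge0// h0/= lerBrDl.
by move=> /andP[h0]; rewrite mx// E ?addr_ge0// h0/= lerBrDl.
Qed.

Lemma integral_subr_itv (a b : R) : 0 <= a ->
  (\int[mu]_(x in `[0%R, a]) (b - x)%:E = (b * a - a ^+ 2 / 2)%:E)%E.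
Proof.
rewrite le_eqVlt => /predU1P[<-|a0].
  by rewrite set_itv1 integral_set1 mulr0 expr0n mul0r subr0.
pose F (x : R) := b * x - x ^+ 2 / 2.
pose p : {poly R} := b *: 'X - 2^-1 *: 'X^2.
have FE : F = (fun x => p.[x]).
  by apply/funext => x; rewrite /F /p !hornerE /=; ring.
have dF (x : R) : is_derive x (1 : R) F (b - x).
  have -> : b - x = (p^`()%R).[x].
    by rewrite /p derivB !derivZ derivX derivXn /= !hornerE /= -mulr_natl; field.
  rewrite FE; exact: is_derive_poly.
rewrite (@continuous_FTC2 _ _ F)//.
- by rewrite -EFinB {1}/F [F 0]/F mulr0 expr0n mul0r subr0 subr0.
- apply: continuous_subspaceT => x; apply: cvgB; [exact: cvg_cst|exact: cvg_id].
- have cF x : {for x, continuous F}.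
    by apply: differentiable_continuous; apply/derivable1_diffP; exact: ex_derive.
  split; first by move=> x _; exact: ex_derive.
  + by apply: cvg_at_right_filter; exact: cF.
  + by apply: cvg_at_left_filter; exact: cF.
- by move=> x _; rewrite derive1E derive_val.
Qed.

(** For fixed [x] in the level set of [s], the inner integral is the remaining length [Y t - x],
    nonnegative since [Y s <= Y t]; it is then integrated over [x] from 0 to [Y s]. *)
Lemma integral_level_inverse_subordinator s t : A s !=set0 -> A t !=set0 -> s <= t ->
  (\int[mu]_x (((0 <= x) && (D (Num.max 0 x) w <= s))%:R%:E *
     \int[mu]_h ((0 <= h) && (D (Num.max 0 (x + h)) w <= t))%:R%:E) =
   (Y t * Y s - (Y s) ^+ 2 / 2)%:E)%E.
Proof.
move=> As At st.
have Ys0 := inverse_subordinator_ge0 D w s.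
have Yst : Y s <= Y t by exact: inverse_subordinator_nd.
have mb (x : R) : 0 <= x -> 
    measurable_fun [set: measurableTypeR R] (fun h => (0 <= h) && (D (Num.max 0 (x + h)) w <= t)).
  move=> x0; apply: measurable_and; first exact: measurable_fun_ler.
  apply: measurable_fun_ler => //; apply: nondecreasing_measurable => //.
  move=> h h' hh'; apply: D_nd; first by rewrite le_max lexx.
  by rewrite ge_max !le_max lexx/= lerD2l hh' orbT.
have integral_f3 x : 0 <= x -> (\int[mu]_h ((0 <= h) && (D (Num.max 0 (x + h)) w <= t))%:R%:E =
    (Num.max 0 (Y t - x))%:E)%E.
  by move=> x0; rewrite (integral_ind _ (mb _ x0)); exact: lebesgue_measure_shifted_level.
have main (b : bool) : (forall x, 0 <= x -> (D x w <= s) = (x < Y s ?<= if b)) ->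
   (\int[mu]_x (((0 <= x) && (D (Num.max 0 x) w <= s))%:R%:E *
     \int[mu]_h ((0 <= h) && (D (Num.max 0 (x + h)) w <= t))%:R%:E) =
    \int[mu]_(x in [set` Interval (BLeft 0%R) (BSide (~~ b) (Y s))]) (Y t - x)%:E)%E.
  move=> E; rewrite [RHS]integral_mkcond; apply: eq_integral => x _.
  rewrite patchE; case: ifPn; rewrite ?inE ?notin_setE/= in_itv/=.
    move=> /andP[x0 xY]; rewrite integral_f3// max_r// x0 E//.
    rewrite negbK in xY; rewrite xY mul1e max_r// subr_ge0 (le_trans _ Yst)//.
    by case: b xY {E} => //= /ltW.
  move=> h; have [x0|x0] := leP 0 x; last by rewrite mul0e.
  rewrite /= E// (_ : (x < Y s ?<= if b) = false) ?mul0e//.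
  by apply/negP => h2; apply: h; rewrite x0 negbK h2.
have [E|E] := inverse_subordinator_level As.
  rewrite (main false)//= integral_itv_bndo_bndc ?integral_subr_itv//.
  by apply/measurable_EFinP; apply: measurable_funB.
by rewrite (main true)// integral_subr_itv.
Qed.

End inverse_path_integrals.

Section stable_inverse.
Context {R : realType} {d : measure_display} {T : measurableType d}.
Variables (P : probability T R) (f : R -> R) (D : R -> T -> R) (a : R).
Hypothesis SD : is_subordinator P f D.
Hypotheses (a01 : 0 < a <= 1) (fE : forall s, 0 < s -> f s = s `^ a).
Local Notation mu := (@lebesgue_measure R).
Local Notation Y := (inverse_subordinator D).
Local Notation G := (Gamma (1 + a)).

Let LD := subordinator_levy SD.
Let D_nd := subordinator_nondecreasing SD.
Let mD := levy_measurable LD.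
Let mDD := measurable_subordinator SD.
Let a0 : 0 < a. Proof. by case/andP: a01. Qed.
Let G0 : 0 < G. Proof. exact: Gamma_gt0. Qed.

Let mlevel s : measurable_fun [set: measurableTypeR R * T]
  (fun z => (0 <= z.1) && (D (Num.max 0 z.1) z.2 <= s)).
Proof.
apply: measurable_and; first by apply: measurable_fun_ler.
by apply: measurable_fun_ler.
Qed.

Let mlevelw s w : measurable_fun [set: measurableTypeR R]
  (fun x => (0 <= x) && (D (Num.max 0 x) w <= s)).
Proof. exact: (measurable_fun_pair1 w (mlevel s)). Qed.

Lemma stable_level t : 0 <= t ->
  (\int[mu \x P]_z ((0 <= z.1) && (D (Num.max 0 z.1) z.2 <= t))%:R%:E =
   (t `^ a / G)%:E)%E.
Proof.
move=> t0; rewrite (integral_ind _ (mlevel t)) -(stable_potential SD a01 fE t0).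
congr ((mu \x P)%E _); apply/seteqP; split => -[x w] /=.
  by move=> /andP[x0 h]; split => //; rewrite /clamped_subordinator/= ge_max t0.
by move=> [-> ]; rewrite /clamped_subordinator/= ge_max => /andP[_ ->].
Qed.

(** The length of the level set has finite mean [t^a / G], hence is almost surely finite, whereas a
    path bounded by [t] would make it infinite. *)
Lemma stable_unbounded t : {ae P, forall w, [set x | 0 <= x /\ t < D x w] !=set0}.
Proof.
wlog t0 : t / 0 <= t.
  move=> H; have /H := normr_ge0 t; apply: filterS => w [x [x0 tx]].
  by exists x; split => //; apply: le_lt_trans tx; exact: ler_norm.
have mF : measurable_fun [set: measurableTypeR R * T]
    (fun z => ((0 <= z.1) && (D (Num.max 0 z.1) z.2 <= t))%:R%:E : \bar R).
  exact: measurable_ind.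
have := stable_level t0; rewrite fubini_tonelli2// => h.
have : P.-integrable setT (fubini_G mu (fun z : measurableTypeR R * T =>
    ((0 <= z.1) && (D (Num.max 0 z.1) z.2 <= t))%:R%:E : \bar R)).
  apply/integrableP; split; first exact: measurable_fun_fubini_tonelli_G.
  rewrite (eq_integral (fubini_G mu (fun z : measurableTypeR R * T =>
    ((0 <= z.1) && (D (Num.max 0 z.1) z.2 <= t))%:R%:E : \bar R))).
    by rewrite h ltry.
  by move=> w _; rewrite gee0_abs// integral_ge0.
move=> /(integrable_ae measurableT); apply: filterS => w /(_ I) fin.
apply: contrapT => At; move: fin; apply/negP.
rewrite /fubini_G (integral_ind _ (mlevelw t w)).
have -> : [set x | (0 <= x) && (D (Num.max 0 x) w <= t)] = `[0%R, +oo[%classic; last first.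
  by have /= -> := @lebesgue_measure_itv R `[0%R, +oo[; rewrite ltry.
apply/seteqP; split => x /=; rewrite in_itv/= andbT; first by move=> /andP[].
move=> x0; rewrite x0 max_r//= leNgt; apply/negP => tx; apply: At.
by exists x.
Qed.

Lemma inverse_stable_mean t : 0 <= t ->
  (\int[P]_w (Y t w)%:E = (t `^ a / G)%:E)%E.
Proof.
move=> t0; have mF : measurable_fun [set: measurableTypeR R * T]
    (fun z => ((0 <= z.1) && (D (Num.max 0 z.1) z.2 <= t))%:R%:E : \bar R).
  exact: measurable_ind.
rewrite -stable_level// fubini_tonelli2//; apply: ge0_ae_eq_integral => //.
- by apply/measurable_EFinP; exact: measurable_inverse_subordinator.
- exact: measurable_fun_fubini_tonelli_G.
- by move=> w _; rewrite lee_fin inverse_subordinator_ge0.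
- by move=> w _; exact: integral_ge0.
apply: filterS (stable_unbounded t) => w At _.
rewrite /fubini_G (integral_ind _ (mlevelw t w)).
rewrite -(lebesgue_measure_inverse_subordinator (D_nd w) At).
congr (mu _); apply/seteqP; split => x /=; rewrite in_itv/= andbT.
  by move=> [x0 h]; rewrite x0 max_r.
by move=> /andP[x0]; rewrite max_r.
Qed.

(** For [0 <= s <= t] this is the mean of [Y s * Y t - Y s ^ 2 / 2], kept as a double integral so
    that Tonelli can be applied. *)
Let J (s t : R) : \bar R := (\int[P]_w \int[mu]_x (((0 <= x) && (D (Num.max 0 x) w <= s))%:R%:E *
     \int[mu]_h ((0 <= h) && (D (Num.max 0 (x + h)) w <= t))%:R%:E))%E.

Let f3 (s t : R) (z : (measurableTypeR R * T) * measurableTypeR R) : \bar R :=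
  (((0 <= z.1.1) && (D (Num.max 0 z.1.1) z.1.2 <= s))%:R%:E *
   ((0 <= z.2) && (D (Num.max 0 (z.1.1 + z.2)) z.1.2 <= t))%:R%:E)%E.

Let mf3 s t : measurable_fun setT (f3 s t).
Proof.
apply: emeasurable_funM.
  exact: (measurableT_comp (measurable_ind (mlevel s)) (@measurable_fst _ _ _ _)).
apply: measurable_ind; apply: measurable_and; first by apply: measurable_fun_ler.
apply: measurable_fun_ler => //.
apply: (@measurableT_comp _ _ _ _ _ _ (fun z : measurableTypeR R * T => D (Num.max 0 z.1) z.2) _
  (fun z : (measurableTypeR R * T) * measurableTypeR R => (z.1.1 + z.2, z.1.2))) => //.
apply: measurable_fun_pair => /=; last by apply: measurableT_comp.
by apply: measurable_funD => //; apply: measurableT_comp.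
Qed.

Let f3_ge0 s t z : (0 <= f3 s t z)%E.
Proof. by rewrite mule_ge0. Qed.

(* Markov property: the increments of D after time x are independent of D x. *)
Let integral_f3 s t x : 0 <= x -> 0 <= s <= t ->
  (\int[P]_w \int[mu]_h f3 s t ((x, w), h) =
   \int[P]_w ((D x w <= s)%R%:R%:E * (((t - D x w) `^ a) / G)%:E))%E.
Proof.
move=> x0 /andP[s0 st].
have m1 : measurable_fun [set: T * measurableTypeR R] (fun z => f3 s t ((x, z.1), z.2)).
  apply: (measurableT_comp (@mf3 s t)) => /=.
  by apply: measurable_fun_pair => //; apply: measurable_fun_pair.
rewrite (fubini_tonelli (fun z : T * measurableTypeR R => f3 s t ((x, z.1), z.2)) m1)//=.
(* The path after time [x] is driven by an independent copy. Integrating over [h] and this copy,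
   with [w] fixed, gives [stable_level] at the level [t - D x w]. *)
pose k (z : (measurableTypeR R * T) * T) : \bar R :=
  ((0 <= z.1.1)%R%:R%:E * ((D x z.2 <= s)%R%:R%:E * (D x z.2 + D (Num.max 0 z.1.1) z.1.2 <= t)%R%:R%:E))%E.
have mDx : measurable_fun [set: (measurableTypeR R * T) * T] (fun z => D x z.2).
  by apply: measurableT_comp => //; exact: mD.
have mk : measurable_fun setT k.
  apply: emeasurable_funM.
    apply: measurable_ind; apply: measurable_fun_ler => //.
    exact: (measurableT_comp (@measurable_fst _ _ _ _) (@measurable_fst _ _ _ _)).
  apply: emeasurable_funM; apply: measurable_ind; apply: measurable_fun_ler => //.
  apply: measurable_funD => //.
  exact: (measurableT_comp mDD (@measurable_fst _ _ _ _)).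
have k0 z : (0 <= k z)%E by rewrite !mule_ge0.
transitivity (\int[mu]_h \int[P]_w' \int[P]_w k ((h, w'), w))%E.
  apply: eq_integral => h _; rewrite /k /f3 /= x0 max_r//=.
  have [h0|h0] := leP 0 h; last first.
    rewrite !integral0_eq// => w _; first by rewrite integral0_eq// => ? _; rewrite mul0e.
    by rewrite mule0.
  rewrite !max_r ?addr_ge0//=.
  pose F (z : R * R) : \bar R := ((z.1 <= s)%R%:R%:E * (z.1 + z.2 <= t)%R%:R%:E)%E.
  have mF : measurable_fun [set: R * R] F.
    apply: emeasurable_funM; apply: measurable_ind; apply: measurable_fun_ler => //.
    exact: measurable_funD.
  have F0 z : (0 <= F z)%E by rewrite mule_ge0.
  have := ge0_integral_levy_pair LD x0 h0 mF F0; rewrite /F/=.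
  under eq_integral do rewrite addrC subrK.
  move=> ->; apply: eq_integral => w' _; apply: eq_integral => w _.
  by rewrite mul1e.
transitivity (\int[mu \x P]_z \int[P]_w k (z, w))%E.
  rewrite fubini_tonelli1//; first exact: measurable_fun_fubini_tonelli_F.
  by move=> z; exact: integral_ge0.
pose muP := sigma_finite_product mu P.
rewrite -[LHS]/(\int[muP]_z \int[P]_w k (z, w))%E (fubini_tonelli k mk k0); apply: eq_integral => w _.
rewrite /k/=; have [Ds|Ds] := leP (D x w) s; last first.
  by rewrite mul0e integral0_eq// => z _; rewrite mul0e mule0.
rewrite mul1e -stable_level ?subr_ge0 ?(le_trans Ds)//.
apply: eq_integral => z _; rewrite mul1e -EFinM -natrM mulnb.
by rewrite lerBrDl.
Qed.

Let g (s t r : R) : R := if r <= s then (t - r) `^ a / G else 0.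

Let g_ge0 s t r : 0 <= g s t r.
Proof. by rewrite /g; case: ifP => // _; rewrite divr_ge0 ?powR_ge0 ?ltW. Qed.

Let measurable_g s t : measurable_fun setT (g s t).
Proof.
apply: measurable_fun_ifT => //; first exact: measurable_fun_ler.
by apply: measurable_funM => //; apply: (measurableT_comp (measurable_powR _)); exact: measurable_funB.
Qed.

(** [g s t] decreases up to [s] and vanishes beyond, so its positive superlevel sets are initial
    segments and the distribution function of the potential measure determines its integral. *)
Let g_level (s t y r : R) : s <= t -> 0 < y -> 
  (y <= g s t r) = (r <= Num.min s (t - (G * y) `^ a^-1)).
Proof.
move=> st y0; rewrite le_min /g; case: ifPn => [rs|_] /=; last by rewrite leNgt y0.
rewrite ler_pdivlMr// mulrC powR_invK//; last by rewrite subr_ge0 (le_trans rs).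
  by rewrite lerBrDl lerBrDr addrC.
by rewrite mulr_ge0 ?ltW.
Qed.

Let integral_g (s t : R) : 0 <= s <= t ->
  (\int[mu \x P]_(z in [set z : measurableTypeR R * T | (0 <= z.1)%R]) (g s t (clamped_subordinator D z))%:E =
   \int[mu]_(x in `[0%R, +oo[) (g s t ((G * x) `^ a^-1))%:E)%E.
Proof.
move=> /andP[s0 st].
have mD1 : measurable [set z : measurableTypeR R * T | 0 <= z.1].
  by apply: measurable_set_le => //; exact: measurable_fst.
have mG : measurable_fun [set: R] (fun x => (G * x) `^ a^-1).
  by apply: (measurableT_comp (measurable_powR _)); exact: measurable_funM.
have mC := measurable_clamped_subordinator SD.
rewrite -[LHS]/(\int[sigma_finite_product mu P]_(z in [set z : measurableTypeR R * T | (0 <= z.1)%R]) (g s t (clamped_subordinator D z))%:E)%E.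
rewrite [LHS]layer_cake//; last by apply: measurable_funTS; apply: (measurableT_comp (measurable_g s t)).
have mgG : measurable_fun (`[0%R, +oo[%classic : set R) (fun x : R => g s t ((G * x) `^ a^-1)).
  by apply: measurable_funTS; apply: (measurableT_comp (measurable_g s t)).
rewrite [RHS](layer_cake mu (measurable_itv _) mgG (fun x _ => g_ge0 s t _)).
apply: eq_integral => y; rewrite inE/= in_itv/= andbT => y0.
rewrite -[LHS]/((mu \x P)%E ([set z : measurableTypeR R * T | (0 <= z.1)%R] `&` [set z | y <= g s t (clamped_subordinator D z)])).
set b := Num.min s (t - (G * y) `^ a^-1).
have [b0|b0] := leP 0 b.
  transitivity ((mu \x P)%E ([set z : measurableTypeR R * T | (0 <= z.1)%R] `&` [set z | clamped_subordinator D z <= b])).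
    by congr ((mu \x P)%E (_ `&` _)); apply/seteqP; split => z /=; rewrite g_level.
  rewrite (stable_potential SD a01 fE b0) -lebesgue_measure_powR_le//.
  by congr (mu (_ `&` _)); apply/seteqP; split => z /=; rewrite g_level.
have E1 : [set z : measurableTypeR R * T | y <= g s t (clamped_subordinator D z)] = set0.
  rewrite -subset0 => z /=; rewrite g_level// -/b; apply/negP; rewrite -ltNge (lt_le_trans b0)//.
  by rewrite le_max lexx.
have E2 : [set x : R | y <= g s t ((G * x) `^ a^-1)] = set0.
  by rewrite -subset0 => z /=; rewrite g_level// -/b; apply/negP; rewrite -ltNge (lt_le_trans b0)// powR_ge0.
by rewrite E1 E2 !setI0 !measure0.
Qed.

(** One factor [1/G] comes from [g], the other from the substitution with [c = G]. *)
Let integral_g_incBeta (s t : R) : 0 <= s <= t ->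
  (\int[mu]_(x in `[0%R, +oo[) (g s t ((G * x) `^ a^-1))%:E =
   (t `^ (2 * a) / G ^+ 2 * a * incBeta a (a + 1) (s / t))%:E)%E.
Proof.
move=> /[dup] st' /andP[s0 st].
have mG : measurable_fun [set: R] (fun x => (G * x) `^ a^-1).
  by apply: (measurableT_comp (measurable_powR _)); exact: measurable_funM.
have h x : 0 <= x -> ((G * x) `^ a^-1 <= s) = (x <= s `^ a / G).
  move=> x0; rewrite -powR_invK ?mulr_ge0 ?(ltW G0)//.
  by rewrite ler_pdivlMr// mulrC.
transitivity (\int[mu]_(x in `[0%R, (s `^ a / G)%R]) (((t - (G * x) `^ a^-1) `^ a / G)%:E))%E.
  rewrite [LHS]integral_mkcond [RHS]integral_mkcond; apply: eq_integral => x _.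
  rewrite !patchE /=; have [x0|x0] := leP 0 x.
    rewrite mem_set/= ?in_itv/= ?x0//; case: ifPn; rewrite /g ?inE ?notin_setE /= in_itv/= x0/= => xs.
      by rewrite h// xs.
    by rewrite h// ifN//; apply/negP.
  rewrite !memNset//= in_itv/= lt_geF//.
have [t0|t0] := eqVneq t 0.
  have -> : s = 0 by apply/eqP; rewrite eq_le s0 -t0 st.
  rewrite t0 powR0 ?gt_eqF// mul0r set_itv1 integral_set1 powR0 ?mul0r// gt_eqF//.
  by rewrite mulr_gt0.
have {}t0 : 0 < t by rewrite lt_neqAle eq_sym t0 (le_trans s0).
under eq_integral do rewrite mulrC EFinM.
rewrite ge0_integralZl//; last 3 first.
- by apply: measurable_funTS; apply/measurable_EFinP; apply: (measurableT_comp (measurable_powR _)); exact: measurable_funB.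
- by move=> x _; rewrite lee_fin powR_ge0.
- by rewrite lee_fin invr_ge0 ltW.
rewrite integral_beta_subst//.
under eq_integral do rewrite EFinM.
rewrite ge0_integralZl//; last 3 first.
- by apply: measurable_funTS; apply/measurable_EFinP; exact: measurable_beta_integrand.
- by move=> x _; rewrite lee_fin mulr_ge0 ?powR_ge0.
- by rewrite lee_fin !mulr_ge0 ?powR_ge0 ?invr_ge0 ?ltW.
rewrite integral_incBeta//; last by rewrite divr_ge0 ?(ltW t0)//= ler_pdivrMr// mul1r.
rewrite -!EFinM; congr (_%:E); field.
by rewrite gt_eqF.
Qed.

Let JE (s t : R) : 0 <= s <= t ->
  J s t = (t `^ (2 * a) / G ^+ 2 * a * incBeta a (a + 1) (s / t))%:E.
Proof.
move=> /[dup] st' /andP[s0 st].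
have mK : measurable_fun [set: measurableTypeR R * T]
    (fun z => (\int[mu]_h f3 s t (z, h))%E).
  exact: (measurable_fun_fubini_tonelli_F (m2 := mu) (f3 s t)).
have K0 (z : measurableTypeR R * T) : (0 <= \int[mu]_h f3 s t (z, h))%E.
  by apply: integral_ge0 => h _; exact: f3_ge0.
transitivity (\int[P]_w \int[mu]_x \int[mu]_h f3 s t ((x, w), h))%E.
  apply: eq_integral => w _; apply: eq_integral => x _.
  rewrite /f3/= ge0_integralZl//.
  apply: measurable_ind; apply: measurable_and; first by apply: measurable_fun_ler.
  apply: measurable_fun_ler => //.
  apply: (measurableT_comp (measurable_fun_pair1 w mDD)) => /=.
  exact: measurable_funD.
rewrite -(fubini_tonelli (fun z : measurableTypeR R * T => \int[mu]_h f3 s t (z, h))%E mK K0).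
rewrite -integral_g_incBeta// -integral_g// [RHS]integral_mkcond.
have mD1 : measurable [set z : measurableTypeR R * T | 0 <= z.1].
  by apply: measurable_set_le => //; exact: measurable_fst.
have mgC : measurable_fun setT (fun z => (g s t (clamped_subordinator D z))%:E : \bar R).
  apply/measurable_EFinP; apply: (measurableT_comp (measurable_g s t)).
  exact: (measurable_clamped_subordinator SD).
rewrite [RHS]fubini_tonelli1//; last 2 first.
- by apply/(measurable_restrictT _ mD1); exact: measurable_funTS.
- by move=> z; rewrite patchE; case: ifP => // _; rewrite lee_fin.
apply: eq_integral => x _; rewrite /fubini_F/=.
have [x0|x0] := leP 0 x; last first.
  rewrite !integral0_eq// => w _.
    by rewrite patchE memNset//=; apply/negP; rewrite -ltNge.
  rewrite integral0_eq// => h _; rewrite /f3/= leNgt x0/= mul0e//.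
rewrite integral_f3//; apply: ge0_ae_eq_integral => //.
- apply: emeasurable_funM.
    by apply: measurable_ind; apply: measurable_fun_ler => //; exact: mD.
  apply/measurable_EFinP; apply: measurable_funM => //.
  by apply: (measurableT_comp (measurable_powR _)); apply: measurable_funB => //; exact: mD.
- rewrite (_ : (fun w => _) = (fun w => (g s t (clamped_subordinator D (x, w)))%:E)).
    exact: (measurableT_comp mgC (measurable_pair1 x)).
  by apply/funext => w; rewrite patchE mem_set.
- by move=> w _; rewrite mule_ge0// lee_fin divr_ge0 ?powR_ge0 ?(ltW G0).
- by move=> w _; rewrite patchE mem_set// lee_fin.
apply: filterS (subordinator_ae_ge0 SD) => w D0 _.
rewrite patchE mem_set// /clamped_subordinator/= (max_r x0) (max_r (D0 _ x0)) /g.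
by case: ifP => _; rewrite ?mul1e ?mul0e.
Qed.

Lemma inverse_stable_corr s t : 0 <= s <= t ->
  (\int[P]_w (Y s w * Y t w)%:E =
   (a / G ^+ 2 * (t `^ (2 * a) * incBeta a (a + 1) (s / t) +
                  s `^ (2 * a) * incBeta a (a + 1) (s / s)))%:E)%E.
Proof.
move=> /[dup] st' /andP[s0 st].
have mK r : measurable_fun [set: T] (fun w =>
    \int[mu]_x (((0 <= x) && (D (Num.max 0 x) w <= s))%:R%:E *
     \int[mu]_h ((0 <= h) && (D (Num.max 0 (x + h)) w <= r))%:R%:E))%E.
  have mK1 := measurable_fun_fubini_tonelli_F (m2 := mu) (f3 s r) (@mf3 s r) (f3_ge0 s r).
  have K0 (z : measurableTypeR R * T) : (0 <= \int[mu]_h f3 s r (z, h))%E.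
    by apply: integral_ge0 => h _; exact: f3_ge0.
  have := measurable_fun_fubini_tonelli_G (m1 := mu) (fun z : measurableTypeR R * T => \int[mu]_h f3 s r (z, h))%E mK1 K0.
  congr measurable_fun; apply/funext => w; apply: eq_integral => x _.
  rewrite /fubini_F /f3/= ge0_integralZl//.
  apply: measurable_ind; apply: measurable_and; first by apply: measurable_fun_ler.
  apply: measurable_fun_ler => //.
  apply: (measurableT_comp (measurable_fun_pair1 w mDD)) => /=.
  exact: measurable_funD.
have K0 r w : (0 <= \int[mu]_x (((0 <= x) && (D (Num.max 0 x) w <= s))%:R%:E *
     \int[mu]_h ((0 <= h) && (D (Num.max 0 (x + h)) w <= r))%:R%:E))%E.
  by apply: integral_ge0 => x _; rewrite mule_ge0// integral_ge0.
(* The pathwise identity at [(s, t)] misses [Y s ^ 2 / 2], which is exactly its value at [(s, s)].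
   This is the origin of the complete beta term. *)
transitivity (J s t + J s s)%E; last first.
  by rewrite !JE ?s0 ?lexx// -EFinD; congr (_%:E); ring.
rewrite /J -ge0_integralD//; apply: ge0_ae_eq_integral => //.
- apply/measurable_EFinP; apply: measurable_funM; exact: measurable_inverse_subordinator.
- exact: emeasurable_funD.
- by move=> w _; rewrite lee_fin mulr_ge0 ?inverse_subordinator_ge0.
- by move=> w _; rewrite adde_ge0.
apply: filterS2 (stable_unbounded s) (stable_unbounded t) => w As At _.
rewrite !(integral_level_inverse_subordinator (D_nd w))// -EFinD; congr (_%:E).
by field.
Qed.

End stable_inverse.

(** * Laplace transforms and moments *)

Section expR_limits.
Context {R : realType} {I : Type} (F : set_system I).
Hypothesis FF : ProperFilter F.

Lemma expR_sub1_bounds (u : R) : u <= expR u - 1 <= u * expR u.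
Proof.
have := expR_ge1Dx u; have := expR_ge1Dx (- u).
rewrite expRN => h1 h2; apply/andP; split; first lra.
have e0 := expR_gt0 u.
suff : (1 - u) * expR u <= 1 by lra.
by rewrite -ler_pdivlMr// mul1r.
Qed.

(** The normaliser [r] is independent of [u], so that first-order limits ([r = h]) and second-order
    ones ([r = h^2]) are both covered. *)
Lemma cvg_expR_sub1 (u r : I -> R) (L : R) : (\forall x \near F, 0 < r x) ->
  u x @[x --> F] --> (0 : R) -> u x / r x @[x --> F] --> L ->
  (expR (u x) - 1) / r x @[x --> F] --> L.
Proof.
move=> r0 u0 uL.
have eu : expR (u x) @[x --> F] --> (1 : R).
  by rewrite -expR0; apply: (continuous_cvg _ _ u0); exact: continuous_expR.
apply: (@squeeze_cvgr _ _ _ _ (fun x => u x / r x) (fun x => (u x / r x) * expR (u x))) => //.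
  near=> x; have rx : 0 < r x by near: x.
  have /andP[h1 h2] := expR_sub1_bounds (u x).
  by rewrite ler_pM2r ?invr_gt0// h1/= mulrAC ler_pM2r ?invr_gt0.
by rewrite -[X in _ --> X]mulr1; exact: cvgM.
Unshelve. all: by end_near. Qed.

Lemma cvg_ln_div (u r : I -> R) (L : R) : (\forall x \near F, 0 < r x) ->
  (\forall x \near F, 0 < u x) ->
  u x @[x --> F] --> (1 : R) -> (u x - 1) / r x @[x --> F] --> L ->
  ln (u x) / r x @[x --> F] --> L.
Proof.
move=> r0 u0 u1 uL.
apply: (@squeeze_cvgr _ _ _ _ (fun x => ((u x - 1) / r x) * (u x)^-1) (fun x => (u x - 1) / r x)) => //.
  near=> x; have rx : 0 < r x by near: x.
  have ux : 0 < u x by near: x.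
  have h (y : R) : 0 < y -> ln y <= y - 1.
    move=> y0; have := @le_ln1Dx _ (y - 1); have -> : 1 + (y - 1) = y by ring.
    by apply; lra.
  rewrite ler_pM2r ?invr_gt0// (h _ ux) andbT mulrAC ler_pM2r ?invr_gt0//.
  have := h (u x)^-1; rewrite invr_gt0 => /(_ ux); rewrite lnV ?posrE//.
  have -> : (u x - 1) / u x = 1 - (u x)^-1 by field; rewrite gt_eqF.
  lra.
rewrite -[X in _ --> X]mulr1; apply: cvgM => //.
by rewrite -[X in _ --> X]invr1; apply: cvgV => //; rewrite oner_eq0.
Unshelve. all: by end_near. Qed.

End expR_limits.

Section integral_limit.
Context {R : realType} {d : measure_display} {T : measurableType d}.
Variable m : {measure set T -> \bar R}.

(** Fatou bounds the integral of [g] by [l], and [h n <= g] gives the converse. Integrability of [g]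
    is thus a conclusion, as is needed to obtain moments from Laplace transforms. *)
Lemma integral_dominated_limit (h : nat -> T -> R) (g : T -> R) (L : nat -> R) (l : R) :
  (forall n, measurable_fun setT (h n)) -> measurable_fun setT g ->
  (forall n w, 0 <= h n w <= g w) -> (forall w, h n w @[n --> \oo] --> g w) ->
  (forall n, \int[m]_w (h n w)%:E = (L n)%:E)%E -> L n @[n --> \oo] --> l ->
  (\int[m]_w (g w)%:E = l%:E)%E.
Proof.
move=> mh mg hb hg hL Ll.
have Eg w : limn_einf (fun n => (h n w)%:E) = (g w)%:E.
  by apply: (@cvg_limn_einf_sup _ _ (g w)%:E _).1; apply: cvg_EFin (hg w); apply: nearW.
have Ll' : (L n)%:E @[n --> \oo] --> l%:E by apply: cvg_EFin Ll; apply: nearW.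
have EL : limn_einf (fun n => (L n)%:E) = l%:E.
  exact: (@cvg_limn_einf_sup _ _ l%:E _).1.
apply/eqP; rewrite eq_le; apply/andP; split.
  under eq_integral do rewrite -Eg.
  rewrite -EL; have -> : (fun n => (L n)%:E) = (fun n => \int[m]_w (h n w)%:E)%E by exact/funext.
  apply: fatou => //.
  - by move=> n; exact/measurable_EFinP.
  - by move=> n w _; rewrite lee_fin; case/andP: (hb n w).
apply: (@cvge_le _ \oo _ _ (fun n => (L n)%:E)); last exact: Ll'.
apply: nearW => n; rewrite -hL; apply: ge0_le_integral => //.
- by move=> w _; rewrite lee_fin; case/andP: (hb n w).
- by apply/measurable_EFinP.
- by apply/measurable_EFinP.
- by move=> w _; rewrite lee_fin; case/andP: (hb n w).
Qed.

End integral_limit.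

Lemma EFin_subr (R : realDomainType) (x : \bar R) (a b : R) :
  (x + a%:E = b%:E)%E -> x = (b - a)%:E.
Proof. by move=> h; rewrite EFinB -h addeK. Qed.

Section laplace_moments.
Context {R : realType} {d : measure_display} {T : measurableType d}.
Variables (P : probability T R) (X : T -> R) (phi : R -> R).
Hypotheses (mX : measurable_fun setT X) (X0 : forall w, 0 <= X w).
Hypothesis phiE : forall theta, 0 < theta ->
  (\int[P]_w (expR (- (theta * X w)))%:E = (phi theta)%:E)%E.

Let mexp theta : measurable_fun setT (fun w => expR (- (theta * X w))).
Proof. by apply: measurableT_comp => //; apply: measurableT_comp => //; exact: measurable_funM. Qed.

Let exp01 theta w : 0 < theta -> 0 <= expR (- (theta * X w)) <= 1.
Proof. by move=> h; rewrite expR_ge0 -expR0 ler_expR oppr_le0 mulr_ge0// ltW. Qed.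

Let int1 (r : R) : (\int[P]_w r%:E = r%:E)%E.
Proof. by rewrite integral_cst//= probability_setT mule1. Qed.

Let integral_1B theta : 0 < theta ->
  (\int[P]_w (1 - expR (- (theta * X w)))%:E = (1 - phi theta)%:E)%E.
Proof.
move=> h; have : (\int[P]_w (1 - expR (- (theta * X w)))%:E +
    \int[P]_w (expR (- (theta * X w)))%:E = 1%:E)%E.
  rewrite -ge0_integralD//.
  - by under eq_integral do rewrite -EFinD subrK; exact: int1.
  - by move=> w _; rewrite lee_fin subr_ge0; case/andP: (exp01 w h).
  - by apply/measurable_EFinP; exact: measurable_funB.
  - by apply/measurable_EFinP.
by rewrite phiE// => /EFin_subr.
Qed.

Let integral_1B2 theta : 0 < theta ->
  (\int[P]_w ((1 - expR (- (theta * X w))) ^+ 2)%:E =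
   (1 - 2 * phi theta + phi (2 * theta))%:E)%E.
Proof.
move=> h; have : (\int[P]_w ((1 - expR (- (theta * X w))) ^+ 2)%:E +
    2%:E * \int[P]_w (expR (- (theta * X w)))%:E =
    1%:E + \int[P]_w (expR (- (2 * theta * X w)))%:E)%E.
  rewrite -ge0_integralZl//; last by apply/measurable_EFinP.
  rewrite -ge0_integralD//.
  - rewrite -[in RHS](int1 1) -ge0_integralD//; last by apply/measurable_EFinP.
    apply: eq_integral => w _; rewrite -EFinM -!EFinD; congr (_%:E).
    have -> : - (2 * theta * X w) = 2%:R * (- (theta * X w)) by ring.
    by rewrite expRM_natl; ring.
  - by move=> w _; rewrite lee_fin sqr_ge0.
  - by apply/measurable_EFinP; apply: measurable_funX; exact: measurable_funB.
  - by apply: measurable_funeM; apply/measurable_EFinP; exact: mexp.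
rewrite !phiE ?mulr_gt0// -EFinM -EFinD => /EFin_subr ->.
by congr (_%:E); ring.
Qed.

Let difference_le theta w : 0 < theta ->
  0 <= (1 - expR (- (theta * X w))) / theta <= X w.
Proof.
move=> h; rewrite divr_ge0 ?(ltW h)//=; last by rewrite subr_ge0; case/andP: (exp01 w h).
rewrite ler_pdivrMr//; have := expR_ge1Dx (- (theta * X w)); lra.
Qed.

Let difference_cvg w :
  (1 - expR (- (harmonic n * X w))) / harmonic n @[n --> \oo] --> X w.
Proof.
have h : (expR (- (harmonic n * X w)) - 1) / harmonic n @[n --> \oo] --> - X w.
  apply: cvg_expR_sub1.
  - by apply: nearW => n; rewrite /harmonic/= invr_gt0.
  - rewrite -oppr0 -(mul0r (X w)); apply: cvgN; apply: cvgMl; exact: cvg_harmonic.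
  - apply: cvg_near_cst; apply: nearW => n.
    by rewrite /harmonic/=; field.
rewrite -[X in _ --> X]opprK; apply: cvg_trans (cvgN h).
by apply: near_eq_cvg; apply: nearW => n; rewrite /= -mulNr opprB.
Qed.

Let harmonic_gt0 n : 0 < @harmonic R n.
Proof. by rewrite /harmonic/= invr_gt0. Qed.

(** The difference quotient [(1 - exp(-theta X)) / theta] lies below [X] and tends to it as [theta]
    decreases to 0 along [1/(n+1)]. *)
Lemma laplace_mean l : (1 - phi (harmonic n)) / harmonic n @[n --> \oo] --> l ->
  (\int[P]_w (X w)%:E = l%:E)%E.
Proof.
apply: (@integral_dominated_limit _ _ _ P
  (fun n w => (1 - expR (- (harmonic n * X w))) / harmonic n)) => //.
- by move=> n; apply: measurable_funM => //; exact: measurable_funB.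
- by move=> n w; exact: difference_le.
move=> n; rewrite (_ : (fun w => _) = (fun w => (harmonic n)^-1%:E *
    (1 - expR (- (harmonic n * X w)))%:E)%E); last first.
  by apply/funext => w; rewrite -EFinM mulrC.
rewrite ge0_integralZl//.
- by rewrite integral_1B// -EFinM mulrC.
- by apply/measurable_EFinP; exact: measurable_funB.
- by move=> w _; rewrite lee_fin subr_ge0; case/andP: (exp01 w (harmonic_gt0 n)).
- by rewrite lee_fin invr_ge0 ltW.
Qed.

(** The square of the same quotient: [(1 - exp(-theta X))^2] expands into transforms at [theta] and
    [2 theta] only. *)
Lemma laplace_second_moment l :
  (1 - 2 * phi (harmonic n) + phi (2 * harmonic n)) / harmonic n ^+ 2 @[n --> \oo] --> l ->
  (\int[P]_w (X w ^+ 2)%:E = l%:E)%E.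
Proof.
apply: (@integral_dominated_limit _ _ _ P
  (fun n w => ((1 - expR (- (harmonic n * X w))) / harmonic n) ^+ 2)) => //.
- by move=> n; apply: measurable_funX; apply: measurable_funM => //; exact: measurable_funB.
- exact: measurable_funX.
- move=> n w; have /andP[h1 h2] := difference_le w (harmonic_gt0 n).
  by rewrite sqr_ge0/= ler_pXn2r// nnegrE.
- by move=> w; apply: cvgM; exact: difference_cvg.
move=> n; rewrite (_ : (fun w => _) = (fun w => (harmonic n ^+ 2)^-1%:E *
    ((1 - expR (- (harmonic n * X w))) ^+ 2)%:E)%E); last first.
  by apply/funext => w; rewrite -EFinM mulrC exprMn exprVn.
rewrite ge0_integralZl//.
- by rewrite integral_1B2// -EFinM mulrC.
- by apply/measurable_EFinP; apply: measurable_funX; exact: measurable_funB.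
- by move=> w _; rewrite lee_fin sqr_ge0.
- by rewrite lee_fin invr_ge0 sqr_ge0.
Qed.

End laplace_moments.

(** * Generalized counting process *)

Section gcp_laplace.
Context {R : realType} {d : measure_display} {T : measurableType d}.
Variables (P : probability T R) (k : nat) (lam : 'I_k -> R) (M : R -> T -> R).
Hypothesis GM : is_gcp P lam M.

Let LM := gcp_levy GM.
Let mM t : 0 <= t -> measurable_fun setT (M t) := levy_measurable LM (t := t).

Let p0 (h : R) : R := fine (P [set w | M h w = 0]).
Let p (i : 'I_k) (h : R) : R := fine (P [set w | M h w = i.+1%:R]).

Let mis (r h : R) : 0 <= h -> measurable_fun setT (fun w => M h w == r).
Proof. by move=> h0; apply: measurable_fun_eqr => //; exact: mM. Qed.

Let integral_is (r h : R) : 0 <= h ->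
  (\int[P]_w (M h w == r)%:R%:E = (fine (P [set w | M h w = r]))%:E)%E.
Proof.
move=> h0; rewrite (integral_ind _ (mis r h0)).
have -> : [set w | M h w = r] = [set w | M h w == r] by apply/seteqP; split=> w /= /eqP.
rewrite fineK// fin_num_measure//.
by rewrite -[X in measurable X]setTI; exact: (mis r h0).
Qed.

(** Pays [e i] at the value [i + 1] and 0 elsewhere; its mean involves the law of [M h] through the
    [p i] alone. *)
Let jumps (e : 'I_k -> R) (x : R) : R := \sum_(i < k) e i * (x == i.+1%:R)%:R.

Let jumpsE (e : 'I_k -> R) (x : R) :
  (exists2 i : 'I_k, x = i.+1%:R & jumps e x = e i) \/
  ((forall i : 'I_k, x != i.+1%:R) /\ jumps e x = 0).
Proof.
have [[i ->]|h] := pselect (exists i : 'I_k, x = i.+1%:R); last first.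
  right; split; first by move=> i; apply/eqP => xi; apply: h; exists i.
  rewrite /jumps big1// => i _; case: eqP => [xi|]; rewrite ?mulr0//.
  by exfalso; apply: h; exists i.
left; exists i => //; rewrite /jumps (bigD1 i)//= eqxx mulr1 big1 ?addr0// => j ji.
by rewrite eqr_nat eqSS eq_sym (inj_eq val_inj) (negbTE ji) mulr0.
Qed.

Let mjumps e h : 0 <= h -> measurable_fun setT (fun w => jumps e (M h w)).
Proof.
move=> h0; apply: measurable_sum => i; apply: measurable_funM => //.
by apply/measurable_EFinP; apply: measurable_ind; exact: mis.
Qed.

Let jumps_ge0 e x : (forall i, 0 <= e i) -> 0 <= jumps e x.
Proof. by move=> e0; apply: sumr_ge0 => i _; rewrite mulr_ge0. Qed.

Let integral_jumps (e : 'I_k -> R) h : 0 <= h -> (forall i, 0 <= e i) ->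
  (\int[P]_w (jumps e (M h w))%:E = (\sum_(i < k) e i * p i h)%:E)%E.
Proof.
move=> h0 e0; rewrite /jumps; under eq_integral do rewrite -sumEFin.
have mi i : measurable_fun setT (fun w => (M h w == i.+1%:R)%:R%:E : \bar R).
  by apply: measurable_ind; exact: mis.
rewrite ge0_integral_sum//.
- rewrite -sumEFin; apply: eq_bigr => i _.
  under eq_integral do rewrite EFinM.
  by rewrite ge0_integralZl// ?lee_fin// integral_is.
- by move=> i; under eq_fun do rewrite EFinM; exact: measurable_funeM.
- by move=> i w _; rewrite lee_fin mulr_ge0.
Qed.

Let integral_le1 (g : T -> R) : measurable_fun setT g -> 
  (forall w, 0 <= g w <= 1) -> (\int[P]_w (g w)%:E <= 1)%E.
Proof.
move=> mg g01; have -> : 1%E = (\int[P]_w 1%:E)%E by rewrite integral_cst//= probability_setT mule1.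
apply: ge0_le_integral => //; first by move=> w _; rewrite lee_fin; case/andP: (g01 w).
- exact/measurable_EFinP.
- by move=> w _; rewrite lee_fin; case/andP: (g01 w).
Qed.

Let mneg h : 0 <= h -> measurable_fun setT (fun w => M h w < 0).
Proof. by move=> h0; apply: measurable_fun_ltr => //; exact: mM. Qed.

(** The negative half-line, 0 and the values [i + 1] are disjoint, so their probabilities add up to
    at most 1. *)
Let negative_mass h : 0 <= h ->
  fine (P [set w | M h w < 0]) <= 1 - p0 h - \sum_(i < k) p i h.
Proof.
move=> h0; rewrite -lee_fin fineK; last first.
  rewrite fin_num_measure// -[X in measurable X]setTI; exact: mneg.
have sE : (\sum_(i < k) p i h)%:E = (\int[P]_w (jumps (fun=> 1) (M h w))%:E)%E.
  by rewrite integral_jumps//; congr (_%:E); apply: eq_bigr => i _; rewrite mul1r.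
have : (\int[P]_w (M h w < 0)%R%:R%:E + \int[P]_w (M h w == 0)%:R%:E +
    \int[P]_w (jumps (fun=> 1) (M h w))%:E <= 1)%E.
  rewrite -ge0_integralD//; [|exact: measurable_ind (mneg h0)|exact: measurable_ind (mis 0 h0)].
  rewrite -ge0_integralD//.
  - apply: integral_le1.
      apply: measurable_funD; last exact: mjumps.
      by apply: measurable_funD; apply/measurable_EFinP; apply: measurable_ind; [exact: mneg|exact: mis].
    move=> w; rewrite !addr_ge0 ?jumps_ge0//=.
    case: (jumpsE (fun=> 1) (M h w)) => [[i -> ->]|[_ ->]].
      by rewrite pnatr_eq0/= ltrn0/= !add0r.
    by rewrite addr0; case: ltgtP => _; rewrite ?addr0 ?add0r// ltW.
  - by move=> w _; rewrite lee_fin addr_ge0.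
  - apply: emeasurable_funD; apply: measurable_ind; [exact: mneg|exact: mis].
  - by move=> w _; rewrite lee_fin jumps_ge0.
  - by apply/measurable_EFinP; exact: mjumps.
rewrite -sE integral_is// (integral_ind _ (mneg h0)) -/(p0 h).
have : P [set w | M h w < 0] \is a fin_num.
  rewrite fin_num_measure// -[X in measurable X]setTI; exact: mneg.
move=> Pfin; rewrite -[X in (X + _ + _ <= _)%E](fineK Pfin) -!EFinD lee_fin.
by rewrite -[X in (X <= _%:E)%E](fineK Pfin) lee_fin; lra.
Qed.

(** A negative sum needs a negative summand, so [q] is subadditive and [q(t) <= (n+1) q(t/(n+1))].
    The rates make [q(h) = o(h)]: both [(1 - p0)/h] and the sum of the [p i / h] tend to the total
    rate. *)
Lemma gcp_ae_ge0 t : 0 <= t -> {ae P, forall w, 0 <= M t w}.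
Proof.
rewrite le_eqVlt => /orP[/eqP<-|t0].
  by apply: filterS (levy_start LM) => w ->.
pose q h := fine (P [set w | M h w < 0]).
have mq h : 0 <= h -> measurable [set w | M h w < 0].
  by move=> h0; rewrite -[X in measurable X]setTI; exact: mneg.
have Pq h : 0 <= h -> P [set w | M h w < 0] = (q h)%:E.
  by move=> h0; rewrite fineK// fin_num_measure//; exact: mq.
have q0 h : 0 <= q h by rewrite fine_ge0.
have qD s h : 0 <= s -> 0 <= h -> q (s + h) <= q s + q h.
  move=> s0 h0; rewrite -lee_fin EFinD -!Pq ?addr_ge0//.
  have inc : P [set w | M h w < 0] = P [set w | M (s + h) w - M s w < 0].
    have := @levy_stationary_increments _ _ _ _ _ LM s (s + h) [set x | x < 0] s0.
    have -> : s + h - s = h by ring.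
    move=> /= <- //; first by rewrite lerDl.
    by apply: measurable_set_lt.
  have mi : measurable [set w | M (s + h) w - M s w < 0].
    by apply: measurable_set_lt => //; apply: measurable_funB; apply: mM => //; exact: addr_ge0.
  rewrite inc; apply: le_trans (measureU2 _ (mq _ s0) mi).
  apply: le_measure; rewrite ?inE//.
  - by apply: mq; exact: addr_ge0.
  - by apply: measurableU => //; exact: mq.
  - move=> w /= h1; have [h2|h2] := ltP (M s w) 0; [by left|right; lra].
have qn n h : 0 <= h -> q (n.+1%:R * h) <= n.+1%:R * q h.
  move=> h0; elim: n => [|n IH]; first by rewrite !mul1r.
  rewrite -natr1 !mulrDl !mul1r; apply: le_trans (qD _ _ _ _) _ => //; first by rewrite mulr_ge0.
  by rewrite lerD2r.
have lim0 : (1 - p0 h - \sum_(i < k) p i h) / h @[h --> 0^'+] --> (0 : R).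
  rewrite -[X in _ --> X](subrr (\sum_(i < k) lam i)).
  have -> : (fun h => (1 - p0 h - \sum_(i < k) p i h) / h) =
      (fun h => (1 - p0 h) / h - \sum_(i < k) p i h / h).
    by apply/funext => h; rewrite mulrBl mulr_suml.
  apply: cvgB; first exact: (gcp_total_rate GM).
  apply: cvg_big => [|i _]; first exact: add_continuous.
  exact: (gcp_jump_rate GM).
have u0 (n : nat) : 0 < t * harmonic n by rewrite mulr_gt0// /harmonic/= invr_gt0.
have := (cvg_at_rightP _ _ _).1 lim0 (fun n => t * harmonic n).
have ul : t * harmonic n @[n --> \oo] --> (0 : R).
  by rewrite -(mulr0 t); apply: cvgMr; exact: cvg_harmonic.
move=> /(_ (conj u0 ul)) lim1.
have qt : q t <= 0.
  rewrite -(mulr0 t).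
  have lc : q t @[n --> \oo] --> q t by exact: cvg_cst.
  pose L n := t * ((1 - p0 (t * harmonic n) - \sum_(i < k) p i (t * harmonic n)) / (t * harmonic n)).
  have lim2 : L n @[n --> \oo] --> t * 0 by exact: cvgMr lim1.
  apply: (ler_cvg_to lc lim2).
  apply: nearW => n; have h0 := ltW (u0 n).
  have := qn n (t * harmonic n) h0; rewrite /harmonic/= mulrCA mulfV ?mulr1// => h1.
  apply: le_trans h1 _.
  have := negative_mass h0; rewrite -/(q _) => h2.
  rewrite /L [leRHS](_ : _ = n.+1%:R * (1 - p0 (t * harmonic n) - \sum_(i < k) p i (t * harmonic n))).
    by rewrite ler_pM2l.
  move: (1 - _ - _) => A; rewrite /harmonic/=; field.
  by rewrite nat1r pnatr_eq0/= gt_eqF.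
exists [set w | M t w < 0]; split; first by apply: mq; exact: ltW.
  by rewrite Pq ?(ltW t0)//; apply/eqP; rewrite eqe eq_le qt q0.
by move=> w /= /negP; rewrite -ltNge.
Qed.

Let mexp theta h : 0 <= h -> measurable_fun setT (fun w => (expR (- (theta * M h w)))%:E : \bar R).
Proof.
move=> h0; apply/measurable_EFinP; apply: measurableT_comp => //; apply: measurableT_comp => //.
by apply: measurable_funM => //; exact: mM.
Qed.

Let laplaceD theta s h : 0 <= s -> 0 <= h ->
  (\int[P]_w (expR (- (theta * M (s + h) w)))%:E =
   \int[P]_w (expR (- (theta * M s w)))%:E * \int[P]_w (expR (- (theta * M h w)))%:E)%E.
Proof.
move=> s0 h0.
pose F (z : R * R) : \bar R := ((expR (- (theta * z.1)))%:E * (expR (- (theta * z.2)))%:E)%E.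
have mF : measurable_fun [set: R * R] F.
  apply: emeasurable_funM; apply/measurable_EFinP; apply: measurableT_comp => //;
    apply: measurableT_comp => //; exact: measurable_funM.
have F0 z : (0 <= F z)%E by rewrite mule_ge0// lee_fin expR_ge0.
have := ge0_integral_levy_pair LM s0 h0 mF F0; rewrite /F/=.
under eq_integral do rewrite -EFinM -expRD -opprD -mulrDr addrC subrK.
move=> ->.
under eq_integral => w' _.
  rewrite ge0_integralZr//; last exact: mexp.
  over.
rewrite ge0_integralZl//; first exact: mexp.
by apply: integral_ge0 => w _; rewrite lee_fin expR_ge0.
Qed.

Let phi (theta h : R) : R := fine (\int[P]_w (expR (- (theta * M h w)))%:E)%E.

Let e (theta : R) (i : 'I_k) : R := expR (- (theta * i.+1%:R)).

Let e01 theta i : 0 < theta -> 0 <= e theta i <= 1.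
Proof. by move=> h; rewrite /e expR_ge0 -expR0 ler_expR oppr_le0 mulr_ge0// ltW. Qed.

(** Pointwise where [M >= 0]: at [M = i + 1] the two terms add up to 1, elsewhere
    [exp(-theta M) <= 1]. Without a sign for [M] the transform could even be infinite. *)
Let laplace_upper theta h : 0 < theta -> 0 <= h ->
  (\int[P]_w (expR (- (theta * M h w)))%:E + (\sum_(i < k) (1 - e theta i) * p i h)%:E <= 1)%E.
Proof.
move=> th h0; have ei i : 0 <= 1 - e theta i by rewrite subr_ge0; case/andP: (e01 i th).
rewrite -integral_jumps// -ge0_integralD//.
- have -> : 1%E = (\int[P]_w 1%:E)%E by rewrite integral_cst//= probability_setT mule1.
  apply: ae_ge0_le_integral => //.
  + by move=> w _; rewrite lee_fin addr_ge0 ?expR_ge0 ?jumps_ge0.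
  + apply: emeasurable_funD; first exact: mexp.
    by apply/measurable_EFinP; exact: mjumps.
  apply: filterS (gcp_ae_ge0 h0) => w M0 _; rewrite lee_fin.
  case: (jumpsE (fun i => 1 - e theta i) (M h w)) => [[i -> ->]|[_ ->]].
    by rewrite /e addrC subrK.
  by rewrite addr0 -expR0 ler_expR oppr_le0 mulr_ge0// ltW.
- exact: mexp.
- by move=> w _; rewrite lee_fin jumps_ge0.
- by apply/measurable_EFinP; exact: mjumps.
Qed.

Let phi_fin theta h : 0 < theta -> 0 <= h ->
  (\int[P]_w (expR (- (theta * M h w)))%:E = (phi theta h)%:E)%E.
Proof.
move=> th h0; rewrite fineK// ge0_fin_numE; last by apply: integral_ge0 => w _; rewrite lee_fin expR_ge0.
apply: le_lt_trans (ltry 1); apply: le_trans (laplace_upper th h0).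
rewrite leeDl// lee_fin sumr_ge0// => i _; rewrite mulr_ge0 ?fine_ge0//.
by rewrite subr_ge0; case/andP: (e01 i th).
Qed.

Let phi_ge theta h : 0 < theta -> 0 <= h ->
  p0 h + \sum_(i < k) e theta i * p i h <= phi theta h.
Proof.
move=> th h0; rewrite -lee_fin -phi_fin// EFinD -integral_is//.
have ei i : 0 <= e theta i by case/andP: (e01 i th).
rewrite -integral_jumps// -ge0_integralD//.
- apply: ge0_le_integral => //.
  + by move=> w _; rewrite lee_fin addr_ge0 ?jumps_ge0.
  + apply: emeasurable_funD; first by apply: measurable_ind; exact: mis.
    by apply/measurable_EFinP; exact: mjumps.
  + exact: mexp.
  move=> w _; rewrite -EFinD lee_fin.
  case: (jumpsE (e theta) (M h w)) => [[i -> ->]|[_ ->]].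
    by rewrite pnatr_eq0/= add0r.
  rewrite addr0; case: eqP => [->|_]; last exact: expR_ge0.
  by rewrite mulr0 oppr0 expR0.
- by apply: measurable_ind; exact: mis.
- by move=> w _; rewrite lee_fin jumps_ge0.
- by apply/measurable_EFinP; exact: mjumps.
Qed.

Let phi_le theta h : 0 < theta -> 0 <= h ->
  phi theta h <= 1 - \sum_(i < k) (1 - e theta i) * p i h.
Proof.
move=> th h0; have := laplace_upper th h0; rewrite phi_fin// -EFinD lee_fin; lra.
Qed.

(** The logarithm of the Laplace transform at time 1 of a compound Poisson process with jumps
    [i + 1] at rates [lam i]. *)
Definition gcp_exponent theta : R := \sum_(i < k) lam i * (expR (- (theta * i.+1%:R)) - 1).

(** [phi_ge] counts the mass outside [0, ..., k] as 0 and [phi_le] counts it as 1; that mass is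
    [o(h)], so both bounds have the same rate. *)
Let phi_rate theta : 0 < theta ->
  (phi theta h - 1) / h @[h --> 0^'+] --> gcp_exponent theta.
Proof.
move=> th; rewrite /gcp_exponent.
apply: (@squeeze_cvgr _ _ _ _
  (fun h => - ((1 - p0 h) / h) + \sum_(i < k) e theta i * (p i h / h))
  (fun h => \sum_(i < k) (e theta i - 1) * (p i h / h))).
- near=> h; have h0 : 0 < h by near: h; exact: nbhs_right_gt.
  have := phi_le th (ltW h0); have := phi_ge th (ltW h0).
  move: (phi theta h) => x h1 h2; apply/andP; split.
    under eq_bigr do rewrite mulrA.
    rewrite -mulr_suml -mulNr -mulrDl ler_pM2r ?invr_gt0//; lra.
  under eq_bigr do rewrite mulrA.
  rewrite -mulr_suml ler_pM2r ?invr_gt0//.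
  suff : \sum_(i < k) (e theta i - 1) * p i h = - \sum_(i < k) (1 - e theta i) * p i h by lra.
  by rewrite -sumrN; apply: eq_bigr => i _; ring.
- rewrite (_ : \sum_(i < k) _ = - (\sum_(i < k) lam i) + \sum_(i < k) e theta i * lam i); last first.
    by rewrite -sumrN -big_split/=; apply: eq_bigr => i _; rewrite -/(e theta i); ring.
  apply: cvgD; first by apply: cvgN; exact: (gcp_total_rate GM).
  apply: cvg_big => [|i _]; first exact: add_continuous.
  by apply: cvgMr; exact: (gcp_jump_rate GM).
- apply: cvg_big => [|i _]; first exact: add_continuous.
  by rewrite mulrC; apply: cvgMr; exact: (gcp_jump_rate GM).
Unshelve. all: by end_near. Qed.

Let phi_cvg1 theta : 0 < theta -> phi theta h @[h --> 0^'+] --> (1 : R).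
Proof.
move=> th; rewrite -[X in _ --> X](addr0 1) -[X in _ --> _ + X](mul0r (gcp_exponent theta)).
have h1 : 1 + h * ((phi theta h - 1) / h) @[h --> 0^'+] --> 1 + 0 * gcp_exponent theta.
  apply: cvgD; first exact: cvg_cst.
  apply: cvgM; last exact: phi_rate.
  by apply: cvg_at_right_filter; exact: cvg_id.
apply: cvg_trans h1; apply: near_eq_cvg; near=> h.
have h0 : h != 0 by rewrite gt_eqF//; near: h; exact: nbhs_right_gt.
by field.
Unshelve. all: by end_near. Qed.

Let phiX theta h n : 0 < theta -> 0 <= h -> phi theta (n.+1%:R * h) = phi theta h ^+ n.+1.
Proof.
move=> th h0; elim: n => [|n IH]; first by rewrite mul1r expr1.
rewrite -natr1 mulrDl mul1r exprSr -IH.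
apply: EFin_inj; rewrite EFinM -!phi_fin ?addr_ge0 ?mulr_ge0//.
by rewrite laplaceD// mulr_ge0.
Qed.

(** Independent stationary increments give [phi(t) = phi(t/(n+1))^(n+1)]. After taking logarithms,
    [ln phi(h) / h] is constant along [h = t/(n+1)], so it equals its limit at 0. *)
Lemma gcp_laplace theta t : 0 < theta -> 0 <= t ->
  (\int[P]_w (expR (- (theta * M t w)))%:E = (expR (t * gcp_exponent theta))%:E)%E.
Proof.
move=> th; rewrite le_eqVlt => /orP[/eqP<-|t0].
  rewrite mul0r expR0 -[RHS](_ : \int[P]_w 1%:E = 1)%E; last first.
    by rewrite integral_cst//= probability_setT mule1.
  apply: ge0_ae_eq_integral => //.
  - exact: mexp.
  by apply: filterS (levy_start LM) => w -> _; rewrite mulr0 oppr0 expR0.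
have u0 (n : nat) : 0 < t * harmonic n by rewrite mulr_gt0// /harmonic/= invr_gt0.
have ul : t * harmonic n @[n --> \oo] --> (0 : R).
  by rewrite -(mulr0 t); apply: cvgMr; exact: cvg_harmonic.
have rate : ln (phi theta h) / h @[h --> 0^'+] --> gcp_exponent theta.
  apply: cvg_ln_div; [exact: nbhs_right_gt| |exact: phi_cvg1|exact: phi_rate].
  exact: (cvgr_gt _ (phi_cvg1 th) _ ltr01).
have := (cvg_at_rightP _ _ _).1 rate _ (conj u0 ul) => lim.
have lim1 := (cvg_at_rightP _ _ _).1 (phi_cvg1 th) _ (conj u0 ul).
have phit n : phi theta t = phi theta (t * harmonic n) ^+ n.+1.
  rewrite -phiX ?(ltW (u0 n))// /harmonic/=; congr (phi theta _).
  by rewrite mulrCA mulfV ?mulr1.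
have near_pos : \forall n \near \oo, 0 < phi theta (t * harmonic n) by exact: cvgr_gt lim1 _ ltr01.
have phit0 : 0 < phi theta t.
  near \oo => n; rewrite (phit n) exprn_gt0//; near: n; exact: near_pos.
have lim2 : ln (phi theta (t * harmonic n)) / (t * harmonic n) @[n --> \oo] --> ln (phi theta t) / t.
  apply: cvg_near_cst; apply: filterS near_pos => n pn.
  rewrite (phit n) lnXn// /harmonic/= -mulr_natl; field.
  by rewrite nat1r pnatr_eq0/= gt_eqF.
have E := cvg_unique (@Rhausdorff R) lim lim2.
by rewrite phi_fin ?(ltW t0)// E mulrC divfK ?gt_eqF// lnK.
Unshelve. all: by end_near. Qed.

End gcp_laplace.

(** The data that pass through differences and time changes. [c] is the uncentred mixed moment,
    specified for ordered times only; right-continuity serves the measurability of the process at a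
    random time. *)
Record second_order (R : realType) (d : measure_display) (T : measurableType d)
    (P : probability T R) (X : R -> T -> R) (a : R -> R) (c : R -> R -> R) : Prop :=
  SecondOrder {
  second_order_measurable : forall t : R, 0 <= t -> measurable_fun setT (X t);
  second_order_right_continuous : forall w (t : R), 0 <= t -> X u w @[u --> t^'+] --> X t w;
  second_order_mean : forall t : R, 0 <= t -> (\int[P]_w (X t w)%:E = (a t)%:E)%E;
  second_order_corr : forall s t : R, 0 <= s <= t ->
    (\int[P]_w (X s w * X t w)%:E = (c s t)%:E)%E
}.

(** * Second-order expansion of the Laplace exponent at 0 *)

Section gcp_exponent_limits.
Context {R : realType} (k : nat) (lam : 'I_k -> R).
Local Notation c := (gcp_exponent lam).
Local Notation h := (@harmonic R).
Local Notation m1 := (\sum_(i < k) lam i * i.+1%:R).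
Local Notation m2 := (\sum_(i < k) lam i * i.+1%:R ^+ 2).

Let h0 n : 0 < h n. Proof. by rewrite /harmonic/= invr_gt0. Qed.

Let expR_rate (j : R) : (expR (- (h n * j)) - 1) / h n @[n --> \oo] --> - j.
Proof.
apply: cvg_expR_sub1.
- exact: nearW.
- rewrite -[X in _ --> X]oppr0 -[X in _ --> - X](mul0r j); apply: cvgN; apply: cvgMl; exact: cvg_harmonic.
- apply: cvg_near_cst; apply: nearW => n; rewrite -mulrN mulrAC divff ?mul1r//.
  by rewrite gt_eqF.
Qed.

Let c_rate : c (h n) / h n @[n --> \oo] --> - m1.
Proof.
rewrite -sumrN; under eq_fun do rewrite mulr_suml.
apply: cvg_big => [|i _]; first exact: add_continuous.
rewrite -mulrN; under eq_fun do rewrite -mulrA.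
by apply: cvgMr; exact: expR_rate.
Qed.

Let c_cvg0 : c (h n) @[n --> \oo] --> (0 : R).
Proof.
rewrite -[X in _ --> X](mulr0 (- m1)).
apply: cvg_trans (cvgM c_rate cvg_harmonic); apply: near_eq_cvg; apply: nearW => n.
by rewrite /= divfK// gt_eqF.
Qed.

Let phi_rate t : (expR (t * c (h n)) - 1) / h n @[n --> \oo] --> - (t * m1).
Proof.
apply: cvg_expR_sub1; first exact: nearW.
- by rewrite -[X in _ --> X](mulr0 t); apply: cvgMr; exact: c_cvg0.
- rewrite -mulrN; under eq_fun do rewrite -mulrA.
  by apply: cvgMr; exact: c_rate.
Qed.

Lemma gcp_exponent_rate1 t :
  (1 - expR (t * c (h n))) / h n @[n --> \oo] --> t * m1.
Proof.
rewrite -[X in _ --> X]opprK; apply: cvg_trans (cvgN (@phi_rate t)); apply: near_eq_cvg; apply: nearW => n.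
by rewrite /= -mulNr opprB.
Qed.

(** The second difference of the exponent: [e^2 - 1 = 2 (e - 1) + (e - 1)^2] yields
    [c(2h) = 2 c(h) + v], with [v] of order [h^2]. *)
Let v n := \sum_(i < k) lam i * (expR (- (h n * i.+1%:R)) - 1) ^+ 2.

Let v_rate : v n / h n ^+ 2 @[n --> \oo] --> m2.
Proof.
under eq_fun do rewrite mulr_suml.
apply: cvg_big => [|i _]; first exact: add_continuous.
under eq_fun do rewrite -mulrA -expr_div_n.
rewrite -(sqrrN i.+1%:R); apply: cvgMr.
by apply: cvgM; exact: expR_rate.
Qed.

Let v_cvg0 : v n @[n --> \oo] --> (0 : R).
Proof.
have -> : (0 : R) = m2 * (0 * 0) by ring.
apply: cvg_trans (cvgM v_rate (cvgM cvg_harmonic cvg_harmonic)); apply: near_eq_cvg; apply: nearW => n.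
by rewrite /= -expr2 divfK// sqrf_eq0 gt_eqF.
Qed.

Let c2E n : c (2 * h n) = 2 * c (h n) + v n.
Proof.
rewrite /gcp_exponent /v mulr_sumr -big_split/=; apply: eq_bigr => i _.
have -> : - (2 * h n * i.+1%:R) = 2%:R * - (h n * i.+1%:R) by ring.
by rewrite expRM_natl; ring.
Qed.

(** With [E = exp(t c(h))] one has [exp(t c(2h)) = E^2 exp(t v)], so the numerator is
    [(1 - E)^2 + E^2 (exp(t v) - 1)]: the squared mean plus the variance. *)
Lemma gcp_exponent_rate2 t :
  (1 - 2 * expR (t * c (h n)) + expR (t * c (2 * h n))) / h n ^+ 2 @[n --> \oo] -->
  (t * m1) ^+ 2 + t * m2.
Proof.
have l1 : expR (t * c (h n)) ^+ 2 @[n --> \oo] --> (1 : R).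
  have e1 : expR (t * c (h n)) @[n --> \oo] --> (1 : R).
    rewrite -[X in _ --> X]expR0; apply: (continuous_cvg _ (@continuous_expR R 0)).
    by rewrite -[X in _ --> X](mulr0 t); apply: cvgMr; exact: c_cvg0.
  by rewrite -[X in _ --> X](mulr1 1); apply: cvgM.
have l2 : (expR (t * v n) - 1) / h n ^+ 2 @[n --> \oo] --> t * m2.
  apply: cvg_expR_sub1.
  - by apply: nearW => n; rewrite exprn_gt0.
  - by rewrite -[X in _ --> X](mulr0 t); apply: cvgMr; exact: v_cvg0.
  - by under eq_fun do rewrite -mulrA; apply: cvgMr; exact: v_rate.
have l3 := @gcp_exponent_rate1 t.
rewrite (_ : _ + _ = t * m1 * (t * m1) + 1 * (t * m2)); last by ring.
apply: cvg_trans (cvgD (cvgM l3 l3) (cvgM l1 l2)); apply: near_eq_cvg; apply: nearW => n.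
rewrite -[LHS]/(((1 - expR (t * c (h n))) / h n) * ((1 - expR (t * c (h n))) / h n) +
  expR (t * c (h n)) ^+ 2 * ((expR (t * v n) - 1) / h n ^+ 2)).
rewrite c2E mulrDr expRD (_ : t * (2 * c (h n)) = 2%:R * (t * c (h n))); last by ring.
rewrite expRM_natl; field.
by rewrite gt_eqF.
Qed.

End gcp_exponent_limits.

Section gcp_moments.
Context {R : realType} {d : measure_display} {T : measurableType d}.
Variables (P : probability T R) (k : nat) (lam : 'I_k -> R) (M : R -> T -> R).
Hypothesis GM : is_gcp P lam M.
Local Notation m1 := (\sum_(i < k) lam i * i.+1%:R).
Local Notation m2 := (\sum_(i < k) lam i * i.+1%:R ^+ 2).

Let LM := gcp_levy GM.
Let mM t : 0 <= t -> measurable_fun setT (M t) := levy_measurable LM (t := t).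

(** The moment lemmas ask for nonnegativity at every point, which [M] has only almost surely. *)
Let X t w := Num.max 0 (M t w).

Let mX t : 0 <= t -> measurable_fun setT (X t).
Proof. by move=> t0; apply: measurable_maxr => //; exact: mM. Qed.

Let X0 t w : 0 <= X t w. Proof. by rewrite le_max lexx. Qed.

Let laplace t : 0 <= t -> forall theta, 0 < theta ->
  (\int[P]_w (expR (- (theta * X t w)))%:E = (expR (t * gcp_exponent lam theta))%:E)%E.
Proof.
move=> t0 theta th; rewrite -(gcp_laplace GM th t0); apply: ge0_ae_eq_integral => //.
- apply/measurable_EFinP; apply: measurableT_comp => //; apply: measurableT_comp => //.
  by apply: measurable_funM => //; exact: mX.
- apply/measurable_EFinP; apply: measurableT_comp => //; apply: measurableT_comp => //.
  by apply: measurable_funM => //; exact: mM.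
by apply: filterS (gcp_ae_ge0 GM t0) => w M0 _; rewrite /X max_r.
Qed.

Let mean t : 0 <= t -> (\int[P]_w (X t w)%:E = (t * m1)%:E)%E.
Proof. by move=> t0; apply: (laplace_mean (mX t0) (X0 t) (laplace t0)); exact: gcp_exponent_rate1. Qed.

Let second t : 0 <= t -> (\int[P]_w (X t w ^+ 2)%:E = ((t * m1) ^+ 2 + t * m2)%:E)%E.
Proof. by move=> t0; apply: (laplace_second_moment (mX t0) (X0 t) (laplace t0)); exact: gcp_exponent_rate2. Qed.

Let increment_ge0 s h : 0 <= s -> 0 <= h -> {ae P, forall w, 0 <= M (s + h) w - M s w}.
Proof.
move=> s0 h0; exists [set w | M (s + h) w - M s w < 0]; split.
- apply: measurable_set_lt => //; apply: measurable_funB; apply: mM => //; exact: addr_ge0.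
- have := @levy_stationary_increments _ _ _ _ _ LM s (s + h) [set x | x < 0] s0.
  have -> : s + h - s = h by ring.
  move=> /= ->; [|by rewrite lerDl|exact: measurable_set_lt].
  apply: measure_negligible; first by apply: measurable_set_lt => //; exact: mM.
  by apply: negligibleS (gcp_ae_ge0 GM h0) => w /=; rewrite ltNge => /negP.
by move=> w /= /negP; rewrite -ltNge.
Qed.

Let cross s h : 0 <= s -> 0 <= h ->
  (\int[P]_w (X s w * Num.max 0 (M (s + h) w - M s w))%:E = ((s * m1) * (h * m1))%:E)%E.
Proof.
move=> s0 h0.
pose F (z : R * R) : \bar R := ((Num.max 0 z.1)%:E * (Num.max 0 z.2)%:E)%E.
have mF : measurable_fun [set: R * R] F.
  by apply: emeasurable_funM; apply/measurable_EFinP; exact: measurable_maxr.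
have F0 z : (0 <= F z)%E by rewrite mule_ge0// lee_fin le_max lexx.
have := ge0_integral_levy_pair LM s0 h0 mF F0; rewrite /F/=.
under eq_integral do rewrite -EFinM.
move=> ->.
transitivity (\int[P]_w' ((s * m1)%:E * (X h w')%:E))%E.
  apply: eq_integral => w' _; rewrite -mean// -ge0_integralZr//.
  - by apply/measurable_EFinP; exact: mX.
  - by move=> w _; rewrite lee_fin.
  - by rewrite lee_fin.
rewrite ge0_integralZl//; first by rewrite mean.
- by apply/measurable_EFinP; exact: mX.
- by move=> w _; rewrite lee_fin.
- by rewrite -mean// integral_ge0// => w _; rewrite lee_fin.
Qed.

(** Almost surely [M s * M t] is [M s ^ 2] plus [M s] times the increment, both nonnegative; the
    increment is independent of [M s] and distributed as [M (t - s)]. *)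
Lemma gcp_second_order :
  second_order P M (fun t => t * m1) (fun s t => s * m2 + m1 ^+ 2 * s * t).
Proof.
split.
- exact: mM.
- by move=> w t t0; have [+ _] := levy_cadlag LM w; exact.
- move=> t t0; rewrite -mean//; apply: ae_eq_integral => //.
  + by apply/measurable_EFinP; exact: mM.
  + by apply/measurable_EFinP; exact: mX.
  by apply: filterS (gcp_ae_ge0 GM t0) => w M0 _; rewrite /X max_r.
move=> s t /andP[s0 st]; have t0 := le_trans s0 st.
have h0 : 0 <= t - s by rewrite subr_ge0.
have tE : t = s + (t - s) by ring.
transitivity (\int[P]_w ((X s w ^+ 2)%:E + (X s w * Num.max 0 (M (s + (t - s)) w - M s w))%:E))%E.
  apply: ae_eq_integral => //.
  - by apply/measurable_EFinP; apply: measurable_funM; exact: mM.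
  - apply: emeasurable_funD; apply/measurable_EFinP; first by apply: measurable_funX; exact: mX.
    apply: measurable_funM; first exact: mX.
    by apply: measurable_maxr => //; apply: measurable_funB; apply: mM => //; rewrite -tE.
  apply: filterS2 (gcp_ae_ge0 GM s0) (increment_ge0 s0 h0) => w M0 I0 _.
  by rewrite /X (max_r M0) (max_r I0) -EFinD -tE; congr (_%:E); ring.
rewrite ge0_integralD//.
- by rewrite second// cross// -EFinD; congr (_%:E); ring.
- by move=> w _; rewrite lee_fin sqr_ge0.
- by apply/measurable_EFinP; apply: measurable_funX; exact: mX.
- by move=> w _; rewrite lee_fin mulr_ge0// le_max lexx.
- apply/measurable_EFinP; apply: measurable_funM; first exact: mX.
  by apply: measurable_maxr => //; apply: measurable_funB; apply: mM => //; rewrite -tE.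
Qed.

End gcp_moments.

(** * Independent time change *)

Section second_order_integrable.
Context {R : realType} {d : measure_display} {T : measurableType d}.
Variables (P : probability T R) (X : R -> T -> R) (a : R -> R) (c : R -> R -> R).
Hypothesis SX : second_order P X a c.
Let mX t : 0 <= t -> measurable_fun setT (X t) := second_order_measurable SX (t := t).

Let integrable_sqr t : 0 <= t -> P.-integrable setT (fun w => (X t w ^+ 2)%:E).
Proof.
move=> t0; apply/integrableP; split.
  by apply/measurable_EFinP; apply: measurable_funX; exact: mX.
under eq_integral do rewrite gee0_abs ?lee_fin ?sqr_ge0// expr2.
by rewrite (second_order_corr SX) ?t0 ?lexx// ltry.
Qed.

Lemma second_order_integrableM s t : 0 <= s -> 0 <= t ->
  P.-integrable setT (fun w => (X s w * X t w)%:E).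
Proof.
move=> s0 t0; apply: (le_integrable measurableT _ _ (integrableD measurableT (integrable_sqr s0) (integrable_sqr t0))).
  by apply/measurable_EFinP; apply: measurable_funM; exact: mX.
move=> w _; rewrite -EFinD !abse_EFin lee_fin [leRHS]ger0_norm ?addr_ge0 ?sqr_ge0//.
by rewrite ler_norml; apply/andP; split; nra.
Qed.

Lemma second_order_integrable t : 0 <= t -> P.-integrable setT (fun w => (X t w)%:E).
Proof.
move=> t0; have i1 : P.-integrable setT (fun w => 1%:E) by exact: finite_measure_integrable_cst.
apply: (le_integrable measurableT _ _ (integrableD measurableT i1 (integrable_sqr t0))).
  by apply/measurable_EFinP; exact: mX.
move=> w _; rewrite -EFinD !abse_EFin lee_fin [leRHS]ger0_norm ?addr_ge0 ?sqr_ge0//.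
by rewrite ler_norml; apply/andP; split; nra.
Qed.

End second_order_integrable.

Section process_sigma.
Context {R : realType} {d : measure_display} {T : measurableType d}.
Implicit Types X Y : R -> T -> R.

Lemma process_sigma_preimage X t (B : set R) : 0 <= t -> measurable B ->
  process_sigma X (X t @^-1` B).
Proof. by move=> t0 mB; apply: sub_sigma_algebra; exists t, B. Qed.

Lemma process_sigma_measurable X (A : set T) :
  (forall t, 0 <= t -> measurable_fun setT (X t)) -> process_sigma X A -> measurable A.
Proof.
move=> mX; apply: smallest_sub; first exact: sigma_algebra_measurable.
by move=> _ [t [B [t0 mB ->]]]; rewrite -[X in measurable X]setTI; exact: mX.
Qed.

End process_sigma.

Section second_order_sub.
Context {R : realType} {d : measure_display} {T : measurableType d}.
Variable P : probability T R.

Let independent_mean (X Y : R -> T -> R) a c b e s t :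
  second_order P X a c -> second_order P Y b e -> indep_processes P X Y ->
  0 <= s -> 0 <= t ->
  P.-integrable setT (fun w => (X s w * Y t w)%:E) /\
  (\int[P]_w (X s w * Y t w)%:E = (a s * b t)%:E)%E.
Proof.
move=> SX SY XY s0 t0.
have iX := second_order_integrable SX s0; have iY := second_order_integrable SY t0.
have ind A B : measurable A -> measurable B ->
    P (X s @^-1` A `&` Y t @^-1` B) = (P (X s @^-1` A) * P (Y t @^-1` B))%E.
  by move=> mA mB; apply: XY; exact: process_sigma_preimage.
have mF : measurable_fun [set: R * R] (fun z => (z.1 * z.2)%:E).
  by apply/measurable_EFinP; exact: measurable_funM.
have fin : (\int[P]_w' \int[P]_w `|(X s w * Y t w')%:E| < +oo)%E.
  have E : (\int[P]_w' \int[P]_w `|(X s w * Y t w')%:E| =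
      \int[P]_w' (`|(Y t w')%:E| * \int[P]_w `|(X s w)%:E|))%E.
    apply: eq_integral => w' _; rewrite muleC -ge0_integralZr//.
      by apply: eq_integral => w _; rewrite EFinM abseM.
    by apply: measurableT_comp => //; case/integrableP: iX.
  rewrite E ge0_integralZr//; last 2 first.
  - by apply: measurableT_comp => //; case/integrableP: iY.
  - exact: integral_ge0.
  have /integrableP[_ h1] := iX; have /integrableP[_ h2] := iY.
  by rewrite lte_mul_pinfty ?integral_ge0// ge0_fin_numE// integral_ge0.
have mX := second_order_measurable SX s0; have mY := second_order_measurable SY t0.
split; first exact: (integrable_indep mX mY ind mF fin).
have := integral_indep mX mY ind mF fin; rewrite /= => ->.
transitivity (\int[P]_w' ((a s)%:E * (Y t w')%:E))%E.
  apply: eq_integral => w' _; rewrite muleC -(second_order_mean SX s0) -integralZl//.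
  by apply: eq_integral => w _; rewrite mulrC EFinM.
by rewrite integralZl// (second_order_mean SY).
Qed.

Lemma second_order_sub (X Y S : R -> T -> R) a c b e :
  second_order P X a c -> second_order P Y b e -> indep_processes P X Y ->
  (forall t w, 0 <= t -> S t w = X t w - Y t w) ->
  second_order P S (fun t => a t - b t)
    (fun s t => c s t - a s * b t - a t * b s + e s t).
Proof.
move=> SX SY XY SE; split.
- move=> t t0; rewrite (_ : S t = fun w => X t w - Y t w); last by apply/funext => w; exact: SE.
  by apply: measurable_funB; [exact: (second_order_measurable SX)|exact: (second_order_measurable SY)].
- move=> w t t0; rewrite SE//.
  have h : X u w - Y u w @[u --> t^'+] --> X t w - Y t w.
    by apply: cvgB; [exact: (second_order_right_continuous SX)|exact: (second_order_right_continuous SY)].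
  apply: cvg_trans h.
  apply: near_eq_cvg; near=> u; rewrite SE//.
  by apply: (le_trans t0); apply: ltW; near: u; exact: nbhs_right_gt.
- move=> t t0; under eq_integral do rewrite SE// EFinB.
  rewrite integralB//; [|exact: second_order_integrable SX _ t0|exact: second_order_integrable SY _ t0].
  by rewrite (second_order_mean SX)// (second_order_mean SY)// EFinB.
move=> s t /[dup] st' /andP[s0 st]; have t0 := le_trans s0 st.
have [i1 E1] := independent_mean SX SY XY s0 t0.
have [i2 E2] := independent_mean SX SY XY t0 s0.
have i3 := second_order_integrableM SX s0 t0; have i4 := second_order_integrableM SY s0 t0.
transitivity (\int[P]_w ((X s w * X t w)%:E - (X s w * Y t w)%:E - (X t w * Y s w)%:E + (Y s w * Y t w)%:E))%E.
  by apply: eq_integral => w _; rewrite -!EFinB -EFinD !SE//; congr (_%:E); ring.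
rewrite integralD//; last by apply: integrableB => //; exact: integrableB.
rewrite integralB//; last exact: integrableB.
rewrite integralB// E1 E2 (second_order_corr SX)// (second_order_corr SY)//.
Unshelve. all: by end_near. Qed.

End second_order_sub.

Section time_change.
Context {R : realType} {d : measure_display} {T : measurableType d}.
Variables (P : probability T R) (X Y : R -> T -> R) (a : R -> R) (c : R -> R -> R).
Hypothesis SX : second_order P X a c.
Hypotheses (Y0 : forall t w, 0 <= Y t w) (mY : forall t, 0 <= t -> measurable_fun setT (Y t)).
Hypothesis XY : indep_processes P X Y.
Let mX t : 0 <= t -> measurable_fun setT (X t) := second_order_measurable SX (t := t).

Lemma measurable_time_change t : 0 <= t -> measurable_fun setT (fun w => X (Y t w) w).
Proof.
move=> t0; have mp := measurable_process mX (second_order_right_continuous SX).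
have : measurable_fun setT (fun w => X (Num.max 0 (Y t w)) w).
  apply: (measurableT_comp mp (g := fun w => (Y t w, w))).
  by apply: measurable_fun_pair => //; exact: mY.
by congr measurable_fun; apply/funext => w; rewrite max_r.
Qed.

Let GX := [set A | exists (t : R) (B : set R), [/\ 0 <= t, measurable B & A = X t @^-1` B]].
Let GY := [set A | exists (t : R) (B : set R), [/\ 0 <= t, measurable B & A = Y t @^-1` B]].
(** Independence is known only for events generated by [X]. Giving [T] that smaller sigma-algebra
    makes the whole path one random element, independent of the pair of times [g]. *)
Let f : T -> g_sigma_algebraType GX := id.
Let mf : measurable_fun setT f.
Proof. by move=> _ A mA; rewrite setTI; exact: (process_sigma_measurable mX mA). Qed.

Let mGX t : 0 <= t -> measurable_fun [set: g_sigma_algebraType GX] (X t).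
Proof. by move=> t0 _ B mB; rewrite setTI; exact: process_sigma_preimage. Qed.

Let mGY t : 0 <= t -> measurable_fun [set: g_sigma_algebraType GY] (Y t).
Proof. by move=> t0 _ B mB; rewrite setTI; exact: process_sigma_preimage. Qed.

Let mp : measurable_fun [set: R * g_sigma_algebraType GX] (fun z => X (Num.max 0 z.1) z.2).
Proof. exact: (measurable_process mGX (second_order_right_continuous SX)). Qed.

Variables (s t : R).
Hypotheses (s0 : 0 <= s) (t0 : 0 <= t).
Let g w := (Y s w, Y t w).
Let mg : measurable_fun setT g.
Proof. by apply: measurable_fun_pair; exact: mY. Qed.
Let ind A B : measurable A -> measurable B ->
  P (f @^-1` A `&` g @^-1` B) = (P (f @^-1` A) * P (g @^-1` B))%E.
Proof.
move=> mA mB; apply: XY; first exact: mA.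
have h : measurable_fun [set: g_sigma_algebraType GY] g.
  by apply: measurable_fun_pair; exact: mGY.
by have := h measurableT B mB; rewrite setTI.
Qed.

Let X1 (z : g_sigma_algebraType GX * (R * R)) := X (Num.max 0 z.2.1) z.1.
Let X2 (z : g_sigma_algebraType GX * (R * R)) := X (Num.max 0 z.2.2) z.1.
Let mX1 : measurable_fun setT X1.
Proof.
apply: (measurableT_comp mp (g := fun z => (z.2.1, z.1))).
by apply: measurable_fun_pair => //; exact: measurableT_comp.
Qed.

Let mX2 : measurable_fun setT X2.
Proof.
apply: (measurableT_comp mp (g := fun z => (z.2.2, z.1))).
by apply: measurable_fun_pair => //; exact: measurableT_comp.
Qed.
Hypothesis (ts : (\int[P]_w (c (Y s w) (Y s w))%:E < +oo)%E).
Hypothesis (tt : (\int[P]_w (c (Y t w) (Y t w))%:E < +oo)%E).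

Let c_ge0 u : 0 <= u -> 0 <= c u u.
Proof.
move=> u0; rewrite -lee_fin -(second_order_corr SX) ?u0 ?lexx// integral_ge0// => w _.
by rewrite lee_fin -expr2 sqr_ge0.
Qed.

(** Dominates both [X1] and [X1 * X2] in absolute value, so one integrability argument serves the
    mean and the mixed moment. *)
Let dom (z : g_sigma_algebraType GX * (R * R)) : \bar R := (1 + X1 z ^+ 2 + X2 z ^+ 2)%:E.
Let mdom : measurable_fun setT dom.
Proof.
apply/measurable_EFinP; apply: measurable_funD; last exact: measurable_funX.
by apply: measurable_funD => //; exact: measurable_funX.
Qed.

Let dom0 z : (0 <= dom z)%E.
Proof. by rewrite lee_fin !addr_ge0 ?sqr_ge0. Qed.

Let integral_dom w' : (\int[P]_w dom (f w, g w') = (1 + c (Y s w') (Y s w') + c (Y t w') (Y t w'))%:E)%E.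
Proof.
rewrite /dom/X1/X2/g/f/= !max_r//.
under eq_integral do rewrite !EFinD.
have m1 u : 0 <= u -> measurable_fun setT (fun w => (X u w ^+ 2)%:E : \bar R).
  by move=> u0; apply/measurable_EFinP; apply: measurable_funX; exact: mX.
have E u : 0 <= u -> (\int[P]_w (X u w ^+ 2)%:E = (c u u)%:E)%E.
  by move=> u0; under eq_integral do rewrite expr2; rewrite (second_order_corr SX)// u0/=.
rewrite ge0_integralD//.
- rewrite ge0_integralD//; last 2 first.
  + by move=> w _; rewrite lee_fin sqr_ge0.
  + exact: m1.
  by rewrite integral_cst//= probability_setT mule1 !E.
- by move=> w _; rewrite adde_ge0// lee_fin ?sqr_ge0.
- by apply: emeasurable_funD => //; exact: m1.
- by move=> w _; rewrite lee_fin sqr_ge0.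
- exact: m1.
Qed.

(** Measurability of [c] along the diagonal is inherited from Tonelli, since [c r r] is the integral
    of [X r ^ 2] over the path. *)
Let mcc u : 0 <= u -> measurable_fun setT (fun w => (c (Y u w) (Y u w))%:E : \bar R).
Proof.
move=> u0; pose Q z : \bar R := (X1 z ^+ 2)%:E.
have mQ : measurable_fun setT Q by apply/measurable_EFinP; exact: measurable_funX.
have Q0 z : (0 <= Q z)%E by rewrite lee_fin sqr_ge0.
have := measurableT_comp (measurable_integral_indep P mf mQ Q0)
  (measurable_fun_pair (mY u0) (mY u0)).
congr measurable_fun; apply/funext => w; rewrite /= /Q/X1/= max_r//.
by under eq_integral do rewrite expr2; rewrite (second_order_corr SX)// Y0/=.
Qed.

Let fin_dom : (\int[P]_w' \int[P]_w dom (f w, g w') < +oo)%E.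
Proof.
under eq_integral do rewrite integral_dom !EFinD.
rewrite ge0_integralD//.
- rewrite ge0_integralD//; last 2 first.
  + by move=> w _; rewrite lee_fin c_ge0.
  + exact: mcc.
  rewrite integral_cst//= probability_setT mule1 lte_add_pinfty//.
  by rewrite lte_add_pinfty// ltry.
- by move=> w _; rewrite adde_ge0// lee_fin c_ge0.
- by apply: emeasurable_funD => //; exact: mcc.
- by move=> w _; rewrite lee_fin c_ge0.
- exact: mcc.
Qed.

Let integral_dominated (F : g_sigma_algebraType GX * (R * R) -> \bar R) :
  measurable_fun setT F -> (forall z, `|F z| <= dom z)%E ->
  P.-integrable setT (fun w => F (f w, g w)) /\
  (\int[P]_w F (f w, g w) = \int[P]_w' \int[P]_w F (f w, g w'))%E.
Proof.
move=> mF Fd.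
have fin : (\int[P]_w' \int[P]_w `|F (f w, g w')| < +oo)%E.
  apply: le_lt_trans fin_dom; apply: ge0_le_integral => //.
  - by move=> w' _; exact: integral_ge0.
  - have m1 : measurable_fun setT (fun z => `|F z|%E) by exact: measurableT_comp.
    exact: (measurableT_comp (measurable_integral_indep P mf m1 (fun z => abse_ge0 (F z))) mg).
  - exact: (measurableT_comp (measurable_integral_indep P mf mdom dom0) mg).
  move=> w' _; apply: ge0_le_integral => //.
  - by apply: measurableT_comp => //; apply: (measurableT_comp mF); exact: measurable_fun_pair.
  - by apply: (measurableT_comp mdom); exact: measurable_fun_pair.
split; first exact: (integrable_indep mf mg ind mF fin).
exact: (integral_indep mf mg ind mF fin).
Qed.

Lemma time_change_mean : 
  (\int[P]_w (X (Y s w) w)%:E = \int[P]_w (a (Y s w))%:E)%E.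
Proof.
have mF : measurable_fun setT (fun z => (X1 z)%:E : \bar R) by exact/measurable_EFinP.
have [|_] := integral_dominated mF.
  move=> z; rewrite abse_EFin lee_fin ler_norml; apply/andP; split; nra.
rewrite /X1/=; under eq_integral do rewrite max_r//.
move=> ->; apply: eq_integral => w' _.
by rewrite max_r// (second_order_mean SX).
Qed.

(** With the path of [Y] frozen, the times are constants and [c] applies. Minimum and maximum put
    them in order, which [Y] itself does not guarantee. *)
Lemma time_change_corr : P.-integrable setT (fun w => (X (Y s w) w * X (Y t w) w)%:E) /\
  (\int[P]_w (X (Y s w) w * X (Y t w) w)%:E =
   \int[P]_w (c (Num.min (Y s w) (Y t w)) (Num.max (Y s w) (Y t w)))%:E)%E.
Proof.
have mF : measurable_fun setT (fun z => (X1 z * X2 z)%:E : \bar R).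
  by apply/measurable_EFinP; exact: measurable_funM.
have [|iF] := integral_dominated mF.
  move=> z; rewrite abse_EFin lee_fin ler_norml; apply/andP; split; nra.
have E w w' : X1 (f w, g w') * X2 (f w, g w') = X (Y s w') w * X (Y t w') w.
  by rewrite /X1 /X2 /= !max_r.
under eq_integral do rewrite E.
move=> EF; split.
  by move: iF; under eq_fun do rewrite E.
rewrite EF; apply: eq_integral => w' _.
under eq_integral do rewrite E.
have [st|st] := leP (Y s w') (Y t w').
  by rewrite (second_order_corr SX)// Y0.
by under eq_integral do rewrite mulrC; rewrite (second_order_corr SX)// Y0 ltW.
Qed.

End time_change.

(** * Generalized fractional Skellam process *)

Lemma gsp_second_order (R : realType) d (T : measurableType d) (P : probability T R)
    (k : nat) (lam mu : 'I_k -> R) (S : R -> T -> R) :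
  is_gsp P lam mu S ->
  let m1 := \sum_(j < k) j.+1%:R * (lam j - mu j) in
  let m2 := \sum_(j < k) j.+1%:R ^+ 2 * (lam j + mu j) in
  second_order P S (fun t => m1 * t) (fun s t => m2 * s + m1 ^+ 2 * (s * t)).
Proof.
move=> [M1 [M2 [G1 G2 ind SE]]] m1 m2.
have := second_order_sub (gcp_second_order G1) (gcp_second_order G2) ind SE.
have m1E : m1 = \sum_(i < k) lam i * i.+1%:R - \sum_(i < k) mu i * i.+1%:R.
  by rewrite -sumrB; apply: eq_bigr => i _; ring.
have m2E : m2 = \sum_(i < k) lam i * i.+1%:R ^+ 2 + \sum_(i < k) mu i * i.+1%:R ^+ 2.
  by rewrite -big_split; apply: eq_bigr => i _; rewrite /=; ring.
congr second_order; first by apply/funext => t; rewrite m1E; ring.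
by apply/funext => s; apply/funext => t; rewrite m1E m2E; ring.
Qed.

Section unit_exponent.
Context {R : realType}.
Local Notation mu := (@lebesgue_measure R).

Lemma Gamma2 : Gamma (1 + 1) = 1 :> R.
Proof.
apply: EFin_inj; rewrite -integral_expRN_powR ?ltr01 ?lexx//.
transitivity (\int[mu]_(v in `[0%R, +oo[) (expR (- v))%:E)%E.
  apply: eq_integral => v; rewrite inE/= in_itv/= andbT => v0.
  by rewrite invr1 powRr1.
by rewrite integral_expRN_tail oppr0 expR0.
Qed.

Lemma incBeta12 (x : R) : 0 <= x <= 1 -> incBeta 1 (1 + 1) x = x - x ^+ 2 / 2.
Proof.
move=> x01; have /andP[x0 x1] := x01; apply: EFin_inj; rewrite -integral_incBeta//.
transitivity (\int[mu]_(u in `[0%R, x]) (1 - u)%:E)%E.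
  apply: eq_integral => u; rewrite inE/= in_itv/= => /andP[u0 ux].
  by rewrite subrr powRr0 mul1r addrK powRr1// subr_ge0 (le_trans ux).
by rewrite integral_subr_itv// mul1r.
Qed.

End unit_exponent.

Definition gfsp_mean (R : realType) (m1 alpha t : R) : R := m1 / Gamma (1 + alpha) * t `^ alpha.

Definition gfsp_corr (R : realType) (m1 m2 alpha s t : R) : R :=
  let l1 := m1 / Gamma (1 + alpha) in
  m2 / Gamma (1 + alpha) * s `^ alpha +
  alpha * l1 ^+ 2 * Beta alpha (1 + alpha) * s `^ (2 * alpha) +
  l1 ^+ 2 * alpha * (t `^ (2 * alpha) * incBeta alpha (alpha + 1) (s / t)).

Section gfsp.
Context {R : realType} {d : measure_display} {T : measurableType d}.
Variables (P : probability T R).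

Lemma second_order_eq (X X' : R -> T -> R) a a' c c' :
  (forall t w, 0 <= t -> X' t w = X t w) -> (forall t, 0 <= t -> a' t = a t) ->
  (forall s t, 0 <= s <= t -> c' s t = c s t) ->
  second_order P X a c -> second_order P X' a' c'.
Proof.
move=> XX aa cc SX.
have E t : 0 <= t -> X' t = X t by move=> t0; apply/funext => w; exact: XX.
split.
- by move=> t t0; rewrite E//; exact: (second_order_measurable SX).
- move=> w t t0; rewrite XX//.
  have h : X u w @[u --> t^'+] --> X t w by exact: (second_order_right_continuous SX).
  apply: cvg_trans h.
  apply: near_eq_cvg; near=> u; rewrite XX//.
  by apply: (le_trans t0); apply: ltW; near: u; exact: nbhs_right_gt.
- by move=> t t0; rewrite E// aa//; exact: (second_order_mean SX).
- move=> s t /[dup] st /andP[s0 /(le_trans s0) t0].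
  by rewrite !E// cc//; exact: (second_order_corr SX).
Unshelve. all: by end_near. Qed.

Lemma second_order_stable_time_change (S : R -> T -> R) (D : R -> T -> R) (m1 m2 alpha : R) :
  0 <= m2 -> 0 < alpha <= 1 ->
  second_order P S (fun t => m1 * t) (fun s t => m2 * s + m1 ^+ 2 * (s * t)) ->
  is_subordinator P (fun s => s `^ alpha) D ->
  indep_processes P S (inverse_subordinator D) ->
  second_order P (fun t w => S (inverse_subordinator D t w) w)
    (gfsp_mean m1 alpha) (gfsp_corr m1 m2 alpha).
Proof.
move=> m20 a01 SS SD ind; have /andP[a0 a1] := a01.
set Y := inverse_subordinator D.
have fE (s : R) : 0 < s -> (fun s => s `^ alpha) s = s `^ alpha by [].
have LD := subordinator_levy SD.
have D_nd := subordinator_nondecreasing SD.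
have Y0 t w : 0 <= Y t w by exact: inverse_subordinator_ge0.
have mY t : 0 <= t -> measurable_fun setT (Y t).
  by move=> _; apply: measurable_inverse_subordinator => //; exact: (levy_measurable LD).
have lin s t x y : 0 <= s -> 0 <= t ->
    (\int[P]_w (Y s w)%:E = x%:E)%E -> (\int[P]_w (Y s w * Y t w)%:E = y%:E)%E ->
    (\int[P]_w (m2 * Y s w + m1 ^+ 2 * (Y s w * Y t w))%:E = (m2 * x + m1 ^+ 2 * y)%:E)%E.
  move=> s0 t0 Ex Ey; under eq_integral do rewrite EFinD.
  have m1Y : measurable_fun setT (fun w => (Y s w)%:E : \bar R).
    by apply/measurable_EFinP; exact: mY.
  have m2Y : measurable_fun setT (fun w => (Y s w * Y t w)%:E : \bar R).
    by apply/measurable_EFinP; apply: measurable_funM; exact: mY.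
  rewrite ge0_integralD//.
  - under eq_integral do rewrite EFinM.
    rewrite ge0_integralZl//; last by move=> w _; rewrite lee_fin.
    under [X in (_ + X)%E]eq_integral do rewrite EFinM.
    rewrite ge0_integralZl//; last 2 first.
    + by move=> w _; rewrite lee_fin mulr_ge0.
    + by rewrite lee_fin sqr_ge0.
    by rewrite Ex Ey -!EFinM -EFinD.
  - by move=> w _; rewrite lee_fin mulr_ge0.
  - by under eq_fun do rewrite EFinM; exact: measurable_funeM.
  - by move=> w _; rewrite lee_fin mulr_ge0 ?sqr_ge0 ?mulr_ge0.
  - by under eq_fun do rewrite EFinM; exact: measurable_funeM.
have fin t : 0 <= t -> (\int[P]_w (m2 * Y t w + m1 ^+ 2 * (Y t w * Y t w))%:E < +oo)%E.
  move=> t0; rewrite (lin _ _ _ _ t0 t0 (inverse_stable_mean SD a01 fE t0) (inverse_stable_corr SD a01 fE _)) ?t0 ?lexx//.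
  exact: ltry.
split.
- by move=> t t0; exact: (measurable_time_change SS Y0 mY).
- move=> w t _; apply: (@right_continuous_inverse_subordinator _ _ D w (fun u => S u w)).
  by move=> u u0; exact: (second_order_right_continuous SS).
- move=> t t0; rewrite (time_change_mean SS Y0 mY ind t0 t0 (fin t t0) (fin t t0)).
  under eq_integral do rewrite EFinM.
  have iY : P.-integrable setT (fun w => (Y t w)%:E).
    apply/integrableP; split; first by apply/measurable_EFinP; exact: mY.
    under eq_integral do rewrite gee0_abs ?lee_fin//.
    by rewrite (inverse_stable_mean SD a01 fE t0) ltry.
  by rewrite integralZl// (inverse_stable_mean SD a01 fE t0) -EFinM /gfsp_mean mulrA mulrAC.
move=> s t /[dup] st' /andP[s0 st]; have t0 := le_trans s0 st.
rewrite (time_change_corr SS Y0 mY ind s0 t0 (fin s s0) (fin t t0)).2.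
transitivity (\int[P]_w (m2 * Y s w + m1 ^+ 2 * (Y s w * Y t w))%:E)%E.
  have mYY := measurable_funM (mY _ s0) (mY _ t0).
  apply: ge0_ae_eq_integral => //.
  - apply/measurable_EFinP; apply: measurable_funD; apply: measurable_funM => //.
      by apply: measurable_minr; exact: mY.
    by apply: measurable_funM; [apply: measurable_minr|apply: measurable_maxr]; exact: mY.
  - apply/measurable_EFinP; apply: measurable_funD; apply: measurable_funM => //; exact: mY.
  - move=> w _; have mn : 0 <= Num.min (Y s w) (Y t w) by rewrite le_min !Y0.
    have mx : 0 <= Num.max (Y s w) (Y t w) by rewrite le_max Y0.
    by rewrite lee_fin addr_ge0 ?(mulr_ge0 m20)// mulr_ge0 ?sqr_ge0// mulr_ge0.
  - by move=> w _; rewrite lee_fin addr_ge0 ?(mulr_ge0 m20)// mulr_ge0 ?sqr_ge0// mulr_ge0.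
  apply: filterS (stable_unbounded SD a01 fE t) => w At _.
  have Yst : Y s w <= Y t w by apply: inverse_subordinator_nd => //; exact: D_nd.
  by rewrite (min_l Yst) (max_r Yst).
rewrite (lin _ _ _ _ s0 t0 (inverse_stable_mean SD a01 fE s0) (inverse_stable_corr SD a01 fE st')).
congr (_%:E); rewrite /gfsp_corr /Beta (addrC 1 alpha).
have -> : s `^ (2 * alpha) * incBeta alpha (alpha + 1) (s / s) = s `^ (2 * alpha) * incBeta alpha (alpha + 1) 1.
  have [->|sn0] := eqVneq s 0; last by rewrite divff.
  by rewrite powR0 ?mul0r// gt_eqF// mulr_gt0.
field; rewrite gt_eqF// addrC; exact: Gamma_gt0.
Qed.

Lemma gfsp_second_order (k : nat) (lam mu : 'I_k -> R) (alpha : R) (Sa : R -> T -> R) :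
  (forall j, 0 < lam j) -> (forall j, 0 < mu j) -> is_gfsp P alpha lam mu Sa ->
  let m1 := \sum_(j < k) j.+1%:R * (lam j - mu j) in
  let m2 := \sum_(j < k) j.+1%:R ^+ 2 * (lam j + mu j) in
  second_order P Sa (gfsp_mean m1 alpha) (gfsp_corr m1 m2 alpha).
Proof.
move=> lam0 mu0 [S [/gsp_second_order SS H]] m1 m2; move: SS; rewrite -/m1 -/m2 => SS.
have m20 : 0 <= m2.
  by apply: sumr_ge0 => i _; rewrite mulr_ge0 ?sqr_ge0// addr_ge0// ltW.
case: H => [[-> SaE]|[/andP[a0 a1] [D [SD ind SaE]]]]; last first.
  have := second_order_stable_time_change m20 _ SS SD ind; rewrite a0 (ltW a1) => /(_ isT).
  exact: second_order_eq.
apply: second_order_eq SS => //.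
- by move=> t t0; rewrite /gfsp_mean Gamma2 divr1 powRr1.
move=> s t /andP[s0 st]; have t0 := le_trans s0 st.
rewrite /gfsp_corr Gamma2 !divr1 powRr1// /Beta.
have P2 u : 0 <= u -> u `^ (2 * 1) = u ^+ 2 by move=> u0; rewrite mulr1 powR_mulrn.
rewrite !P2// !incBeta12 ?lexx ?ler01//; last first.
  have [->|tn0] := eqVneq t 0; first by rewrite invr0 mulr0 lexx ler01.
  by rewrite divr_ge0//= ler_pdivrMr ?mul1r// lt_neqAle eq_sym tn0.
(* At [alpha = 1] the complete beta value is 1/2, so the two terms in [s^2 / 2] cancel and
   [m1^2 s t] remains. At [t = 0] the quotient [s / t] is not a genuine division. *)
have [t00|tn0] := eqVneq t 0; last by field.
have -> : s = 0 by apply/eqP; rewrite eq_le s0 -t00 st.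
by rewrite t00; ring.
Qed.

End gfsp.

(** * Moments of a general inverse subordinator *)

Section inverse_subordinator_moments.
Context {R : realType} {d : measure_display} {T : measurableType d}.
Variables (P : probability T R) (f : R -> R) (D : R -> T -> R).
Hypothesis SD : is_subordinator P f D.
Local Notation mu := (@lebesgue_measure R).
Local Notation H := (inverse_subordinator D).
Local Notation C := (clamped_subordinator D).

Let LD := subordinator_levy SD.
Let D_nd := subordinator_nondecreasing SD.
Let mD := levy_measurable LD.
Let mDD := measurable_subordinator SD.
Let mC := measurable_clamped_subordinator SD.

Let mCx x : measurable_fun setT (fun w => C (x, w)).
Proof. exact: (measurableT_comp mC (measurable_pair1 x)). Qed.

Let mexpC x : measurable_fun setT (fun w => expR (- (1 * C (x, w)))).
Proof.
apply: measurableT_comp => //; apply: measurableT_comp => //.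
exact: measurable_funM.
Qed.

Let expC_le1 x w : expR (- (1 * C (x, w))) <= 1.
Proof. by rewrite -[leRHS]expR0 ler_expR oppr_le0 mul1r le_max lexx. Qed.

Lemma subordinator_exponent_ge0 : 0 <= f 1.
Proof.
rewrite -oppr_le0 -ler_expR expR0 -[X in expR (- X)]mul1r -lee_fin.
rewrite -(laplace_clamped_subordinator SD)//.
have -> : 1%:E = (\int[P]_w 1%:E)%E by rewrite integral_cst//= probability_setT mule1.
apply: ge0_le_integral => //; first by apply/measurable_EFinP.
by move=> w _; rewrite lee_fin.
Qed.

(** Here [exp(-D x)] has mean 1 and is at most 1 after clamping, so [D] is almost surely at most 0
    at all integers, and by monotonicity at all times. *)
Lemma subordinator_degenerate : f 1 = 0 ->
  {ae P, forall w, forall x, 0 <= x -> D x w <= 0}.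
Proof.
move=> f0.
have h (n : nat) : {ae P, forall w, D n%:R w <= 0}.
  have E : (\int[P]_w (1 - expR (- (1 * C (n%:R, w))))%:E = 0)%E.
    have : (\int[P]_w (1 - expR (- (1 * C (n%:R, w))))%:E +
       \int[P]_w (expR (- (1 * C (n%:R, w))))%:E = 1%:E)%E.
      rewrite -ge0_integralD//.
      - under eq_integral do rewrite -EFinD subrK.
        by rewrite integral_cst//= probability_setT mule1.
      - by move=> w _; rewrite lee_fin subr_ge0.
      - by apply/measurable_EFinP; exact: measurable_funB.
      - by apply/measurable_EFinP.
    by rewrite (laplace_clamped_subordinator SD)// f0 mulr0 oppr0 expR0 => /EFin_subr ->; rewrite subrr.
  have mg : measurable_fun setT (fun w => (1 - expR (- (1 * C (n%:R, w))))%:E : \bar R).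
    by apply/measurable_EFinP; exact: measurable_funB.
  have E' : (\int[P]_w `|(1 - expR (- (1 * C (n%:R, w))))%:E| = 0)%E.
    by rewrite -[RHS]E; apply: eq_integral => w _; rewrite gee0_abs// lee_fin subr_ge0.
  have := (ae_eq_integral_abs P measurableT mg).1 E'.
  apply: filterS => w /(_ I) [] /eqP; rewrite subr_eq0 -[X in X == _]expR0 => /eqP/expR_inj/esym/eqP.
  rewrite oppr_eq0 mul1r /clamped_subordinator/= (max_r (ler0n _ n)) => /eqP CE.
  by rewrite -[leRHS]CE le_max lexx orbT.
have := ae_foralln h.
apply: filterS => w Dw x x0; apply: le_trans (Dw (Num.bound x)).
by apply: D_nd => //; exact: ltW (archi_boundP x0).
Qed.

Let mlevel t : measurable_fun [set: measurableTypeR R * T]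
  (fun z => (0 <= z.1) && (D (Num.max 0 z.1) z.2 <= t)).
Proof.
apply: measurable_and; first by apply: measurable_fun_ler.
by apply: measurable_fun_ler.
Qed.

(** The weight [1 + x] on the level set serves twice: the 1 makes the integral infinite on a path
    bounded by [t], and the [x] controls the square of [H t]. *)
Let wl t (z : measurableTypeR R * T) : \bar R :=
  (((0 <= z.1) && (D (Num.max 0 z.1) z.2 <= t))%:R * (1 + Num.max 0 z.1))%:E.

Let wl_ge0 t z : (0 <= wl t z)%E.
Proof. by rewrite lee_fin mulr_ge0// addr_ge0// le_max lexx. Qed.

Let mwl t : measurable_fun setT (wl t).
Proof.
apply/measurable_EFinP; apply: measurable_funM.
  by apply/measurable_EFinP; exact: measurable_ind (mlevel t).
by apply: measurable_funD => //; apply: measurable_maxr.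
Qed.

Section nondegenerate.
Hypothesis f1 : 0 < f 1.

(** A Chernoff bound: the indicator of [D x <= t] is at most [exp(t - D x)], of mean
    [exp(t - x f(1))]. Half of that decay absorbs the weight, since
    [1 + x <= (1 + 2/f(1)) exp(x f(1)/2)]. *)
Let weighted_level t x : 0 <= t -> (\int[P]_w wl t (x, w) <=
  (expR t * (1 + 2 / f 1))%:E * (if (0 <= x)%R then expR (- (f 1 / 2 * x)) else 0)%:E)%E.
Proof.
move=> t0; rewrite /wl/=; have [x0|x0] := leP 0 x; last first.
  by under eq_integral do rewrite mul0r; rewrite integral0 mule0.
have e0 : 0 <= 1 + x by rewrite addr_ge0.
have K0 : 0 <= expR t * (1 + x) by rewrite mulr_ge0 ?expR_ge0.
apply: (@le_trans _ _ (\int[P]_w ((expR t * (1 + x))%:E * (expR (- (1 * C (x, w))))%:E))%E).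
  apply: ge0_le_integral => //.
  - by move=> w _; rewrite lee_fin mulr_ge0.
  - have := measurableT_comp (mwl t) (measurable_pair1 x).
    by rewrite /wl /comp/= x0 (max_r x0).
  - by apply: measurable_funeM; apply/measurable_EFinP.
  move=> w _; rewrite lee_fin/=.
  have [Dt|_] := leP (D x w) t; last by rewrite mul0r !mulr_ge0 ?expR_ge0.
  rewrite [leLHS]mul1r mulrAC -expRD ler_peMl// mul1r /clamped_subordinator/= (max_r x0).
  by rewrite -[leLHS]expR0 ler_expR subr_ge0 ge_max t0.
rewrite ge0_integralZl//; last by apply/measurable_EFinP.
rewrite (laplace_clamped_subordinator SD)// -!EFinM lee_fin -[leLHS]mulrA -[leRHS]mulrA ler_pM2l ?expR_gt0//.
have -> : - (x * f 1) = - (f 1 / 2 * x) + - (f 1 / 2 * x) by field.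
rewrite expRD mulrA ler_pM2r ?expR_gt0//.
rewrite expRN ler_pdivrMr ?expR_gt0//.
have h := expR_ge1Dx (f 1 / 2 * x).
have y0 : 0 <= f 1 / 2 * x by rewrite mulr_ge0// divr_ge0// ltW.
have h1 : 2 / f 1 * (f 1 / 2 * x) = x by field; rewrite gt_eqF.
have h2 : 0 < 2 / f 1 by rewrite divr_gt0.
nra.
Qed.

Let integral_weighted_level t : 0 <= t -> (\int[P]_w \int[mu]_x wl t (x, w) < +oo)%E.
Proof.
move=> t0; rewrite -(fubini_tonelli (wl t) (mwl t) (wl_ge0 t)).
have c0 : 0 < f 1 / 2 by rewrite divr_gt0.
have me : measurable_fun [set: R] (fun x : R => if 0 <= x then expR (- (f 1 / 2 * x)) else 0).
  apply: measurable_fun_ifT => //; first exact: measurable_fun_ler.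
  by apply: measurableT_comp => //; apply: measurableT_comp => //; exact: measurable_funM.
have e0 x : 0 <= (if 0 <= x then expR (- (f 1 / 2 * x)) else 0) :> R by case: ifP.
have K0 : 0 <= expR t * (1 + 2 / f 1).
  by rewrite mulr_ge0 ?expR_ge0// addr_ge0// divr_ge0// ltW.
apply: (@le_lt_trans _ _ (\int[mu]_x ((expR t * (1 + 2 / f 1))%:E *
    (if (0 <= x)%R then expR (- (f 1 / 2 * x)) else 0)%:E))%E).
  apply: ge0_le_integral => //.
  - by move=> x _; apply: integral_ge0 => w _; exact: wl_ge0.
  - exact: (measurable_fun_fubini_tonelli_F (m2 := P) (wl t) (mwl t) (wl_ge0 t)).
  - by apply: measurable_funeM; apply/measurable_EFinP.
  - by move=> x _; exact: weighted_level.
rewrite ge0_integralZl//; last 2 first.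
- by apply/measurable_EFinP.
- by move=> x _; rewrite lee_fin.
have -> : (\int[mu]_x (if (0 <= x)%R then expR (- (f 1 / 2 * x)) else 0)%:E =
    \int[mu]_(x in `[0%R, +oo[) (expR (- (f 1 / 2 * (1 * x) `^ 1^-1)))%:E)%E.
  rewrite [RHS]integral_mkcond; apply: eq_integral => x _; rewrite patchE.
  case: ifPn => x0; first by rewrite mem_set/= ?in_itv/= ?x0// invr1 powRr1 mul1r.
  by rewrite memNset//= in_itv/= (negbTE x0).
by rewrite integral_expRN_powR_scale ?ltr01 ?lexx// -EFinM ltry.
Qed.

Let mG t : measurable_fun [set: T] (fun w => \int[mu]_x wl t (x, w))%E.
Proof. exact: (measurable_fun_fubini_tonelli_G (m1 := mu) (wl t) (mwl t) (wl_ge0 t)). Qed.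

Lemma subordinator_ae_unbounded t : 0 <= t ->
  {ae P, forall w, [set x | 0 <= x /\ t < D x w] !=set0}.
Proof.
move=> t0; have : P.-integrable setT (fun w => \int[mu]_x wl t (x, w))%E.
  apply/integrableP; split => //.
  by under eq_integral do rewrite gee0_abs ?integral_ge0//; exact: integral_weighted_level.
move=> /(integrable_ae measurableT); apply: filterS => w /(_ I) fin.
apply: contrapT => At; move: fin; apply/negP.
suff -> : (\int[mu]_x wl t (x, w) = +oo)%E by [].
apply/eqP; rewrite -leye_eq.
have -> : +oo%E = (\int[mu]_x (0 <= x)%R%:R%:E)%E.
  rewrite integral_ind; last by apply: measurable_fun_ler.
  have -> : [set x | 0 <= x] = `[0%R, +oo[%classic :> set R.
    by apply/seteqP; split => x /=; rewrite in_itv/= andbT.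
  by have /= -> := @lebesgue_measure_itv R `[0%R, +oo[; rewrite ltry.
apply: ge0_le_integral => //.
- by apply: measurable_ind; apply: measurable_fun_ler.
- by apply: (measurableT_comp (mwl t)); exact: measurable_pair2.
move=> x _; rewrite lee_fin /wl/=; have [x0|x0] := leP 0 x; last by rewrite mul0r.
have -> : D x w <= t by rewrite leNgt; apply/negP => tx; apply: At; exists x.
by rewrite mul1r lerDl.
Qed.

Lemma inverse_subordinator_second_moment_pos t : 0 <= t -> (\int[P]_w (H t w ^+ 2)%:E < +oo)%E.
Proof.
move=> t0.
have mH : measurable_fun setT (H t) by exact: measurable_inverse_subordinator.
have H0 w : 0 <= H t w by exact: inverse_subordinator_ge0.
(* On [[H/2, H[] the path is at most [t] and the weight at least [H/2]; as that interval has length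
   [H/2], the inner integral is at least [H^2 / 4]. *)
apply: (@le_lt_trans _ _ (\int[P]_w (4%:E * \int[mu]_x wl t (x, w)))%E); last first.
  by rewrite ge0_integralZl// ?lte_mul_pinfty ?integral_weighted_level// => w _; exact: integral_ge0.
apply: ge0_le_integral => //.
- by move=> w _; rewrite lee_fin sqr_ge0.
- by apply/measurable_EFinP; exact: measurable_funX.
- exact: measurable_funeM.
move=> w _; have Hw := H0 w; set h := H t w in Hw *.
have : ((h / 2 * (h / 2))%:E <= \int[mu]_x wl t (x, w))%E.
  apply: (@le_trans _ _ (\int[mu]_(x in `[(h / 2)%R, h[) wl t (x, w))%E); last first.
    apply: ge0_subset_integral => //.
    by apply: (measurableT_comp (mwl t)); exact: measurable_pair2.
  apply: (@le_trans _ _ (\int[mu]_(x in `[(h / 2)%R, h[) (h / 2)%:E)%E).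
    rewrite integral_cst//= lebesgue_measure_itv/= lte_fin.
    case: ifPn => [_|]; first by rewrite -EFinB -EFinM lee_fin; lra.
    rewrite -leNgt => hh; have -> : h = 0 by lra.
    by rewrite mule0 !mul0r.
  apply: ge0_le_integral => //.
  - by move=> x _; rewrite lee_fin divr_ge0.
  - by apply: measurable_funTS; apply: (measurableT_comp (mwl t)); exact: measurable_pair2.
  move=> x; rewrite /= in_itv/= => /andP[hx xh]; rewrite /wl/=.
  have x0 : 0 <= x by apply: le_trans hx; rewrite divr_ge0.
  rewrite x0/= max_r// (lt_inverse_subordinator x0 xh) mul1r lee_fin.
  by apply: le_trans hx _; rewrite lerDr.
have n4 : (0 <= 4%:E :> \bar R)%E by rewrite lee_fin.
move=> /(lee_wpmul2l n4); apply: le_trans.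
by rewrite -EFinM lee_fin; lra.
Qed.

End nondegenerate.

Lemma inverse_subordinator_second_moment t : 0 <= t -> (\int[P]_w (H t w ^+ 2)%:E < +oo)%E.
Proof.
move=> t0; have := subordinator_exponent_ge0; rewrite le_eqVlt => /orP[/eqP/esym f0|]; last first.
  by move=> f0; exact: inverse_subordinator_second_moment_pos.
have mH : measurable_fun setT (H t) by exact: measurable_inverse_subordinator.
suff -> : (\int[P]_w (H t w ^+ 2)%:E = \int[P]_w 0)%E by rewrite integral0 ltry.
apply: ge0_ae_eq_integral => //.
- by apply/measurable_EFinP; exact: measurable_funX.
- by move=> w _; rewrite lee_fin sqr_ge0.
apply: filterS (subordinator_degenerate f0) => w Dw _.
rewrite inverse_subordinator_out ?expr0n// => -[x [x0]].
by rewrite ltNge => /negP; apply; exact: le_trans (Dw _ x0) t0.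
Qed.

Lemma inverse_subordinator_ae_le s t : 0 <= s -> s <= t ->
  {ae P, forall w, H s w <= H t w}.
Proof.
move=> s0 st; have t0 := le_trans s0 st.
have := subordinator_exponent_ge0; rewrite le_eqVlt => /orP[/eqP/esym f0|f0]; last first.
  by apply: filterS (subordinator_ae_unbounded f0 t0) => w At; exact: inverse_subordinator_nd.
apply: filterS (subordinator_degenerate f0) => w Dw.
(* No level [s >= 0] is ever exceeded, so [H s] takes the default value 0. *)
rewrite [leLHS]inverse_subordinator_out ?inverse_subordinator_ge0// => -[x [x0]].
by rewrite ltNge => /negP; apply; exact: le_trans (Dw _ x0) s0.
Qed.

End inverse_subordinator_moments.

(** * The time-changed process *)

Lemma incBeta_ge0_homo (R : realType) (a x y : R) : 0 < a -> 0 <= x -> x <= y -> y <= 1 ->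
  0 <= incBeta a (a + 1) x <= incBeta a (a + 1) y.
Proof.
move=> a0 x0 xy y1; have y0 := le_trans x0 xy; have x1 := le_trans xy y1.
rewrite -!lee_fin -!integral_incBeta ?x0 ?y0//.
have nn (u : R) : (0 <= (u `^ (a - 1) * (1 - u) `^ (a + 1 - 1))%:E)%E.
  by rewrite lee_fin mulr_ge0 ?powR_ge0.
rewrite integral_ge0//=; apply: ge0_subset_integral => //.
  by apply: measurable_funTS; apply/measurable_EFinP; exact: measurable_beta_integrand.
by move=> u /=; rewrite !in_itv/= => /andP[-> /le_trans]; exact.
Qed.

(** The incomplete beta function is monotone on [[0, 1]], hence measurable once clamped to that
    interval; the ratio always lies there, its value being 0 when the denominator is 0. *)
Lemma measurable_incBeta_ratio (R : realType) d (T : measurableType d) (a : R) (x y : T -> R) :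
  0 < a -> measurable_fun setT x -> measurable_fun setT y ->
  (forall w, 0 <= x w) -> (forall w, x w <= y w \/ y w = 0) ->
  measurable_fun setT (fun w => incBeta a (a + 1) (x w / y w)).
Proof.
move=> a0 mx my x0 xy.
pose B (r : R) := incBeta a (a + 1) (Num.max 0 (Num.min 1 r)).
have mB : measurable_fun setT B.
  apply: nondecreasing_measurable => // r r' rr'; rewrite /B.
  have h : Num.max 0 (Num.min 1 r) <= Num.max 0 (Num.min 1 r').
    by rewrite ge_max !le_max lexx/= !le_min !ge_min lexx rr' !orbT/= ?orbT.
  apply: (andP (@incBeta_ge0_homo _ a _ _ a0 _ h _)).2; first by rewrite le_max lexx.
  by rewrite ge_max ler01 ge_min lexx.
have m2 : measurable_fun setT (fun w => x w / y w).
  apply: measurable_funM => //; have := measurableT_comp (measurable_powR (- 1)) my.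
  congr measurable_fun; apply/funext => w; rewrite /= powR_inv1//.
  by have [/(le_trans (x0 w))|->] := xy w.
have := measurableT_comp mB m2; congr measurable_fun; apply/funext => w; rewrite /= /B.
have r0 : 0 <= x w / y w.
  by have [h|->] := xy w; rewrite ?invr0 ?mulr0// divr_ge0// (le_trans (x0 w)).
have r1 : x w / y w <= 1.
  have [h|->] := xy w; last by rewrite invr0 mulr0.
  have [->|yn0] := eqVneq (y w) 0; first by rewrite invr0 mulr0.
  by rewrite ler_pdivrMr ?mul1r// lt_neqAle eq_sym yn0 (le_trans (x0 w)).
by rewrite min_r// max_r.
Qed.

(** Both exponents [alpha] and [2 alpha] lie in [[0, 2]], so the second moment of [H] dominates
    every power that occurs. *)
Lemma powR_le1sqr (R : realType) (r x : R) : 0 <= r <= 2 -> 0 <= x -> x `^ r <= 1 + x ^+ 2.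
Proof.
move=> /andP[r0 r2] x0; have [x1|/ltW x1] := leP x 1.
  apply: (@le_trans _ _ 1); last by rewrite lerDl sqr_ge0.
  have <- : 1 `^ r = 1 by rewrite powR1.
  by rewrite ge0_ler_powR// nnegrE.
apply: (@le_trans _ _ (x ^+ 2)); last by rewrite lerDr.
by rewrite -powR_mulrn// ler_powR.
Qed.

Section gfsp_inverse_subordinator.
Context {R : realType} {d : measure_display} {T : measurableType d}.
Variables (P : probability T R) (X D : R -> T -> R) (f : R -> R) (m1 m2 a : R).
Hypotheses (SX : second_order P X (gfsp_mean m1 a) (gfsp_corr m1 m2 a))
  (SD : is_subordinator P f D) (ind : indep_processes P X (inverse_subordinator D))
  (a0 : 0 < a) (a1 : a <= 1).
Local Notation H := (inverse_subordinator D).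
Local Notation G := (Gamma (1 + a)).
Local Notation l1 := (m1 / G).
Local Notation l2 := (m2 / G).
Local Notation K s t w := (H t w `^ (2 * a) * incBeta a (a + 1) (H s w / H t w)).

Let a01 : 0 <= a <= 2.
Proof. by rewrite ltW//= (le_trans a1)// ler1n. Qed.
Let a02 : 0 <= 2 * a <= 2.
Proof. by rewrite mulr_ge0 ?(ltW a0)//= ler_piMr. Qed.

Let H0 t w : 0 <= H t w. Proof. exact: inverse_subordinator_ge0. Qed.
Let D_nd := subordinator_nondecreasing SD.
Let mH t : measurable_fun setT (H t).
Proof.
by apply: measurable_inverse_subordinator => //; exact: (levy_measurable (subordinator_levy SD)).
Qed.

Let mHr r t : measurable_fun setT (fun w => H t w `^ r).
Proof. exact: (measurableT_comp (measurable_powR r) (mH t)). Qed.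

Let integrable_powR r t : 0 <= r <= 2 -> 0 <= t ->
  P.-integrable setT (fun w => (H t w `^ r)%:E).
Proof.
move=> r02 t0.
have iH2 : P.-integrable setT (fun w => (H t w ^+ 2)%:E).
  apply/integrableP; split; first by apply/measurable_EFinP; exact: measurable_funX.
  under eq_integral do rewrite gee0_abs ?lee_fin ?sqr_ge0//.
  exact: (inverse_subordinator_second_moment SD t0).
have i1 : P.-integrable setT (fun w => 1%:E) by exact: finite_measure_integrable_cst.
apply: (le_integrable measurableT _ _ (integrableD measurableT i1 iH2)).
  by apply/measurable_EFinP.
move=> w _; rewrite -EFinD !abse_EFin lee_fin ger0_norm ?powR_ge0//.
by rewrite ger0_norm ?addr_ge0 ?sqr_ge0// powR_le1sqr.
Qed.

Let ratio01 s t w : s <= t -> 0 <= H s w / H t w <= 1.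
Proof.
move=> st; have [h|->] := inverse_subordinator_le D w st; last by rewrite invr0 mulr0 lexx ler01.
rewrite divr_ge0//=; have [->|yn0] := eqVneq (H t w) 0; first by rewrite invr0 mulr0 ler01.
by rewrite ler_pdivrMr ?mul1r// lt_neqAle eq_sym yn0 H0.
Qed.

Let mK s t : s <= t -> measurable_fun setT (fun w => K s t w).
Proof.
move=> st; apply: measurable_funM => //; apply: measurable_incBeta_ratio => //.
by move=> w; exact: inverse_subordinator_le.
Qed.

Lemma integrable_powR_incBeta s t : 0 <= t -> s <= t ->
  P.-integrable setT (fun w => (K s t w)%:E).
Proof.
move=> t0 st.
apply: (le_integrable measurableT _ _ (integrableZl measurableT (incBeta a (a + 1) 1) (integrable_powR a02 t0))).
  by apply/measurable_EFinP; exact: mK.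
move=> w _; rewrite -EFinM !abse_EFin lee_fin.
have /andP[r0 r1] := ratio01 w st.
have /andP[b0 b1] := incBeta_ge0_homo a0 r0 r1 (lexx 1).
rewrite !ger0_norm ?mulr_ge0 ?powR_ge0//; last exact: le_trans b1.
by rewrite mulrC ler_wpM2r ?powR_ge0.
Qed.

Let corr_integral s t : 0 <= s -> s <= t ->
  (\int[P]_w (gfsp_corr m1 m2 a (H s w) (H t w))%:E =
   l2%:E * \int[P]_w (H s w `^ a)%:E +
   (a * l1 ^+ 2 * Beta a (1 + a))%:E * \int[P]_w (H s w `^ (2 * a))%:E +
   (l1 ^+ 2 * a)%:E * \int[P]_w (K s t w)%:E)%E.
Proof.
move=> s0 st; have t0 := le_trans s0 st.
have i1 : P.-integrable setT (fun w => (H s w `^ a)%:E).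
  exact: integrable_powR.
have i2 : P.-integrable setT (fun w => (H s w `^ (2 * a))%:E).
  exact: integrable_powR.
have i3 := integrable_powR_incBeta t0 st.
rewrite -!integralZl// -integralD//; [|exact: integrableZl|exact: integrableZl].
rewrite -integralD//; last 2 first.
- by apply: integrableD => //; exact: integrableZl.
- exact: integrableZl.
Qed.

Let corr_fin t : 0 <= t -> (\int[P]_w (gfsp_corr m1 m2 a (H t w) (H t w))%:E < +oo)%E.
Proof.
move=> t0; rewrite corr_integral//.
have i1 : P.-integrable setT (fun w => (H t w `^ a)%:E).
  exact: integrable_powR.
have i2 : P.-integrable setT (fun w => (H t w `^ (2 * a))%:E).
  exact: integrable_powR.
have i3 := integrable_powR_incBeta t0 (lexx t).
have f1 := integrable_fin_num measurableT i1; have f2 := integrable_fin_num measurableT i2.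
have f3 := integrable_fin_num measurableT i3.
by rewrite ltey_eq !fin_numD !fin_numM.
Qed.

Let Z t w := X (H t w) w.

Let mHH t : 0 <= t -> measurable_fun setT (H t). Proof. by []. Qed.

Let integrableZZ s t : 0 <= s -> 0 <= t -> P.-integrable setT (fun w => (Z s w * Z t w)%:E).
Proof.
by move=> s0 t0; case: (time_change_corr SX H0 mHH ind s0 t0 (corr_fin s0) (corr_fin t0)).
Qed.

Lemma integrable_gfsp_inverse_subordinator t : 0 <= t -> P.-integrable setT (fun w => (Z t w)%:E).
Proof.
move=> t0; have i1 : P.-integrable setT (fun w => 1%:E) by exact: finite_measure_integrable_cst.
apply: (le_integrable measurableT _ _ (integrableD measurableT i1 (integrableZZ t0 t0))).
  by apply/measurable_EFinP; exact: (measurable_time_change SX H0 mHH).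
move=> w _; rewrite -EFinD !abse_EFin lee_fin [leRHS]ger0_norm.
  by rewrite ler_norml; apply/andP; split; nra.
by rewrite addr_ge0// -expr2 sqr_ge0.
Qed.

Lemma gfsp_inverse_subordinator_mean t : 0 <= t ->
  ('E_P[Z t] = l1%:E * 'E_P[(fun w => (H t w `^ a)%R)])%E.
Proof.
move=> t0; rewrite unlock.
rewrite (time_change_mean SX H0 mHH ind t0 t0 (corr_fin t0) (corr_fin t0)).
by rewrite -integralZl//; exact: integrable_powR.
Qed.

(** The mean of [gfsp_corr] at the two random times, minus the product of the means. The almost sure
    order of [H s] and [H t] removes the minimum and maximum left by the time change. *)
Lemma gfsp_inverse_subordinator_covariance s t : 0 <= s -> s <= t ->
  (covariance P (Z s) (Z t) =
   l2%:E * 'E_P[(fun w => (H s w `^ a)%R)] +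
   (a * l1 ^+ 2 * Beta a (1 + a))%:E * 'E_P[(fun w => (H s w `^ (2 * a))%R)]
   - (l1 ^+ 2)%:E * 'E_P[(fun w => (H s w `^ a)%R)] * 'E_P[(fun w => (H t w `^ a)%R)] +
   (l1 ^+ 2 * a)%:E * 'E_P[(fun w => (K s t w)%R)])%E.
Proof.
move=> s0 st; have t0 := le_trans s0 st.
rewrite covarianceE; last 3 first.
- by apply/Lfun1_integrable; exact: integrable_gfsp_inverse_subordinator.
- by apply/Lfun1_integrable; exact: integrable_gfsp_inverse_subordinator.
- by apply/Lfun1_integrable; exact: integrableZZ.
rewrite !gfsp_inverse_subordinator_mean//.
have -> : ('E_P[(Z s * Z t)%R] = l2%:E * 'E_P[(fun w => (H s w `^ a)%R)] +
   (a * l1 ^+ 2 * Beta a (1 + a))%:E * 'E_P[(fun w => (H s w `^ (2 * a))%R)] +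
   (l1 ^+ 2 * a)%:E * 'E_P[(fun w => (K s t w)%R)])%E.
  rewrite unlock -corr_integral//.
  rewrite (time_change_corr SX H0 mHH ind s0 t0 (corr_fin s0) (corr_fin t0)).2.
  have mc (x y : T -> R) : measurable_fun setT x -> measurable_fun setT y ->
      (forall w, 0 <= x w) -> (forall w, x w <= y w \/ y w = 0) ->
      measurable_fun setT (fun w => (gfsp_corr m1 m2 a (x w) (y w))%:E).
    move=> mx my x0 xy; apply/measurable_EFinP; rewrite /gfsp_corr.
    have mpow r (z : T -> R) : measurable_fun setT z -> measurable_fun setT (fun w => z w `^ r).
      by move=> mz; exact: (measurableT_comp (measurable_powR r) mz).
    apply: measurable_funD; first by apply: measurable_funD; apply: measurable_funM => //; exact: mpow.
    apply: measurable_funM => //; apply: measurable_funM; first exact: mpow.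
    exact: measurable_incBeta_ratio.
  apply: ae_eq_integral => //.
  - apply: mc; [exact: measurable_minr|exact: measurable_maxr| |].
      by move=> w; rewrite le_min !H0.
    by move=> w; left; rewrite le_max ge_min lexx.
  - by apply: mc => // w; exact: inverse_subordinator_le.
  apply: filterS (inverse_subordinator_ae_le SD s0 st) => w Hst _.
  by rewrite (min_l Hst) (max_r Hst).
have fin r u : 0 <= r <= 2 -> 0 <= u -> ('E_P[(fun w => (H u w `^ r)%R)] \is a fin_num)%E.
  by move=> r02 u0; rewrite unlock; apply: integrable_fin_num => //; exact: integrable_powR.
have finK : ('E_P[(fun w => (K s t w)%R)] \is a fin_num)%E.
  by rewrite unlock; apply: integrable_fin_num => //; exact: integrable_powR_incBeta.
(* All expectations are finite, so the rearrangement can be done in the ring [R]. *)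
rewrite -(fineK finK) -(fineK (fin a s a01 s0)) -(fineK (fin a t a01 t0)) -(fineK (fin (2 * a) s a02 s0)).
rewrite -!EFinM -!EFinD; congr (_%:E); ring.
Qed.

(** The covariance at [s = t]: the ratio is 1 except where [H t = 0], and there the power vanishes.
    The incomplete beta term thus becomes a second copy of the complete one, whence the factor 2. *)
Lemma gfsp_inverse_subordinator_variance t : 0 <= t ->
  let EH := ('E_P[(fun w => (H t w `^ a)%R)])%E in
  ('V_P[Z t] = EH * (l2%:E - (l1 ^+ 2)%:E * EH) +
   (2 * (a * l1 ^+ 2 * Beta a (1 + a)))%:E * 'E_P[(fun w => (H t w `^ (2 * a))%R)])%E.
Proof.
move=> t0 EH; rewrite /variance gfsp_inverse_subordinator_covariance//.
have -> : (fun w => K t t w) = (fun w => incBeta a (a + 1) 1 * H t w `^ (2 * a)).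
  apply/funext => w; have [->|hn0] := eqVneq (H t w) 0; last by rewrite divff// mulrC.
  by rewrite powR0 ?mulr0 ?mul0r// gt_eqF// mulr_gt0.
have fin r : 0 <= r <= 2 -> ('E_P[(fun w => (H t w `^ r)%R)] \is a fin_num)%E.
  by move=> r02; rewrite unlock; apply: integrable_fin_num => //; exact: integrable_powR.
have -> : ('E_P[(fun w => (incBeta a (a + 1) 1 * H t w `^ (2 * a))%R)] =
    (incBeta a (a + 1) 1)%:E * 'E_P[(fun w => (H t w `^ (2 * a))%R)])%E.
  by rewrite unlock -integralZl//; exact: integrable_powR.
rewrite -/EH /Beta (addrC 1 a); have := fin _ a01; rewrite -/EH => fE.
rewrite -(fineK fE) -(fineK (fin _ a02)).
rewrite -!(EFinM, EFinD, EFinN); congr (_%:E); ring.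
Qed.

End gfsp_inverse_subordinator.

Theorem mainTheorem20 (R : realType) (disp : measure_display)
    (T : measurableType disp) (P : probability T R)
    (k : nat) (lam mu : 'I_k -> R) (alpha : R) (f : R -> R)
    (Salpha Df : R -> T -> R)
    (k_ge1 : (1 <= k)%N)
    (lam_gt0 : forall j, 0 < lam j) (mu_gt0 : forall j, 0 < mu j)
    (alpha_gt0 : 0 < alpha) (alpha_le1 : alpha <= 1)
    (Salpha_gfsp : is_gfsp P alpha lam mu Salpha)
    (Df_subordinator : is_subordinator P f Df)
    (Salpha_Hf_indep : indep_processes P Salpha (inverse_subordinator Df)) :
  let H := inverse_subordinator Df in
  let Z := fun t w => Salpha (H t w) w in
  let m1 := \sum_(j < k) j.+1%:R * (lam j - mu j) in
  let m2 := \sum_(j < k) j.+1%:R ^+ 2 * (lam j + mu j) in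
  let l1 := m1 / Gamma (1 + alpha) in
  let l2 := m2 / Gamma (1 + alpha) in
  let d := alpha * l1 ^+ 2 * Beta alpha (1 + alpha) in
  let EH := fun r t : R => ('E_P[(fun w => (H t w `^ r)%R)])%E in
  forall s t : R, 0 < s -> s <= t ->
  [/\ ('E_P[Z t] = l1%:E * EH alpha t)%E,
      ('V_P[Z t] = EH alpha t * (l2%:E - (l1 ^+ 2)%:E * EH alpha t)
                   + (2 * d)%:E * EH (2 * alpha)%R t)%E &
      (covariance P (Z s) (Z t) =
         l2%:E * EH alpha s + d%:E * EH (2 * alpha)%R s
         - (l1 ^+ 2)%:E * EH alpha s * EH alpha t
         + (l1 ^+ 2 * alpha)%:E *
           'E_P[(fun w => (H t w `^ (2 * alpha)
                           * incBeta alpha (alpha + 1) (H s w / H t w))%R)])%E].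
Proof.
move=> H Z m1 m2 l1 l2 d EH s t /ltW s0 st; have t0 := le_trans s0 st.
have SX := gfsp_second_order lam_gt0 mu_gt0 Salpha_gfsp.
split.
- exact: (gfsp_inverse_subordinator_mean SX Df_subordinator Salpha_Hf_indep).
- exact: (gfsp_inverse_subordinator_variance SX Df_subordinator Salpha_Hf_indep).
- exact: (gfsp_inverse_subordinator_covariance SX Df_subordinator Salpha_Hf_indep).
Qed.
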